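(* There exist positive constants $\gamma_0,\gamma_1,\gamma_2$ such that the following holds. Let $\kappa>0$ and let $T_1,T_2>0$ satisfy (C1) $\kappa^2T_1>\gamma_2$ and (C2) $\sqrt{T_2}-\sqrt{T_1}\ge\gamma_1\kappa^{1/2}T_2^{1/4}$. Then there exists a steady state $f=f(x,v)$, $x\in(0,1)$, $v\in\mathbb{R}$, of the nonlinear BGK equation with diffusive boundary conditions, that is, a (non-negative, unit mass) solution of $$v\,\partial_x f=\frac1\kappa\left(\rho_f\mathcal{M}_{T_f}-f\right),$$ $$f(0,v)=\widetilde{\mathcal{M}}_1(v)\int_{v'<0}|v'|f(0,v')\,dv'\quad(v>0),\qquad f(1,v)=\widetilde{\mathcal{M}}_2(v)\int_{v'>0}|v'|f(1,v')\,dv'\quad(v<0).$$ Furthermore this steady state has the following properties: (i) it has zero momentum: $\int_{\mathbb{R}}v f(x,v)\,dv=0$ for all $x\in(0,1)$; (ii) for all $x\in(0,1)$, $$1-\gamma_0\kappa^{-1/2}T_1^{-1/4}\le\rho_f(x)\le1+\gamma_1\kappa^{-1/2}T_1^{-1/4},\qquad \sqrt{T_1T_2}\lesssim P_f(x)\lesssim\sqrt{T_1T_2};$$ (iii) the temperature profile $T_f$ is $1/2$-Hölder continuous on $(0,1)$ and, for all $x\in(0,1)$, $$\sqrt{T_1T_2}\left(1-\gamma_1\kappa^{-1/2}T_1^{-1/4}\right)\lesssim T_f(x)\lesssim\sqrt{T_1T_2}\left(1+\gamma_0\kappa^{-1/2}T_1^{-1/4}\right).$$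
   Context: For a non-negative function $f(x,v)$ on $(0,1)\times\mathbb{R}$: $\rho_f(x)=\int_{\mathbb{R}}f(x,v)\,dv$ is the spatial density, $P_f(x)=\int_{\mathbb{R}}v^2f(x,v)\,dv$ is the pressure, and $T_f(x)$ is the local temperature, defined by $\rho_f(x)T_f(x)=P_f(x)$. For $T>0$, $\mathcal{M}_T(v)=(2\pi T)^{-1/2}e^{-v^2/(2T)}$; in the equation $\mathcal{M}_{T_f}$ means $\mathcal{M}_{T_f(x)}(v)$. For $i=1,2$, $\widetilde{\mathcal{M}}_i(v)=\frac1{T_i}e^{-v^2/(2T_i)}$, normalised so that $\int_0^\infty v\widetilde{\mathcal{M}}_i(v)\,dv=1$. The number $\kappa$ is the Knudsen number. $A\lesssim B$ means $A\le CB$ for a constant $C>0$ depending only on $T_1,T_2$. Unit mass means $\int_0^1\int_{\mathbb{R}}f\,dv\,dx=1$. The stationary equation is understood along characteristics: for $v\ne0$, $x\mapsto f(x,v)$ is absolutely continuous on $[0,1]$ and satisfies the equation for a.e. $x$; the half-fluxes in the boundary conditions are finite. *)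

(* Defs.v *)
From mathcomp Require Import all_boot all_order all_algebra.
From mathcomp Require Import all_classical all_reals all_analysis.

Set Implicit Arguments.
Unset Strict Implicit.
Unset Printing Implicit Defensive.

Import Order.TTheory GRing.Theory Num.Theory.
Import numFieldNormedType.Exports.

#[global] Open Scope classical_set_scope.
#[global] Open Scope ring_scope.

Definition maxwellian (R : realType) (T v : R) : R :=
  (2 * pi * T) `^ (- 2^-1) * expR (- v ^+ 2 / (2 * T)).

(* Normalised by its flux: v * wall_maxwellian T v has integral 1 on v > 0. *)
Definition wall_maxwellian (R : realType) (T v : R) : R :=
  T^-1 * expR (- v ^+ 2 / (2 * T)).

(* Kinetic densities are total functions f x v; only the values at
   0 <= x <= 1 are ever used. [Rintegral] is 0 on an infinite integral, so
   finiteness of the moments is demanded separately, in [steady_state]. *)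
Definition density (R : realType) (f : R -> R -> R) (x : R) : R :=
  \int[lebesgue_measure]_v f x v.

Definition pressure (R : realType) (f : R -> R -> R) (x : R) : R :=
  \int[lebesgue_measure]_v (v ^+ 2 * f x v).

Definition momentum (R : realType) (f : R -> R -> R) (x : R) : R :=
  \int[lebesgue_measure]_v (v * f x v).

Definition temperature (R : realType) (f : R -> R -> R) (x : R) : R :=
  pressure f x / density f x.

Lemma density_temperature (R : realType) (f : R -> R -> R) (x : R) :
  0 < density f x -> density f x * temperature f x = pressure f x.
Proof. by move=> f0; rewrite mulrC divfK// gt_eqF. Qed.

Definition absolutely_continuous (R : realType) (a b : R) (g : R -> R) : Prop :=
  forall eps : R, 0 < eps -> exists2 delta : R, 0 < delta &
    forall (n : nat) (l r : 'I_n -> R),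
      (forall i, a <= l i /\ l i <= r i /\ r i <= b) ->
      trivIset setT (fun i => [set` `]l i, r i[]) ->
      \sum_(i < n) (r i - l i) < delta ->
      \sum_(i < n) `|g (r i) - g (l i)| < eps.

Definition holder_continuous (R : realType) (alpha : R) (A : set R)
    (g : R -> R) : Prop :=
  exists K : R, forall x y : R, A x -> A y ->
    `|g x - g y| <= K * `|x - y| `^ alpha.

(* Non-negative solution of unit mass of
     v d_x f = kappa^-1 (rho_f M_{T_f} - f)  on (0,1) x R,
   along characteristics, with diffusive boundary conditions at wall
   temperatures T1 (at x = 0) and T2 (at x = 1). Finiteness of the density and
   of the pressure and positivity of the density make T_f meaningful. *)
Record steady_state (R : realType) (kappa T1 T2 : R) (f : R -> R -> R) : Prop :=
  SteadyState {
  ss_measurable : measurable_fun ([set x : R | 0 <= x <= 1] `*` [set: R])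
    (fun p : R * R => f p.1 p.2) ;
  ss_ge0 : forall x v : R, 0 <= x <= 1 -> 0 <= f x v ;
  ss_density_fin : forall x : R, 0 < x < 1 ->
    lebesgue_measure.-integrable setT (fun v : R => (f x v)%:E) ;
  ss_pressure_fin : forall x : R, 0 < x < 1 ->
    lebesgue_measure.-integrable setT (fun v : R => (v ^+ 2 * f x v)%:E) ;
  ss_density_gt0 : forall x : R, 0 < x < 1 -> 0 < density f x ;
  ss_unit_mass : \int[lebesgue_measure]_(x in `]0%R, 1%R[) density f x = 1 ;
  ss_absolutely_continuous : forall v : R, v != 0 ->
    absolutely_continuous 0 1 (f ^~ v) ;
  ss_bgk : forall v : R, v != 0 ->
    {ae lebesgue_measure, forall x : R, 0 < x < 1 ->
      derivable (f ^~ v) x 1 /\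
      v * derive1 (f ^~ v) x =
        kappa^-1 * (density f x * maxwellian (temperature f x) v - f x v)} ;
  ss_flux0_fin : lebesgue_measure.-integrable `]-oo, 0%R[
    (fun v : R => (`|v| * f 0 v)%:E) ;
  ss_flux1_fin : lebesgue_measure.-integrable `]0%R, +oo[
    (fun v : R => (`|v| * f 1 v)%:E) ;
  ss_boundary0 : forall v : R, 0 < v ->
    f 0 v = wall_maxwellian T1 v *
      \int[lebesgue_measure]_(w in `]-oo, 0%R[) (`|w| * f 0 w) ;
  ss_boundary1 : forall v : R, v < 0 ->
    f 1 v = wall_maxwellian T2 v *
      \int[lebesgue_measure]_(w in `]0%R, +oo[) (`|w| * f 1 w)
}.

(* Main.v *)
Require Import Defs.
From mathcomp Require Import all_boot all_order all_algebra.
From mathcomp Require Import all_classical all_reals all_analysis.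
From mathcomp Require Import measurable_realfun ring lra.
Set Implicit Arguments.
Unset Strict Implicit.
Unset Printing Implicit Defensive.
Import Order.TTheory GRing.Theory Num.Theory.
Import numFieldNormedType.Exports.
Local Open Scope classical_set_scope.
Local Open Scope ring_scope.

(** The equation conserves two moments. Integrating it against 1 shows that the
    flux of f is constant in x, and the diffusive walls make it vanish;
    integrating it against v then shows that the pressure is constant. Since
    T = P / rho, and since multiplying f by a constant leaves T unchanged, the
    pressure may be normalised to 1. The only unknown left is the density rho:
    the Maxwellian in the equation becomes [source (rho x) v], with temperature
    1 / rho x.

    Conversely, let a continuous density rho be given. The equation is then
    linear and is solved along each characteristic by Duhamel's formula
    ([beam]), once the fluxes J1 and J2 emitted by the two walls are known.
    They are chosen ([inflow1], [inflow2]) so that at x = 1 the total flux is 0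
    and the pressure is 1. The density of the solution is [density_map rho]. If
    rho is a fixed point of this map, then the collision term has no mass, the
    flux vanishes everywhere ([profile_flux]), hence the pressure is 1
    everywhere ([profile_pressure]), so the temperature is 1 / rho and the
    equation is the nonlinear one. Division by the mass gives the steady state.

    The fixed point exists because the gas is almost in free flight. Put
    s1 = sqrt T1, s2 = sqrt T2, s ^ 2 = s1 * s2 and
    eta = kappa ^ (-1/2) * T1 ^ (-1/4), a small number since kappa ^ 2 * T1 is
    large. Without collisions the density would be the constant s ^ -2. A
    particle of speed v collides about 1 / (kappa v) times, and
    1 / kappa = eta ^ 2 * s1, so that only particles slower than s * eta are
    really affected. Treating these separately ([int_pos_split_bound]) shows
    that collisions change the density by a relative amount O(eta)
    ([density_map_bound]), and also, as [source] is Lipschitz in the density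
    ([source_lip]), that the map is a contraction ([density_map_diff]). The
    same splitting, at the speed sqrt |x - y|, shows that the density of the
    solution is 1/2-Hoelder in x, uniformly in rho ([density_map_holder]). So
    the iteration stays in a set of Hoelder functions that is closed under
    pointwise limits ([density_fixed_point]), and its limit has all the
    required properties. *)

(** * Contraction in the pointwise topology *)
Section picard.
Context {R : realType} {T : Type}.

Lemma cvg_geometric_rate (u : nat -> R) (q D : R) : 0 <= q < 1 ->
  (forall n k, `|u (n + k)%N - u n| <= q ^+ n * D) ->
  exists l : R, u n @[n --> \oo] --> l.
Proof.
move=> /andP[q0 q1] uC.
have D0 : 0 <= D by have := uC 0%N 0%N; rewrite subrr normr0 expr0 mul1r.
have qD0 : (q ^+ n * D) @[n --> \oo] --> (0 : R).
  rewrite -[X in _ --> X](mul0r D).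
  by apply: cvgMl; apply: cvg_expr; rewrite ger0_norm.
suff : cvgn u by move=> /cvg_ex.
apply/cauchy_cvgP/cauchy_ballP => _ /posnumP[e].
rewrite near_map2.
have : \forall n \near \oo, q ^+ n * D < e%:num / 2.
  have := cvgr_lt _ qD0; apply; exact: divr_gt0.
move=> [N _ HN].
exists ((fun n => is_true (N <= n)%N), (fun n => is_true (N <= n)%N)); first by split; exists N.
move=> [m n] /= [Nm Nn].
have step k : (N <= k)%N -> `|u k - u N| < e%:num / 2.
  by move=> /subnKC <-; exact: le_lt_trans (uC _ _) (HN _ (leqnn N)).
rewrite /ball/= (splitr e%:num).
rewrite -(subrKA (u N)) (le_lt_trans (ler_normD _ _))//.
by rewrite ltrD// ?step// distrC step.
Qed.

(** Banach's principle for the uniform distance on functions. The limit is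
    formed point by point, so it is enough that [U] is closed under pointwise
    convergence; [D] makes the distances to the starting point finite. *)
Lemma picard_fixed_point (U : set (T -> R)) (F : (T -> R) -> T -> R)
    (u0 : T -> R) (q D : R) :
  0 <= q < 1 -> U u0 -> (forall u, U u -> U (F u)) ->
  (forall (u w : T -> R) (d : R), U u -> U w -> (forall z, `|u z - w z| <= d) ->
     forall z, `|F u z - F w z| <= q * d) ->
  (forall u, U u -> forall z, `|u z - u0 z| <= D) ->
  (forall (u_ : nat -> T -> R) (u : T -> R), (forall n, U (u_ n)) ->
     (forall z, u_ n z @[n --> \oo] --> u z) -> U u) ->
  exists2 u, U u & forall z, F u z = u z.
Proof.
move=> /[dup] q01 /andP[q0 q1] Uu0 UF Fq UD Ucl.
pose u_ n := iter n F u0.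
have Uu_ n : U (u_ n) by elim: n => //= n; exact: UF.
have uC n k z : `|u_ (n + k)%N z - u_ n z| <= q ^+ n * D.
  elim: n z => [|n IH] z; first by rewrite add0n expr0 mul1r UD.
  by rewrite exprS -mulrA; exact: Fq.
have uL z : exists l : R, u_ n z @[n --> \oo] --> l.
  by apply: (@cvg_geometric_rate _ q D) => // n k; exact: uC.
have {}uL : forall z, exists l : R, u_ n z @[n --> \oo] --> l := uL.
pose u z := xget 0 [set l | u_ n z @[n --> \oo] --> l].
have ucvg z : u_ n z @[n --> \oo] --> u z.
  by rewrite /u; case: xgetP => [l _ //|nex]; have [l /nex] := uL z.
have Uu : U u by exact: Ucl Uu_ ucvg.
exists u => // z.
have uB n y : `|u_ n y - u y| <= q ^+ n * D.
  rewrite distrC; have cu : `|u_ k y - u_ n y| @[k --> \oo] --> `|u y - u_ n y|.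
    by apply: cvg_norm; apply: cvgB; [exact: ucvg|exact: cvg_cst].
  rewrite -(cvg_lim _ cu)//; apply: limr_le; first by apply/cvg_ex; exists `|u y - u_ n y|.
  exists n => // k /= /subnKC <-; exact: uC.
have qD0 : (q ^+ n * D) @[n --> \oo] --> (0 : R).
  rewrite -[X in _ --> X](mul0r D).
  by apply: cvgMl; apply: cvg_expr; rewrite ger0_norm.
have cu1 : (u_ n.+1 z @[n --> \oo]) --> u z.
  by rewrite (cvg_shiftS (fun n => u_ n z)); exact: ucvg.
suff cF : (u_ n.+1 z @[n --> \oo]) --> F u z by exact: (cvg_unique _ cF cu1).
apply/cvgrPdist_le => e e0.
have [N _ HN] := cvgr_le _ qD0 _ e0; exists N => // n /HN /= qDe.
apply: le_trans qDe; rewrite distrC /=.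
have := Fq _ _ _ (Uu_ n) Uu (uB n) z => /le_trans; apply.
by rewrite ler_piMl ?(ltW q1)// (le_trans _ (uB n z)).
Qed.

End picard.

(** * Integrals over positive velocities *)
Section half_line.
Context {R : realType}.
Implicit Types (h w : R -> R).
Local Notation mu := (@lebesgue_measure R).

(** Every velocity integral is reduced to positive velocities, because the two
    signs of v are solved from opposite walls. *)
Definition integrable_pos h : Prop := mu.-integrable `]0%R, +oo[ (EFin \o h).
Definition int_pos h : R := \int[mu]_(v in `]0%R, +oo[) h v.
Definition measurable_pos h : Prop := measurable_fun (`]0%R, +oo[ : set R) h.

Lemma integrable_pos_dom h w : measurable_pos h ->
  (forall v, 0 < v -> `|h v| <= w v) -> integrable_pos w -> integrable_pos h.
Proof.
move=> mh hw iw; apply: le_integrable iw => //=; first exact/measurable_EFinP.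
move=> v /=; rewrite in_itv/= andbT => v0.
by rewrite lee_fin (le_trans (hw _ v0))// ler_norm.
Qed.

Lemma integrable_pos_norm h : integrable_pos h -> integrable_pos (fun v => `|h v|).
Proof. exact: integrable_norm. Qed.

Lemma integrable_pos_measurable h : integrable_pos h -> measurable_pos h.
Proof. by move=> /(measurable_int mu) /measurable_EFinP. Qed.

Lemma integrable_posZ a h : integrable_pos h -> integrable_pos (fun v => a * h v).
Proof.
rewrite /integrable_pos => ih; have : mu.-integrable `]0%R, +oo[ (fun v => a%:E * (EFin \o h) v)%E.
  exact: integrableZl.
by apply: eq_integrable => // v _; rewrite /= EFinM.
Qed.

Lemma integrable_posD h w : integrable_pos h -> integrable_pos w ->
  integrable_pos (fun v => h v + w v).
Proof.
rewrite /integrable_pos => ih iw; have : mu.-integrable `]0%R, +oo[ ((EFin \o h) \+ (EFin \o w))%E.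
  exact: integrableD.
by apply: eq_integrable => // v _; rewrite /= EFinD.
Qed.

Lemma integrable_posB h w : integrable_pos h -> integrable_pos w ->
  integrable_pos (fun v => h v - w v).
Proof.
rewrite /integrable_pos => ih iw; have : mu.-integrable `]0%R, +oo[ ((EFin \o h) \- (EFin \o w))%E.
  exact: integrableB.
by apply: eq_integrable => // v _; rewrite /= EFinB.
Qed.

Lemma int_posZ a h : integrable_pos h -> int_pos (fun v => a * h v) = a * int_pos h.
Proof. by move=> ih; rewrite /int_pos RintegralZl. Qed.

Lemma int_posD h w : integrable_pos h -> integrable_pos w ->
  int_pos (fun v => h v + w v) = int_pos h + int_pos w.
Proof. by move=> ih iw; rewrite /int_pos RintegralD. Qed.

Lemma int_posB h w : integrable_pos h -> integrable_pos w ->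
  int_pos (fun v => h v - w v) = int_pos h - int_pos w.
Proof. by move=> ih iw; rewrite /int_pos RintegralB. Qed.

Lemma int_pos_le h w : integrable_pos h -> integrable_pos w ->
  (forall v, 0 < v -> h v <= w v) -> int_pos h <= int_pos w.
Proof.
move=> ih iw hw; apply: le_Rintegral => //.
by move=> v /=; rewrite in_itv/= andbT; exact: hw.
Qed.

Lemma int_pos_norm_le h w : measurable_pos h ->
  (forall v, 0 < v -> `|h v| <= w v) -> integrable_pos w ->
  `|int_pos h| <= int_pos w.
Proof.
move=> mh hw iw; have ih := integrable_pos_dom mh hw iw.
apply: le_trans (le_normr_Rintegral _ ih) _ => //.
by apply: int_pos_le => //; exact: integrable_pos_norm.
Qed.

Lemma int_pos_ge0 h : (forall v, 0 < v -> 0 <= h v) -> 0 <= int_pos h.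
Proof.
move=> h0; apply: Rintegral_ge0 => v /=; rewrite in_itv/= andbT; exact: h0.
Qed.

Lemma eq_int_pos h w : (forall v, 0 < v -> h v = w v) -> int_pos h = int_pos w.
Proof.
move=> hw; apply: eq_Rintegral => v; rewrite inE/= in_itv/= andbT; exact: hw.
Qed.

Lemma eq_integrable_pos h w : (forall v, 0 < v -> h v = w v) ->
  integrable_pos h -> integrable_pos w.
Proof.
move=> hw; apply: eq_integrable => // v.
by rewrite inE/= in_itv/= andbT => v0; rewrite hw.
Qed.

Lemma int_pos_itv (d : R) : 0 < d ->
  integrable_pos \1_`]0%R, d] /\ int_pos \1_`]0%R, d] = d.
Proof.
move=> d0; split.
  apply: (@integrableS _ _ _ _ setT) => //.
  exact: integrable_indic_itv.
rewrite /int_pos /Rintegral integral_indic//= setIidl; last first.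
  by move=> v /=; rewrite !in_itv/= => /andP[->].
by rewrite lebesgue_measure_itv/= lte_fin d0/= subr0.
Qed.

(** The factor l / v, typically a number of collisions, is small for fast
    velocities but not integrable at v = 0. So it is used only above the speed
    d; below, the plain bound A costs A * d. Taking d of order sqrt l makes
    both terms of order sqrt l, which is the source of the powers 1/2 in the
    theorem. *)
Lemma int_pos_split_bound h w (A l d : R) : 0 <= l -> 0 < d ->
  measurable_pos h -> integrable_pos w ->
  (forall v, 0 < v -> 0 <= w v <= A) ->
  (forall v, 0 < v -> `|h v| <= w v) ->
  (forall v, 0 < v -> `|h v| <= w v * (l / v)) ->
  `|int_pos h| <= A * d + l / d * int_pos w.
Proof.
move=> l0 d0 mh iw w0 hw hwl.
have A0 : 0 <= A by have /andP[]:= w0 1 ltr01; exact: le_trans.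
have [ind intd] := int_pos_itv d0.
rewrite -[X in A * X]intd -int_posZ// -int_posZ// -int_posD//; last 2 first.
- exact: integrable_posZ.
- exact: integrable_posZ.
apply: int_pos_norm_le => //; last first.
  by apply: integrable_posD; exact: integrable_posZ.
move=> v v0; rewrite indicE.
have [/andP[w0v wA]] := (w0 _ v0, ltW v0).
case: (leP v d) => vd _.
  rewrite mem_set/=; last by rewrite in_itv/= v0.
  by rewrite mulr1 (le_trans (hw _ v0))// (le_trans wA)// lerDl mulr_ge0// divr_ge0// ltW.
rewrite memNset/=; last by rewrite in_itv/= v0/=; apply/negP; rewrite -ltNge.
rewrite mulr0 add0r (le_trans (hwl _ v0))// mulrC ler_wpM2r//.
by rewrite ler_wpM2l// lef_pV2// ltW.
Qed.

(** The invariance of Lebesgue measure under v -> - v, in the form that brings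
    the incoming flux at the left wall back to positive velocities. *)
Lemma integral_reflect h : measurable_fun setT h -> integrable_pos (fun v => h (- v)) ->
  mu.-integrable `]-oo, 0%R[ (EFin \o h) /\
  \int[mu]_(v in `]-oo, 0%R[) h v = int_pos (fun v => h (- v)).
Proof.
move=> mh ih.
have preE : `]-oo, 0%R[%classic =
    (-%R : _ -> measurableTypeR R) @^-1` `]0%R, +oo[.
  by rewrite opp_preimage_itvbndy oppr0.
have mhN : measurable_fun setT (fun v : R => h (- v)).
  by apply: (measurableT_comp mh).
have mhNe : measurable_fun setT (fun v : R => `|h (- v)|%:E).
  by apply/measurable_EFinP; apply: measurableT_comp.
have intN : mu.-integrable `]-oo, 0%R[ (EFin \o h).
  apply/integrableP; split.
    by apply/measurable_EFinP; exact: measurable_funTS.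
  move/integrableP : ih => [_]; apply: le_lt_trans.
  rewrite le_eqVlt; apply/orP; left; apply/eqP.
  transitivity (\int[pushforward mu (-%R : _ -> measurableTypeR R)]_(v in `]0%R, +oo[) `|(h (- v))%:E|)%E.
    rewrite ge0_integral_pushforward//=; last first.
      by apply: measurable_funS mhNe.
    by rewrite -preE; apply: eq_integral => v _ /=; rewrite opprK.
  by apply: eq_measure_integral => //= A mA _; exact: lebesgue_measureN.
split=> //.
rewrite /int_pos /Rintegral; congr fine.
transitivity (\int[pushforward mu (-%R : _ -> measurableTypeR R)]_(v in `]0%R, +oo[) (h (- v))%:E)%E; last first.
  by apply: eq_measure_integral => //= A mA _; exact: lebesgue_measureN.
rewrite integral_pushforward//=.
- rewrite -preE; apply: eq_integral => v _ /=; by rewrite opprK.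
- by apply/measurable_EFinP.
- rewrite -preE; apply: eq_integrable intN => // v _ /=; by rewrite opprK.
Qed.

Lemma integral_line_split h : measurable_fun setT h ->
  integrable_pos h -> integrable_pos (fun v => h (- v)) ->
  mu.-integrable setT (EFin \o h) /\
  \int[mu]_v h v = int_pos (fun v => h v + h (- v)).
Proof.
move=> mh ih ihN; have [iN eN] := integral_reflect mh ihN.
have mhe : measurable_fun setT (fun v : R => `|h v|%:E).
  by apply/measurable_EFinP; apply: measurableT_comp.
have E : setT = `]-oo, 0%R[ `|` `[0%R, +oo[ :> set R.
  apply/seteqP; split => // x _; rewrite /= !in_itv/= andbT.
  by case: ltP; [left|right].
have mE : measurable_fun (`[0%R, +oo[ : set R) (EFin \o h).
  by apply/measurable_EFinP; exact: measurable_funTS.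
have i0 : mu.-integrable `[0%R, +oo[ (EFin \o h).
  apply/integrableP; split=> //.
  move/integrableP : ih => [_].
  by rewrite integral_itv_obnd_cbnd//; apply: measurableT_comp => //;
    apply/measurable_EFinP; exact: measurable_funTS.
have dis : disj_set (`]-oo, 0%R[ : set R) `[0%R, +oo[.
  by apply/disj_setPS => y [/=]; rewrite !in_itv/= andbT leNgt => ->.
have iT : mu.-integrable setT (EFin \o h).
  apply/integrableP; split; first exact/measurable_EFinP.
  rewrite E ge0_integral_setU//=; last first.
    by apply: measurable_funS mhe.
  by rewrite lte_add_pinfty//; [move/integrableP: iN => []|move/integrableP: i0 => []].
split => //.
rewrite E Rintegral_setU//; last by rewrite -E.
rewrite eN -Rintegral_itv_obnd_cbnd// addrC.
by rewrite -int_posD.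
Qed.

End half_line.

(** * Half-line moments of Gaussians *)
Section gauss.
Context {R : realType}.
Local Notation mu := (@lebesgue_measure R).
Implicit Types (t v : R).

Definition gauss t v : R := expR (- v ^+ 2 / (2 * t ^+ 2)).
(** The integral of exp (- v ^ 2 / 2) over v > 0. *)
Definition half_sqrt_2pi : R := Num.sqrt (2 * pi) / 2.

Lemma gauss_gt0 t v : 0 < gauss t v. Proof. exact: expR_gt0. Qed.
Lemma gaussN t v : gauss t (- v) = gauss t v.
Proof. by rewrite /gauss sqrrN. Qed.

Lemma gauss_le1 t v : gauss t v <= 1.
Proof.
rewrite /gauss -[leRHS]expR0 ler_expR mulNr oppr_le0 divr_ge0 ?sqr_ge0//.
by rewrite mulr_ge0// sqr_ge0.
Qed.

Lemma half_sqrt_2pi_ge1 : 1 <= half_sqrt_2pi.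
Proof.
rewrite /half_sqrt_2pi ler_pdivlMr// mul1r -(@ler_pXn2r _ 2)//.
- by rewrite sqr_sqrtr ?mulr_ge0 ?pi_ge0//; have := @pi_ge2 R; lra.
- by rewrite nnegrE.
- by rewrite nnegrE sqrtr_ge0.
Qed.

Lemma half_sqrt_2pi_le2 : half_sqrt_2pi <= 2.
Proof.
rewrite /half_sqrt_2pi ler_pdivrMr// -(@ler_pXn2r _ 2)//.
- by rewrite sqr_sqrtr ?mulr_ge0 ?pi_ge0//; have := @pihalf_lt2 R; lra.
- by rewrite nnegrE sqrtr_ge0.
- by rewrite nnegrE.
Qed.

Lemma is_derive_gauss t v : t != 0 ->
  is_derive v 1 (gauss t) (- (v / t ^+ 2) * gauss t v).
Proof.
move=> t0.
have D : is_derive v 1 (fun u : R => - u ^+ 2 / (2 * t ^+ 2)) (- (v / t ^+ 2)).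
  have -> : (fun u : R => - u ^+ 2 / (2 * t ^+ 2)) = (fun u : R => - (2 * t ^+ 2)^-1 * (u * u)).
    by apply/funext => u; rewrite expr2 mulrC mulrN mulNr.
  apply: is_derive_eq.
  rewrite /GRing.scale/= ; field.
  by [].
rewrite mulrC.
exact: (@is_derive1_comp _ expR (fun u : R => - u ^+ 2 / (2 * t ^+ 2)) v _ _ _ D).
Qed.

Lemma continuous_gauss t : t != 0 -> continuous (gauss t).
Proof.
move=> t0 v; apply: differentiable_continuous; apply/derivable1_diffP.
by apply: ex_derive; exact: is_derive_gauss.
Qed.

Lemma measurable_gauss t : measurable_fun setT (gauss t).
Proof.
apply: measurableT_comp => //; apply: measurable_funM => //.
apply: measurableT_comp => //; exact: exprn_measurable.
Qed.

Lemma integrable_gauss t : 0 < t -> integrable_pos (gauss t) /\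
  int_pos (gauss t) = half_sqrt_2pi * t.
Proof.
move=> t0; have tn0 : t != 0 by rewrite gt_eqF.
have pk0 := normal_peak_gt0 tn0.
have E v : gauss t v = (normal_peak t)^-1 * normal_pdf 0 t v.
  rewrite normal_pdfE// mulrA mulVf ?gt_eqF// mul1r /normal_fun subr0 /gauss.
  by rewrite mulr_natl.
have ipdf : integrable_pos (normal_pdf 0 t).
  apply: (@integrableS _ _ _ _ setT) => //.
  exact: integrable_normal_pdf.
have ig : integrable_pos (gauss t).
  apply: (@eq_integrable_pos _ (fun v => (normal_peak t)^-1 * normal_pdf 0 t v)).
    by move=> v _; rewrite E.
  exact: integrable_posZ.
split=> //.
have igN : integrable_pos (fun v => gauss t (- v)).
  by apply: eq_integrable_pos ig => v _; rewrite gaussN.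
have [_ sp] := integral_line_split (measurable_gauss t) ig igN.
have E2 : int_pos (fun v => gauss t v + gauss t (- v)) = 2 * int_pos (gauss t).
  by rewrite -(int_posZ 2 ig); apply: eq_int_pos => v _; rewrite gaussN mulr_natl mulr2n.
have : \int[mu]_v gauss t v = (normal_peak t)^-1.
  rewrite /Rintegral; under eq_integral do rewrite E EFinM.
  rewrite integralZl//; last exact: integrable_normal_pdf.
  by rewrite integral_normal_pdf mule1.
rewrite sp E2 /normal_peak invrK => H.
rewrite -[LHS](mulKf (_ : 2 != 0)) ?H//.
have -> : t ^+ 2 * pi *+ 2 = t ^+ 2 * (2 * pi) by rewrite -mulr_natr; ring.
by rewrite sqrtrM ?sqr_ge0// sqrtr_sqr gtr0_norm// /half_sqrt_2pi; field.
Qed.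

End gauss.

Section gauss_moments.
Context {R : realType}.
Local Notation mu := (@lebesgue_measure R).
Implicit Types (t v : R).
Local Notation c := (@half_sqrt_2pi R).

Lemma gauss_decay t v : t != 0 -> v ^+ 2 * gauss t v <= 2 * t ^+ 2.
Proof.
move=> t0; rewrite /gauss mulNr expRN.
have T0 : 0 < 2 * t ^+ 2 by rewrite mulr_gt0// exprn_even_gt0.
rewrite ler_pdivrMr ?expR_gt0// -ler_pdivrMl// mulrC.
by rewrite (le_trans _ (expR_ge1Dx _))// lerDr.
Qed.

Lemma cvgV_pinfty : v^-1 @[v --> +oo] --> (0 : R).
Proof.
apply/(@gtr0_cvgV0 _ _ _ _ id); last exact: cvg_id.
by near=> v; near: v; exact: nbhs_pinfty_gt.
Unshelve. all: by end_near. Qed.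

Lemma cvg_id_gauss t : t != 0 -> v * gauss t v @[v --> +oo] --> (0 : R).
Proof.
move=> t0; apply: (@squeeze_cvgr _ _ _ _ (fun=> 0) (fun v => 2 * t ^+ 2 * v^-1)).
- near=> v; have v0 : 0 < v by near: v; exact: nbhs_pinfty_gt.
  rewrite mulr_ge0 ?(ltW v0) ?(ltW (gauss_gt0 _ _))//=.
  rewrite ler_pdivlMr// (le_trans _ (gauss_decay v t0))//.
  by rewrite expr2 mulrAC.
- exact: cvg_cst.
- rewrite -[X in _ --> X](mulr0 (2 * t ^+ 2)); apply: cvgMr; exact: cvgV_pinfty.
Unshelve. all: by end_near. Qed.

Lemma cvg_gauss t : t != 0 -> gauss t v @[v --> +oo] --> (0 : R).
Proof.
move=> t0; apply: (@squeeze_cvgr _ _ _ _ (fun=> 0) (fun v => v * gauss t v)).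
- near=> v; have v1 : 1 <= v by near: v; exact: nbhs_pinfty_ge.
  by rewrite (ltW (gauss_gt0 _ _))/= ler_peMl ?(ltW (gauss_gt0 _ _)).
- exact: cvg_cst.
- exact: cvg_id_gauss.
Unshelve. all: by end_near. Qed.

(** The factor v ^ 2 is absorbed by doubling the width of the Gaussian. *)
Lemma integrable_sqr_gauss t : 0 < t -> integrable_pos (fun v => v ^+ 2 * gauss t v).
Proof.
move=> t0; have t20 : 0 < 2 * t by rewrite mulr_gt0.
have [ig _] := integrable_gauss t20.
apply: (@integrable_pos_dom _ _ (fun v => (8 * t ^+ 2) * gauss (2 * t) v)).
- apply: measurable_funTS; apply: measurable_funM; last exact: measurable_gauss.
  exact: exprn_measurable.
- move=> v v0; rewrite ger0_norm; last first.
    by rewrite mulr_ge0 ?sqr_ge0 ?(ltW (gauss_gt0 _ _)).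
  have -> : gauss t v = gauss (2 * t) v * (gauss (2 * t) v) ^+ 3.
    by rewrite -exprS /gauss -expRM_natl; congr expR; field; rewrite gt_eqF.
  rewrite mulrA ler_pM//.
  + by rewrite mulr_ge0 ?sqr_ge0 ?(ltW (gauss_gt0 _ _)).
  + by rewrite exprn_ge0 ?(ltW (gauss_gt0 _ _)).
  + have := gauss_decay v (lt0r_neq0 t20) => /le_trans; apply.
    by rewrite exprMn mulrA le_eqVlt; apply/orP; left; apply/eqP; ring.
  + rewrite exprS ler_piMr ?(ltW (gauss_gt0 _ _))//.
    by rewrite exprn_ile1 ?(ltW (gauss_gt0 _ _)) ?gauss_le1.
- exact: integrable_posZ.
Qed.

Lemma integrable_id_gauss t : 0 < t -> integrable_pos (fun v => v * gauss t v).
Proof.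
move=> t0; have [ig _] := integrable_gauss t0.
apply: (@integrable_pos_dom _ _ (fun v => gauss t v + v ^+ 2 * gauss t v)).
- by apply: measurable_funTS; apply: measurable_funM => //; exact: measurable_gauss.
- move=> v v0; rewrite ger0_norm; last by rewrite mulr_ge0 ?(ltW v0) ?(ltW (gauss_gt0 _ _)).
  rewrite -[X in _ <= X + _]mul1r -mulrDl ler_wpM2r ?(ltW (gauss_gt0 _ _))//; nra.
- by apply: integrable_posD => //; exact: integrable_sqr_gauss.
Qed.

(** [fun v => - t ^+ 2 * gauss t v] is a primitive of the integrand. *)
Lemma int_id_gauss t : 0 < t -> int_pos (fun v => v * gauss t v) = t ^+ 2.
Proof.
move=> t0; have tn0 : t != 0 by rewrite gt_eqF.
have D v : is_derive v 1 (fun v => - t ^+ 2 * gauss t v) (v * gauss t v).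
  have := is_derive_gauss v tn0 => Dg.
  by apply: is_derive_eq; rewrite /GRing.scale/=; field.
rewrite /int_pos Rintegral_itv_obnd_cbnd; last exact: integrable_id_gauss.
rewrite (@Rintegral_ge0_continuous_FTC2y _ _ (fun v => - t ^+ 2 * gauss t v) 0 0).
- by rewrite /gauss expr0n/= oppr0 mul0r expR0; ring.
- by move=> v v0; rewrite mulr_ge0// ltW// gauss_gt0.
- apply: continuous_subspaceT => v; apply: cvgM; first exact: cvg_id.
  exact: continuous_gauss.
- rewrite -[X in _ --> X](mulr0 (- t ^+ 2)); apply: cvgMr; exact: cvg_gauss.
- by move=> v _; apply: ex_derive.
- apply: cvg_at_right_filter; apply: cvgMr; exact: continuous_gauss.
- by move=> v _; rewrite derive1E derive_val.
Qed.

(** The function (v ^ 2 - t ^ 2) * gauss t v has the primitive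
    - t ^ 2 * v * gauss t v, which vanishes at both ends of the half-line; the
    second moment is thus t ^ 2 times the zeroth. *)
Lemma int_sqr_gauss t : 0 < t -> int_pos (fun v => v ^+ 2 * gauss t v) = c * t ^+ 3.
Proof.
move=> t0; have tn0 : t != 0 by rewrite gt_eqF.
have [ig eg] := integrable_gauss t0; have ig2 := integrable_sqr_gauss t0.
pose F v := - t ^+ 2 * (v * gauss t v).
pose f v := (v ^+ 2 - t ^+ 2) * gauss t v.
have D v : is_derive v 1 F (f v).
  have := is_derive_gauss v tn0 => Dg.
  by apply: is_derive_eq; rewrite /GRing.scale/= /f; field.
have cf : continuous f.
  move=> v; apply: cvgM; last exact: continuous_gauss.
  by apply: cvgB; [exact: exprn_continuous|exact: cvg_cst].
have cF : continuous F.
  move=> v; apply: cvgMr; apply: cvgM; [exact: cvg_id|exact: continuous_gauss].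
have if_ : integrable_pos f.
  apply: (eq_integrable_pos _ (integrable_posB ig2 (integrable_posZ (t ^+ 2) ig))).
  by move=> v _; rewrite /f mulrBl.
have : int_pos f = 0.
  rewrite /int_pos Rintegral_itv_obnd_cbnd//.
  have if0 : mu.-integrable `[0, +oo[ (EFin \o f).
    apply/integrableP; split.
      by apply/measurable_EFinP; apply: measurable_funTS; exact: continuous_measurable_fun.
    move/integrableP : if_ => [mf]; rewrite integral_itv_obnd_cbnd//.
    by apply: measurableT_comp.
  (* The integrand changes sign at t, and improper integrals are computed from
     primitives for integrands of constant sign. *)
  have := @Rintegral_itvB _ f (BLeft 0) (BInfty _ false) t if0.
  rewrite !bnd_simp => /(_ (ltW t0) isT) E.
  have E1 : \int[mu]_(x in `[0, t]) f x = F t - F 0.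
    rewrite /Rintegral (@continuous_FTC2 _ _ F) ?EFinN//.
    - exact: continuous_subspaceT.
    - split => [v _||]; first by apply: ex_derive.
      + by apply: cvg_at_right_filter; exact: cF.
      + by apply: cvg_at_left_filter; exact: cF.
    - by move=> v _; rewrite derive1E derive_val.
  have E2 : \int[mu]_(x in `]t, +oo[) f x = 0 - F t.
    rewrite Rintegral_itv_obnd_cbnd//; last first.
      by apply: integrableS if_ => //; apply: subset_itvr; rewrite bnd_simp ltW.
    apply: Rintegral_ge0_continuous_FTC2y.
    - move=> v tv; rewrite /f mulr_ge0 ?(ltW (gauss_gt0 _ _))// subr_ge0.
      by rewrite ler_pXn2r ?nnegrE ?(ltW t0)// (le_trans (ltW t0) tv).
    - exact: continuous_subspaceT.
    - rewrite -[X in _ --> X](mulr0 (- t ^+ 2)); apply: cvgMr; exact: cvg_id_gauss.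
    - by move=> v _; apply: ex_derive.
    - by apply: cvg_at_right_filter; exact: cF.
    - by move=> v _; rewrite derive1E derive_val.
  move: E; rewrite E1 E2 => /eqP; rewrite subr_eq => /eqP ->.
  by rewrite /F mul0r mulr0; ring.
have -> : int_pos f = int_pos (fun v => v ^+ 2 * gauss t v - t ^+ 2 * gauss t v).
  by apply: eq_int_pos => v _; rewrite /f mulrBl.
rewrite int_posB//; last exact: integrable_posZ.
by rewrite int_posZ// eg => /eqP; rewrite subr_eq0 => /eqP ->; ring.
Qed.

End gauss_moments.

(** * Measurability and Fubini for parametric integrals *)
Section parametric.
Context {R : realType}.
Local Notation mu := (@lebesgue_measure R).

Lemma measurable_Rintegral_param d (T : measurableType d) (h : T * R -> R) :
  measurable_fun setT h -> (forall p, 0 <= h p) ->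
  measurable_fun setT (fun t => \int[mu]_y h (t, y)).
Proof.
move=> mh h0; apply: (measurableT_comp (fine_measurable measurableT)).
apply: (@measurable_fun_fubini_tonelli_F _ _ T _ R mu (fun p => (h p)%:E)).
  exact/measurable_EFinP.
by move=> p; rewrite lee_fin.
Qed.

(** Fubini on [0, x] x (0, +oo): since [0, x] has finite measure, a majorant in v
    alone is enough for integrability on the product. *)
Lemma int_pos_swap (q : R * R -> R) (B : R -> R) (x : R) : 0 <= x ->
  measurable_fun setT q -> integrable_pos B ->
  (forall y v, 0 <= y <= x -> 0 < v -> `|q (y, v)| <= B v) ->
  int_pos (fun v => \int[mu]_(y in `[0, x]) q (y, v)) =
  \int[mu]_(y in `[0, x]) int_pos (fun v => q (y, v)).
Proof.
move=> x0 mq iB qB.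
(* Once q is cut off outside the rectangle, both iterated integrals are
   integrals over the plane. *)
pose g (p : R * R) : R := \1_`[0, x]%classic p.1 * (\1_`]0, +oo[%classic p.2 * q p).
have mg : measurable_fun setT g.
  apply: measurable_funM.
    by apply: measurableT_comp => //; exact: measurable_indic.
  apply: measurable_funM => //.
  by apply: measurableT_comp => //; exact: measurable_indic.
have gin y v : 0 <= y <= x -> 0 < v -> g (y, v) = q (y, v).
  move=> yx v0; rewrite /g !indicE mem_set/= ?in_itv//= mem_set ?mul1r//=.
  by rewrite in_itv/= v0.
have gout1 y v : ~~ (0 <= y <= x) -> g (y, v) = 0.
  by move=> yx; rewrite /g !indicE memNset ?mul0r//= in_itv/=; exact/negP.
have gout2 y v : ~~ (0 < v) -> g (y, v) = 0.
  move=> v0; rewrite /g/=; have -> : \1_(`]0, +oo[ : set R) v = 0 :> R.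
    by rewrite indicE memNset//= in_itv/= andbT; exact/negP.
  by rewrite mul0r mulr0.
have iq y : 0 <= y <= x -> integrable_pos (fun v => q (y, v)).
  move=> yx; apply: integrable_pos_dom iB; last by move=> v v0; exact: qB.
  by apply: measurable_funTS; exact: measurableT_comp.
have gE1 y : 0 <= y <= x -> (\int[mu]_v (g (y, v))%:E = (int_pos (fun v => q (y, v)))%:E)%E.
  move=> yx; rewrite /int_pos /Rintegral fineK; last exact/integrable_fin_num/iq.
  rewrite [RHS]integral_mkcond; apply: eq_integral => v _; rewrite patchE.
  case: ifPn => [|]; first by rewrite inE/= in_itv/= andbT => v0; rewrite gin.
  by rewrite notin_setE/= in_itv/= andbT => /negP v0; rewrite gout2.
have gE2 v : 0 < v -> (\int[mu]_y (g (y, v))%:E = \int[mu]_(y in `[0%R, x]) (q (y, v))%:E)%E.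
  move=> v0; rewrite [RHS]integral_mkcond; apply: eq_integral => y _; rewrite patchE.
  case: ifPn => [|]; first by rewrite inE/= in_itv/= => yx; rewrite gin.
  by rewrite notin_setE/= in_itv/= => /negP yx; rewrite gout1.
have ig : (mu \x mu)%E.-integrable setT (EFin \o g).
  apply/integrable12ltyP; first exact/measurable_EFinP.
  apply: (@le_lt_trans _ _ (\int[mu]_y (int_pos B * \1_`[0, x]%classic y)%:E)%E).
    apply: ge0_le_integral => //.
    - by move=> y _; apply: integral_ge0.
    - apply: (@measurable_fun_fubini_tonelli_F _ _ _ _ R mu (fun p => `|(g p)%:E|%E)) => //.
      by apply: measurableT_comp => //; exact/measurable_EFinP.
    - apply/measurable_EFinP; apply: measurable_funM => //; exact: measurable_indic.
    - move=> y _; have [yx|yx] := boolP (0 <= y <= x).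
        rewrite indicE mem_set/= ?in_itv// mulr1 /int_pos /Rintegral fineK; last first.
          exact: integrable_fin_num.
        have -> : (\int[mu]_v `|(EFin \o g) (y, v)| = \int[mu]_(v in `]0%R, +oo[) `|(q (y, v))%:E|)%E.
          rewrite [RHS]integral_mkcond; apply: eq_integral => v _; rewrite patchE.
          case: ifPn => [|].
            by rewrite inE/= in_itv/= andbT => v0; rewrite gin.
          by rewrite notin_setE/= in_itv/= andbT => /negP v0; rewrite gout2// normr0.
        have miq := integrable_pos_measurable (iq y yx).
        have miB := integrable_pos_measurable iB.
        apply: ge0_le_integral => //.
        + by apply: measurableT_comp => //; exact/measurable_EFinP.
        + exact/measurable_EFinP.
        + by move=> v /=; rewrite in_itv/= andbT => v0; rewrite lee_fin qB.
      rewrite indicE memNset/= ?in_itv//=; last exact/negP.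
      rewrite mulr0 (eq_integral (cst 0%E)) ?integral0// => v _.
      by rewrite gout1// normr0.
  under eq_integral do rewrite EFinM.
  rewrite integralZl//; last first.
    exact: integrable_indic_itv.
  rewrite integral_indic//= setIT lte_mul_pinfty ?lee_fin//.
    by apply: int_pos_ge0 => v v0; apply: le_trans (qB 0 v _ v0); rewrite ?lexx.
  by rewrite lebesgue_measure_itv/=; case: ifPn => // _; rewrite ltry.
have FB := Fubini ig.
rewrite [LHS](_ : _ = fine (\int[mu]_v \int[mu]_y (g (y, v))%:E)%E); last first.
  rewrite /int_pos /Rintegral [in LHS]integral_mkcond; congr fine.
  apply: eq_integral => v _; rewrite patchE; case: ifPn.
    rewrite inE/= in_itv/= andbT => v0; rewrite (gE2 v v0) fineK; first by [].
    apply: integrable_fin_num; first by [].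
    apply: (@le_integrable _ _ R mu `[0, x]%classic _ _ (EFin \o cst (B v))); first by [].
    - by apply/measurable_EFinP; apply: measurable_funTS; exact: measurableT_comp.
    - move=> y /=; rewrite in_itv/= => yx.
      by rewrite lee_fin (le_trans (qB _ _ yx v0))// ler_norm.
    - apply: measurable_bounded_integrable; first by [].
      + by rewrite /= lebesgue_measure_itv/=; case: ifPn => // _; rewrite ltry.
      + exact: measurable_cst.
      + exact: bounded_cst.
  rewrite notin_setE/= in_itv/= andbT => /negP v0.
  by rewrite (eq_integral (cst 0%E)) ?integral0// => y _; rewrite gout2.
rewrite -FB /Rintegral [in RHS]integral_mkcond; congr fine.
apply: eq_integral => y _; rewrite patchE; case: ifPn.
  by rewrite inE/= in_itv/= => yx; rewrite gE1.
rewrite notin_setE/= in_itv/= => /negP yx.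
by rewrite (eq_integral (cst 0%E)) ?integral0// => v _; rewrite /= gout1.
Qed.

End parametric.

(** * The equation on one characteristic *)
Section ftc.
Context {R : realType}.
Local Notation mu := (@lebesgue_measure R).

Lemma continuous_integrable_itv (k : R -> R) (a b : R) :
  {within `[a, b], continuous k} -> mu.-integrable `[a, b] (EFin \o k).
Proof. by move=> ck; apply: continuous_compact_integrable => //; exact: segment_compact. Qed.

Lemma Rintegral_is_derive (u g : R -> R) (b : R) : 0 <= b ->
  (forall x, 0 < x < b -> is_derive x 1 u (g x)) ->
  {within `[0, b], continuous u} -> {within `[0, b], continuous g} ->
  \int[mu]_(y in `[0, b]) g y = u b - u 0.
Proof.
rewrite le_eqVlt => /predU1P[<- _ _ _|b0 D cu cg].
  by rewrite set_itv1 Rintegral_set1 subrr.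
rewrite /Rintegral (@continuous_FTC2 _ _ u)//.
- have /(continuous_within_itvP _ b0)[_ cl cr] := cu.
  by split => // x; rewrite in_itv/= => xb; have := D _ xb => Dx; exact: ex_derive.
- move=> x; rewrite in_itv/= => xb; rewrite derive1E.
  by have := D _ xb => Dx; rewrite derive_val.
Qed.

End ftc.

Section duhamel.
Context {R : realType}.
Local Notation mu := (@lebesgue_measure R).
Implicit Types (lam a x : R) (s : R -> R).

(** The solution of u' = lam * (s - u) that vanishes at 0. *)
Definition duhamel lam s x : R :=
  expR (- (lam * x)) * \int[mu]_(y in `[0, x]) (lam * expR (lam * y) * s y).

Lemma is_derive_expRM (k x : R) : is_derive x 1 (fun y => expR (k * y)) (k * expR (k * x)).
Proof.
have D : is_derive x 1 (fun y : R => k * y) k.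
  by apply: is_derive_eq; rewrite /GRing.scale/= mulr1.
rewrite mulrC; exact: (@is_derive1_comp _ expR (fun y => k * y) x _ _ _ D).
Qed.

Lemma continuous_expRM (k : R) : continuous (fun y : R => expR (k * y)).
Proof.
move=> x; apply: differentiable_continuous; apply/derivable1_diffP.
by apply: ex_derive; exact: is_derive_expRM.
Qed.

Let kc lam s : continuous s -> continuous (fun y => lam * expR (lam * y) * s y).
Proof.
move=> cs x; apply: cvgM; last exact: cs.
by apply: cvgMr; exact: continuous_expRM.
Qed.

Lemma is_derive_duhamel lam s x : continuous s -> 0 < x ->
  is_derive x 1 (duhamel lam s) (lam * (s x - duhamel lam s x)).
Proof.
move=> cs x0; rewrite /duhamel.
have x1 : x < x + 1 by rewrite ltrDl.
have ik : mu.-integrable `[0, x + 1] (EFin \o (fun y => lam * expR (lam * y) * s y)).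
  by apply: continuous_integrable_itv; apply: continuous_subspaceT; exact: kc.
have [d1 d2] := continuous_FTC1_closed x1 ik x0 (@kc lam s cs x).
have D1 : is_derive x 1 (fun x => \int[mu]_(y in `[0, x]) (lam * expR (lam * y) * s y))
    (lam * expR (lam * x) * s x).
  by apply: DeriveDef; [exact: d1|rewrite -derive1E; exact: d2].
have D2 := is_derive_expRM (- lam) x.
have -> : (fun y : R => expR (- (lam * y)) * \int[mu]_(z in `[0, y]) (lam * expR (lam * z) * s z)) =
  (fun y => expR (- lam * y)) * (fun x => \int[mu]_(y in `[0, x]) (lam * expR (lam * y) * s y)).
  by apply/funext => y; rewrite mulrfctE /= mulNr.
apply: is_derive_eq; rewrite /GRing.scale/= mulNr.
have E : expR (- (lam * x)) * expR (lam * x) = 1 by rewrite -expRD addNr expR0.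
rewrite mulrA (mulrA _ lam) (mulrC _ lam) -(mulrA lam) E mulr1; ring.
Qed.

Lemma continuous_duhamel lam s b : continuous s -> 0 <= b ->
  {within `[0, b], continuous (duhamel lam s)}.
Proof.
move=> cs b0 x; apply: cvgM.
  apply: continuous_subspaceT => {}x.
  have -> : (fun y : R => expR (- (lam * y))) = (fun y => expR (- lam * y)).
    by apply/funext => y; rewrite mulNr.
  exact: continuous_expRM.
apply: parameterized_integral_continuous => //.
by apply: continuous_integrable_itv; apply: continuous_subspaceT; exact: kc.
Qed.

Lemma duhamel0 lam s : duhamel lam s 0 = 0.
Proof. by rewrite /duhamel set_itv1 Rintegral_set1 mulr0. Qed.

(** Duhamel's formula integrates s against a positive kernel of this total
    weight, whence the bounds below. *)
Lemma duhamel1 lam x : 0 <= x -> duhamel lam (fun=> 1) x = 1 - expR (- (lam * x)).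
Proof.
move=> x0; rewrite /duhamel.
have H1 y : 0 < y < x -> is_derive y 1 (fun y => expR (lam * y)) (lam * expR (lam * y) * 1).
  by move=> _; rewrite mulr1; exact: is_derive_expRM.
have H2 : {within `[0, x], continuous (fun y => expR (lam * y))}.
  by apply: continuous_subspaceT; exact: continuous_expRM.
have H3 : {within `[0, x], continuous (fun y => lam * expR (lam * y) * 1)}.
  by apply: continuous_subspaceT; apply: kc; exact: cst_continuous.
rewrite (Rintegral_is_derive x0 H1 H2 H3).
by rewrite mulr0 expR0 mulrBr -expRD addNr expR0 mulr1.
Qed.

Lemma duhamelB lam s1 s2 x : continuous s1 -> continuous s2 ->
  duhamel lam (fun y => s1 y - s2 y) x = duhamel lam s1 x - duhamel lam s2 x.
Proof.
move=> c1 c2; rewrite /duhamel -mulrBr -RintegralB//.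
- by congr (_ * _); apply: eq_Rintegral => y _; rewrite mulrBr.
- by apply: continuous_integrable_itv; apply: continuous_subspaceT; exact: kc.
- by apply: continuous_integrable_itv; apply: continuous_subspaceT; exact: kc.
Qed.

Lemma duhamelZ lam s k x : continuous s ->
  duhamel lam (fun y => k * s y) x = k * duhamel lam s x.
Proof.
move=> c1; rewrite /duhamel [RHS]mulrCA; congr (_ * _); rewrite -RintegralZl//.
- by apply: eq_Rintegral => y _; ring.
- by apply: continuous_integrable_itv; apply: continuous_subspaceT; exact: kc.
Qed.

Lemma duhamel_ge0 lam s x : 0 <= lam -> (forall y, 0 <= y <= x -> 0 <= s y) -> 0 <= duhamel lam s x.
Proof.
move=> lam0 s0; rewrite mulr_ge0 ?expR_ge0//; apply: Rintegral_ge0 => y.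
by rewrite /= in_itv/= => yx; rewrite !mulr_ge0 ?expR_ge0 ?s0.
Qed.

Lemma duhamel_le lam s1 s2 x : 0 <= lam -> continuous s1 -> continuous s2 ->
  (forall y, 0 <= y <= x -> s1 y <= s2 y) -> duhamel lam s1 x <= duhamel lam s2 x.
Proof.
move=> lam0 c1 c2 s12; rewrite -subr_ge0 -duhamelB//.
by apply: duhamel_ge0 => // y yx; rewrite subr_ge0 s12.
Qed.

Lemma duhamel_bound lam s M x : 0 <= lam -> 0 <= x -> continuous s ->
  (forall y, 0 <= y <= x -> `|s y| <= M) ->
  `|duhamel lam s x| <= M * (1 - expR (- (lam * x))).
Proof.
move=> lam0 x0 cs sM; have cM k : continuous (fun _ : R => k * 1 : R) by move=> y; exact: cst_continuous.
rewrite -duhamel1// ler_norml -mulNr -!duhamelZ; try exact: cst_continuous.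
apply/andP; split; apply: duhamel_le => // y yx; rewrite mulr1;
  by have := sM y yx; rewrite ler_norml => /andP[].
Qed.

Lemma one_sub_expRN_le (z : R) : 1 - expR (- z) <= z.
Proof. by have := expR_ge1Dx (- z); lra. Qed.

Lemma one_sub_expRN_le1 (z : R) : 1 - expR (- z) <= 1.
Proof. by have := expR_gt0 (- z); lra. Qed.

(** The solution of u' = lam * (s - u) with u 0 = a: the density of the particles
    of a given velocity, where a enters through the wall and the gas removes
    particles at rate lam while emitting lam * s. *)
Definition beam lam a s x : R := a * expR (- (lam * x)) + duhamel lam s x.

Lemma beam0 lam a s : beam lam a s 0 = a.
Proof. by rewrite /beam duhamel0 mulr0 oppr0 expR0 mulr1 addr0. Qed.

Lemma is_derive_beam lam a s x : continuous s -> 0 < x ->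
  is_derive x 1 (beam lam a s) (lam * (s x - beam lam a s x)).
Proof.
move=> cs x0; have D1 := is_derive_duhamel lam cs x0.
have D2 := is_derive_expRM (- lam) x.
have -> : beam lam a s = (fun y => a * expR (- lam * y)) + duhamel lam s.
  by apply/funext => y; rewrite /beam -mulNr.
have D3 : is_derive x 1 (fun y => a * expR (- lam * y)) (a * (- lam * expR (- lam * x))).
  by apply: is_derive_eq.
apply: is_derive_eq.
by rewrite addrfctE /=; ring.
Qed.

Lemma continuous_beam lam a s b : continuous s -> 0 <= b ->
  {within `[0, b], continuous (beam lam a s)}.
Proof.
move=> cs b0.
have c1 : {within `[0, b], continuous (fun y => a * expR (- (lam * y)))}.
  apply: continuous_subspaceT => x.
  have -> : (fun y : R => a * expR (- (lam * y))) = (fun y => a * expR (- lam * y)).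
    by apply/funext => y; rewrite mulNr.
  by apply: cvgMr; exact: continuous_expRM.
move=> x; apply: cvgD; [exact: c1|exact: continuous_duhamel].
Qed.

Lemma beam_bound lam a s M x : 0 <= lam -> 0 <= x -> continuous s ->
  (forall y, 0 <= y <= x -> `|s y| <= M) -> `|beam lam a s x| <= `|a| + M.
Proof.
move=> l0 x0 cs sM; have lx0 : 0 <= lam * x by rewrite mulr_ge0.
have M0 : 0 <= M by apply: le_trans (sM 0 _); rewrite ?lexx.
rewrite (le_trans (ler_normD _ _))// lerD//.
  rewrite normrM ler_piMr// ger0_norm ?expR_ge0//.
  by rewrite -[leRHS]expR0 ler_expR oppr_le0.
by rewrite (le_trans (duhamel_bound _ _ _ sM))// ler_piMr// one_sub_expRN_le1.
Qed.

Lemma beam_lipschitz lam a s M x y : 0 <= lam -> 0 <= x -> 0 <= y ->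
  continuous s -> (forall z, `|s z| <= M) ->
  `|beam lam a s x - beam lam a s y| <= lam * (`|a| + 2 * M) * `|x - y|.
Proof.
move=> l0 + + cs sM.
wlog xy : x y / y <= x.
  move=> H x0 y0; have [yx|/ltW xy] := leP y x; first exact: H.
  by rewrite distrC (distrC x) H.
move=> x0 y0.
have [] := @MVT_segment _ (beam lam a s) (fun z => lam * (s z - beam lam a s z)) _ _ xy.
- move=> z; rewrite in_itv/= => /andP[yz _]; apply: is_derive_beam => //.
  exact: le_lt_trans yz.
- have := @continuous_beam lam a s x cs x0; apply: continuous_subspaceW.
  by apply: subset_itvr; rewrite bnd_simp.
move=> z; rewrite in_itv/= => /andP[yz zx] ->.
rewrite normrM normrM (ger0_norm l0) ler_wpM2r// ler_wpM2l//.
rewrite (le_trans (ler_normB _ _))//.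
have := beam_bound a l0 (le_trans y0 yz) cs (fun z _ => sM z).
by have := sM z; lra.
Qed.

End duhamel.

(** * The Maxwellian of a gas at unit pressure *)
Section source.
Context {R : realType}.
Implicit Types (r v s : R).
Local Notation c := (@half_sqrt_2pi R).

(** This is r times the Maxwellian of temperature 1 / r
    ([source_maxwellian]): the local equilibrium with density r and pressure 1. *)
Definition source r v : R := r * Num.sqrt r / (2 * c) * expR (- (r * v ^+ 2) / 2).

Lemma half_sqrt_2pi_gt0 : 0 < c.
Proof. exact: lt_le_trans ltr01 half_sqrt_2pi_ge1. Qed.

Lemma sourceE r v : 0 < r ->
  source r v = r * Num.sqrt r / (2 * c) * gauss (Num.sqrt r)^-1 v.
Proof.
move=> r0; rewrite /source /gauss; congr (_ * expR _).
by rewrite exprVn sqr_sqrtr ?ltW//; field; rewrite gt_eqF.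
Qed.

Lemma sourceN r v : source r (- v) = source r v.
Proof. by rewrite /source sqrrN. Qed.

Lemma source_ge0 r v : 0 <= r -> 0 <= source r v.
Proof.
move=> r0; rewrite mulr_ge0 ?expR_ge0// divr_ge0 ?mulr_ge0 ?sqrtr_ge0//.
Qed.

Lemma int_source r : 0 < r -> integrable_pos (source r) /\ int_pos (source r) = r / 2.
Proof.
move=> r0; have w0 : 0 < (Num.sqrt r)^-1 by rewrite invr_gt0 sqrtr_gt0.
have [ig eg] := integrable_gauss w0.
have c0 := half_sqrt_2pi_gt0.
split; first by apply: eq_integrable_pos (integrable_posZ _ ig) => v _; rewrite sourceE.
rewrite (eq_int_pos (fun v _ => sourceE v r0)) int_posZ// eg.
by field; rewrite !gt_eqF ?sqrtr_gt0.
Qed.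

(** The dimensionless variable a = s * sqrt r turns all the estimates on
    [source] into estimates near a = 1. *)
Lemma sqrt_rescaled s r : 0 < s -> 2^-1 <= s ^+ 2 * r <= 3 / 2 ->
  0 < r /\ exists a, [/\ 0 < a, a <= 5 / 4, Num.sqrt r = a / s & s ^+ 2 * r = a ^+ 2].
Proof.
move=> s0 /andP[r1 r2].
have r0 : 0 < r by rewrite -(pmulr_rgt0 _ (exprn_gt0 2 s0)); lra.
split => //; exists (s * Num.sqrt r); split.
- by rewrite mulr_gt0// sqrtr_gt0.
- rewrite -(@ler_pXn2r _ 2) ?nnegrE//; last by rewrite mulr_ge0 ?sqrtr_ge0 ?ltW.
  by rewrite exprMn sqr_sqrtr ?ltW//; lra.
- by rewrite mulrC mulKf ?gt_eqF.
- by rewrite exprMn sqr_sqrtr ?ltW.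
Qed.

(** A majorant of [source r v] for all r of order s ^ -2. Its width is twice
    the typical one: the slack absorbs the factor v ^ 2 that appears when the
    exponential is differentiated in r. *)
Definition weight s v : R := s ^- 3 * gauss (2 * s) v.

Lemma source_rescaled s r v a : 0 < s -> 0 < a -> Num.sqrt r = a / s -> s ^+ 2 * r = a ^+ 2 ->
  source r v = s ^- 3 * (a ^+ 3 / (2 * c) *
    expR (- (4 * a ^+ 2 * (v ^+ 2 / (2 * (2 * s) ^+ 2))))).
Proof.
move=> s0 a0 rE ra; have c0 := half_sqrt_2pi_gt0.
have -> : r = a ^+ 2 / s ^+ 2 by rewrite -ra mulrAC mulfV ?mul1r// gt_eqF ?exprn_gt0.
rewrite /source; have -> : Num.sqrt (a ^+ 2 / s ^+ 2) = a / s.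
  by rewrite -expr_div_n sqrtr_sqr gtr0_norm// divr_gt0.
rewrite [RHS]mulrA; congr (_ * expR _).
  by field; rewrite !gt_eqF.
by field; rewrite gt_eqF.
Qed.

Lemma source_bound s r v : 0 < s -> 2^-1 <= s ^+ 2 * r <= 3 / 2 ->
  0 <= source r v <= weight s v.
Proof.
move=> s0 /[dup] /andP[r1 r2] /(sqrt_rescaled s0)[r0 [a [a0 a54 rE ra]]].
rewrite source_ge0 ?(ltW r0)//= (source_rescaled v s0 a0 rE ra) /weight.
have c1 := half_sqrt_2pi_ge1.
rewrite ler_wpM2l ?invr_ge0 ?exprn_ge0 ?(ltW s0)//.
rewrite -[leRHS]mul1r ler_pM ?expR_ge0//.
- by rewrite divr_ge0 ?exprn_ge0 ?mulr_ge0// ltW// half_sqrt_2pi_gt0.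
- have c20 : 0 < 2 * c by have := c1 R; lra.
  have a3 : a ^+ 3 <= (5 / 4) ^+ 3 by rewrite ler_pXn2r ?nnegrE ?(ltW a0)//; lra.
  rewrite ler_pdivrMr// mul1r; apply: (le_trans a3); have := c1 R; lra.
- rewrite /gauss mulNr ler_expR lerN2.
  set q := _ / _; have q0 : 0 <= q by rewrite /q divr_ge0 ?sqr_ge0// mulr_ge0 ?sqr_ge0.
  by rewrite ra in r1; nra.
Qed.

(** The Lipschitz bound of [source] in dimensionless form. As
    4 * b ^ 2 >= 2, the larger exponential is at most exp (- 2 * q); one of its
    two factors exp (- q) absorbs the q produced by the difference of the
    exponents, and the other one remains in the bound. *)
Lemma cube_exp_lip (a b q : R) : 0 <= q -> 0 < b -> b <= a -> a <= 5 / 4 -> 2^-1 <= b ^+ 2 ->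
  `|a ^+ 3 * expR (- (4 * a ^+ 2 * q)) - b ^+ 3 * expR (- (4 * b ^+ 2 * q))|
    <= 12 * (a ^+ 2 - b ^+ 2) * expR (- q).
Proof.
move=> q0 b0 ba a54 b2.
set X := expR (- (4 * a ^+ 2 * q)); set Y := expR (- (4 * b ^+ 2 * q)).
set Z := expR (- q).
have ab2 : 0 <= a ^+ 2 - b ^+ 2 by nra.
have Z0 : 0 < Z by exact: expR_gt0.
have Z1 : Z <= 1 by rewrite /Z -[leRHS]expR0 ler_expR oppr_le0.
have XY : X <= Y by rewrite ler_expR; nra.
have YZ : Y <= Z ^+ 2 by rewrite /Z -expRM_natl ler_expR; nra.
have X0 : 0 < X by exact: expR_gt0.
have Y0 : 0 < Y by exact: expR_gt0.
have qZ : q * Z <= 1.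
  rewrite /Z expRN ler_pdivrMr ?expR_gt0// mul1r.
  by rewrite (le_trans _ (expR_ge1Dx _))// lerDr.
have YX : Y - X <= Y * (4 * (a ^+ 2 - b ^+ 2) * q).
  have -> : X = Y * expR (- (4 * (a ^+ 2 - b ^+ 2) * q)).
    by rewrite /X /Y -expRD; congr expR; ring.
  rewrite -[X in X - _]mulr1 -mulrBr ler_wpM2l ?(ltW Y0)//.
  exact: one_sub_expRN_le.
have YX2 : Y - X <= 4 * (a ^+ 2 - b ^+ 2) * Z.
  apply: (le_trans YX); apply: (@le_trans _ _ (Z ^+ 2 * (4 * (a ^+ 2 - b ^+ 2) * q))).
    by rewrite ler_wpM2r// mulr_ge0// mulr_ge0.
  rewrite [leLHS](_ : _ = (4 * (a ^+ 2 - b ^+ 2) * Z) * (q * Z)); last by ring.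
  by rewrite ler_piMr// mulr_ge0 ?(ltW Z0)// mulr_ge0.
have a3 : 0 <= a ^+ 3 - b ^+ 3 <= 5 / 2 * (a ^+ 2 - b ^+ 2).
  have -> : a ^+ 3 - b ^+ 3 = (a - b) * (a ^+ 2 + a * b + b ^+ 2) by ring.
  have -> : 5 / 2 * (a ^+ 2 - b ^+ 2) = (a - b) * (5 / 2 * (a + b)) by ring.
  rewrite mulr_ge0 ?subr_ge0//=; last by nra.
  by rewrite ler_wpM2l ?subr_ge0//; nra.
have b3 : 0 <= b ^+ 3 <= 2.
  rewrite exprn_ge0 ?(ltW b0)//=; apply: (@le_trans _ _ ((5 / 4) ^+ 3)); last by lra.
  by rewrite ler_pXn2r ?nnegrE ?(ltW b0)//; lra.
rewrite [X in `|X|](_ : _ = (a ^+ 3 - b ^+ 3) * X - b ^+ 3 * (Y - X)); last by ring.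
rewrite (le_trans (ler_normB _ _))//.
move: a3 b3 => /andP[a30 a3] /andP[b30 b3].
have YX0 : 0 <= Y - X by rewrite subr_ge0.
rewrite (ger0_norm (mulr_ge0 a30 (ltW X0))) (ger0_norm (mulr_ge0 b30 YX0)).
have XZ : X <= Z by apply: (le_trans XY); apply: (le_trans YZ); rewrite expr2 ler_piMr// ltW.
have T1 : (a ^+ 3 - b ^+ 3) * X <= 5 / 2 * (a ^+ 2 - b ^+ 2) * Z.
  by apply: ler_pM => //; exact: ltW.
have T2 : b ^+ 3 * (Y - X) <= 2 * (4 * (a ^+ 2 - b ^+ 2) * Z).
  by apply: ler_pM => //; rewrite subr_ge0.
have T3 : 0 <= (a ^+ 2 - b ^+ 2) * Z by rewrite mulr_ge0// ltW.
lra.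
Qed.

Lemma source_lip s r r' v : 0 < s -> 2^-1 <= s ^+ 2 * r <= 3 / 2 ->
  2^-1 <= s ^+ 2 * r' <= 3 / 2 ->
  `|source r v - source r' v| <= 6 * (s ^+ 2 * `|r - r'|) * weight s v.
Proof.
move=> s0; wlog rr : r r' / r' <= r.
  move=> H; have [|/ltW] := leP r' r; first exact: H.
  by move=> /H{}H ra ra'; rewrite distrC (distrC r); exact: H.
move=> /[dup] /andP[r1 r2] /(sqrt_rescaled s0)[r0 [a [a0 a54 rE ra]]].
move=> /[dup] /andP[r1' r2'] /(sqrt_rescaled s0)[r0' [b [b0 b54 rE' rb]]].
rewrite (source_rescaled v s0 a0 rE ra) (source_rescaled v s0 b0 rE' rb) /weight.
set q := v ^+ 2 / _; have q0 : 0 <= q by rewrite /q divr_ge0 ?sqr_ge0// mulr_ge0 ?sqr_ge0.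
have s30 : 0 < s ^- 3 by rewrite invr_gt0 exprn_gt0.
have ba : b <= a.
  rewrite -(@ler_pXn2r _ 2) ?nnegrE ?(ltW a0) ?(ltW b0)// -ra -rb.
  by rewrite ler_wpM2l ?sqr_ge0.
have b21 : 2^-1 <= b ^+ 2 by rewrite -rb.
have H := cube_exp_lip q0 b0 ba a54 b21.
rewrite -mulrBr normrM (gtr0_norm s30) [leRHS]mulrCA ler_wpM2l ?(ltW s30)//.
rewrite (ger0_norm (_ : 0 <= r - r')) ?subr_ge0// /gauss mulNr -/q.
have c1 := @half_sqrt_2pi_ge1 R.
have c20 : 0 < 2 * c by lra.
rewrite [X in `|X|](_ : _ = (2 * c)^-1 * (a ^+ 3 * expR (- (4 * a ^+ 2 * q)) - b ^+ 3 * expR (- (4 * b ^+ 2 * q)))); last first.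
  by field; rewrite gt_eqF//; lra.
rewrite normrM (gtr0_norm (_ : 0 < (2 * c)^-1)) ?invr_gt0// mulrC ler_pdivrMr//.
apply: (le_trans H); rewrite -ra -rb -mulrBr.
have S0 : 0 <= s ^+ 2 * (r - r') * expR (- q).
  by rewrite mulr_ge0 ?expR_ge0// mulr_ge0 ?sqr_ge0 ?subr_ge0.
nra.
Qed.

Lemma weight_gt0 s v : 0 < s -> 0 < weight s v.
Proof. by move=> s0; rewrite mulr_gt0 ?gauss_gt0// invr_gt0 exprn_gt0. Qed.

Lemma weight_le s v : 0 < s -> weight s v <= s ^- 3.
Proof. by move=> s0; rewrite ler_piMr ?gauss_le1// invr_ge0 exprn_ge0 ?ltW. Qed.

Lemma int_weight s : 0 < s -> integrable_pos (weight s) /\ int_pos (weight s) <= 4 / s ^+ 2.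
Proof.
move=> s0; have s20 : 0 < 2 * s by rewrite mulr_gt0.
have [ig eg] := integrable_gauss s20; split; first exact: integrable_posZ.
rewrite int_posZ// eg.
rewrite [leLHS](_ : _ = (2 * c) / s ^+ 2); last by field; rewrite gt_eqF.
by rewrite ler_wpM2r ?invr_ge0 ?sqr_ge0//; have := @half_sqrt_2pi_le2 R; lra.
Qed.

Lemma int_id_weight s : 0 < s -> integrable_pos (fun v => v * weight s v) /\
  int_pos (fun v => v * weight s v) = 4 / s.
Proof.
move=> s0; have s20 : 0 < 2 * s by rewrite mulr_gt0.
have ig := integrable_id_gauss s20.
have E v : 0 < v -> s ^- 3 * (v * gauss (2 * s) v) = v * weight s v.
  by move=> _; rewrite /weight mulrCA.
split; first by apply: (eq_integrable_pos E); exact: integrable_posZ.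
rewrite -(eq_int_pos E) int_posZ// int_id_gauss//.
by field; rewrite gt_eqF.
Qed.

Lemma int_sqr_weight s : 0 < s -> integrable_pos (fun v => v ^+ 2 * weight s v).
Proof.
move=> s0; have s20 : 0 < 2 * s by rewrite mulr_gt0.
have ig := integrable_sqr_gauss s20.
apply: (eq_integrable_pos _ (integrable_posZ (s ^- 3) ig)).
by move=> v _; rewrite /weight mulrCA.
Qed.

Lemma continuous_source (rho : R -> R) v : continuous rho ->
  continuous (fun y => source (rho y) v).
Proof.
move=> cr y; rewrite /source; apply: cvgM.
  apply: cvgMl; apply: cvgM; first exact: cr.
  by apply: (continuous_comp (cr y)); exact: sqrt_continuous.
apply: (@cvg_comp _ _ _ (fun y => - (rho y * v ^+ 2) / 2) expR); last exact: continuous_expR.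
by apply: cvgMl; apply: cvgN; apply: cvgMl; exact: cr.
Qed.

Lemma measurable_source d (T : measurableType d) (rho vel : T -> R) :
  measurable_fun setT rho -> measurable_fun setT vel ->
  measurable_fun setT (fun p => source (rho p) (vel p)).
Proof.
move=> mr mv; rewrite /source; apply: measurable_funM.
  apply: measurable_funM => //; apply: measurable_funM => //.
  by apply: measurableT_comp => //; apply: continuous_measurable_fun; exact: sqrt_continuous.
apply: measurableT_comp => //; apply: measurable_funM => //.
apply: measurableT_comp => //; apply: measurable_funM => //.
by apply: measurable_funX.
Qed.

End source.

(** * Particles emitted by the gas *)
Section gain.
Context {R : realType}.
Local Notation mu := (@lebesgue_measure R).

(** Inversion is discontinuous at 0, so each sign is written with the
    logarithm. *)
Lemma measurable_inv : measurable_fun setT (@GRing.inv R).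
Proof.
have -> : @GRing.inv R = fun x => if 0 < x then expR (- ln x)
    else if x < 0 then - expR (- ln (- x)) else 0.
  apply/funext => x; case: ltgtP => // [x0|x0|<-]; last by rewrite invr0.
  - by rewrite expRN lnK.
  - by rewrite expRN lnK ?posrE ?oppr_gt0// invrN opprK.
apply: measurable_fun_ifT => //.
- exact: measurable_fun_ltr.
- by apply: measurableT_comp => //; apply: measurableT_comp => //; exact: measurable_ln.
- apply: measurable_fun_ifT => //; first exact: measurable_fun_ltr.
  apply: measurableT_comp => //; apply: measurableT_comp => //.
  apply: measurableT_comp => //; apply: measurableT_comp => //.
Qed.

(** Collisions per unit length for a particle of speed v. *)
Definition rate (kappa v : R) : R := (kappa * v)^-1.

Lemma measurable_rate d (T : measurableType d) kappa (vel : T -> R) :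
  measurable_fun setT vel -> measurable_fun setT (fun p => rate kappa (vel p)).
Proof.
move=> mv; apply: (measurableT_comp measurable_inv).
exact: measurable_funM.
Qed.

(** The particles of velocity v > 0 that are at x after at least one collision
    (in contrast to [attenuated] below). *)
Definition gain kappa rho x v : R :=
  duhamel (rate kappa v) (fun y => source (rho y) v) x.

Lemma measurable_gain kappa (rho : R -> R) : 0 < kappa ->
  measurable_fun setT rho -> (forall y, 0 <= rho y) ->
  measurable_fun setT (fun p : R * R => if 0 < p.2 then gain kappa rho p.1 p.2 else 0).
Proof.
move=> k0 mr r0.
pose h (p : (R * R) * R) : R := if (0 < p.1.2) && ((0 <= p.2) && (p.2 <= p.1.1)) then
  rate kappa p.1.2 * expR (rate kappa p.1.2 * p.2) * source (rho p.2) p.1.2 else 0.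
have m12 : measurable_fun setT (fun p : (R * R) * R => p.1.2).
  by apply: measurableT_comp => //.
have m11 : measurable_fun setT (fun p : (R * R) * R => p.1.1).
  by apply: measurableT_comp => //.
have mh : measurable_fun setT h.
  apply: measurable_fun_ifT => //.
    apply: measurable_and; first exact: measurable_fun_ltr.
    by apply: measurable_and; exact: measurable_fun_ler.
  apply: measurable_funM; last first.
    by apply: measurable_source => //; exact: measurableT_comp.
  apply: measurable_funM; first exact: measurable_rate.
  apply: measurableT_comp => //; apply: measurable_funM => //.
  exact: measurable_rate.
have h0 p : 0 <= h p.
  rewrite /h; case: ifPn => // /andP[v0 _].
  apply: mulr_ge0; last exact: source_ge0.
  by apply: mulr_ge0; rewrite ?expR_ge0// invr_ge0 ltW// mulr_gt0.
have mI := measurable_Rintegral_param mh h0.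
rewrite (_ : (fun _ => _) = fun p : R * R => if 0 < p.2 then
    expR (- (rate kappa p.2 * p.1)) * \int[mu]_y h (p, y) else 0).
  apply: measurable_fun_ifT => //; first exact: measurable_fun_ltr.
  apply: measurable_funM => //; apply: measurableT_comp => //.
  apply: measurableT_comp => //; apply: measurable_funM => //.
  exact: measurable_rate.
apply/funext => -[x v] /=; case: ifPn => // v0.
rewrite /gain /duhamel Rintegral_mkcond; congr (_ * _); apply: eq_Rintegral => y _.
rewrite patchE /h/= v0/=; case: ifPn => [|].
  by rewrite inE/= in_itv/= => ->.
by rewrite notin_setE/= in_itv/= => /negP/negbTE ->.
Qed.

Lemma measurable_pos_gain kappa (rho : R -> R) x : 0 < kappa ->
  measurable_fun setT rho -> (forall y, 0 <= rho y) -> measurable_pos (gain kappa rho x).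
Proof.
move=> k0 mr r0; have mg := measurable_gain k0 mr r0.
have : measurable_fun setT (fun v : R => if 0 < v then gain kappa rho x v else 0).
  exact: (measurableT_comp mg (measurable_pair1 x)).
move=> /measurable_funTS => /(_ `]0, +oo[%classic); apply: eq_measurable_fun => v.
by rewrite inE/= in_itv/= andbT => ->.
Qed.

End gain.

(** * Particles emitted by the walls, in the nearly collisionless regime *)
Section regime.
Context {R : realType}.
Local Notation c := (@half_sqrt_2pi R).

(** s1 and s2 are the thermal speeds at the walls, s is their geometric mean, and
    the last field says that eta = kappa ^ (-1/2) * s1 ^ (-1/2). The bound
    200^-1 is what makes [density_map] a contraction with ratio 1/2: by
    [density_diff_alg] the ratio is at most 60 * eta + 240 * eta ^ 2. *)
Record regime (kappa s1 s2 s eta : R) : Prop := Regime {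
  eta_gt0 : 0 < eta ;
  eta_small : eta <= 200^-1 ;
  s1_gt0 : 0 < s1 ;
  s1_le_s2 : s1 <= s2 ;
  s_gt0 : 0 < s ;
  s_sqr : s ^+ 2 = s1 * s2 ;
  kappaV : kappa^-1 = eta ^+ 2 * s1 }.

Section facts.
Variables (kappa s1 s2 s eta : R).
Hypothesis rg : regime kappa s1 s2 s eta.

Lemma s2_gt0 : 0 < s2. Proof. exact: lt_le_trans (s1_gt0 rg) (s1_le_s2 rg). Qed.

Lemma kappa_gt0 : 0 < kappa.
Proof.
by rewrite -invr_gt0 (kappaV rg) mulr_gt0 ?(s1_gt0 rg)// exprn_gt0 ?(eta_gt0 rg).
Qed.

Lemma s1_le_s : s1 <= s.
Proof.
rewrite -(@ler_pXn2r _ 2) ?nnegrE ?(ltW (s1_gt0 rg)) ?(ltW (s_gt0 rg))//.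
by rewrite (s_sqr rg) expr2 ler_wpM2l ?(s1_le_s2 rg)// ltW// (s1_gt0 rg).
Qed.

Lemma rateE v : rate kappa v = eta ^+ 2 * s1 / v.
Proof. by rewrite /rate invfM (kappaV rg). Qed.

Lemma rate_gt0 v : 0 < v -> 0 < rate kappa v.
Proof. by move=> v0; rewrite invr_gt0 mulr_gt0// kappa_gt0. Qed.

(** Moments of a contribution that has undergone at least one collision. In the
    flux and in the pressure the factor v cancels the 1 / v of the collision
    rate, which leaves the order eta ^ 2. The density has no such factor: the
    split at the speed s * eta gives only the order eta. *)
Lemma thin_moments (h : R -> R) (k : R) : 0 <= k -> measurable_pos h ->
  (forall v, 0 < v -> `|h v| <= k * weight s v) ->
  (forall v, 0 < v -> `|h v| <= k * weight s v * rate kappa v) ->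
  [/\ `|int_pos h| <= k * (5 * eta / s ^+ 2),
      `|int_pos (fun v => v * h v)| <= k * (4 * eta ^+ 2 / s2) &
      `|int_pos (fun v => v ^+ 2 * h v)| <= k * (4 * eta ^+ 2)].
Proof.
move=> k0 mh h1 h2.
have e0 := eta_gt0 rg; have sg0 := s_gt0 rg; have s10 := s1_gt0 rg; have s20 := s2_gt0.
have [iw ew] := int_weight sg0; have [iw1 ew1] := int_id_weight sg0.
have l0 : 0 <= eta ^+ 2 * s1 by rewrite mulr_ge0 ?sqr_ge0 ?ltW.
have w0 v : 0 <= weight s v by exact/ltW/weight_gt0.
split.
- have d0 : 0 < s * eta by rewrite mulr_gt0.
  have := @int_pos_split_bound _ h (fun v => k * weight s v) (k * s ^- 3) (eta ^+ 2 * s1) (s * eta) l0 d0 mh (integrable_posZ k iw).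
  have H1 v : 0 < v -> 0 <= k * weight s v <= k * s ^- 3.
    by move=> v0; rewrite mulr_ge0//= ler_wpM2l// weight_le.
  have H2 v : 0 < v -> `|h v| <= k * weight s v * (eta ^+ 2 * s1 / v).
    by move=> v0; rewrite -rateE; exact: h2.
  move=> /(_ H1 h1 H2) => /le_trans; apply; rewrite int_posZ//.
  have -> : k * s ^- 3 * (s * eta) = k * (eta / s ^+ 2) by field; rewrite gt_eqF.
  rewrite [X in _ + X]mulrCA -mulrDr ler_wpM2l//.
  have -> : 5 * eta / s ^+ 2 = eta / s ^+ 2 + eta * (4 / s ^+ 2) by ring.
  rewrite lerD2l; apply: ler_pM => //.
  + by rewrite divr_ge0// ltW.
  + by apply: int_pos_ge0 => v _.
  + rewrite ler_pdivrMr// (_ : eta * (s * eta) = eta ^+ 2 * s); last by ring.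
    by rewrite ler_wpM2l ?sqr_ge0// s1_le_s.
- have -> : k * (4 * eta ^+ 2 / s2) = k * (eta ^+ 2 * s1) * (4 / s ^+ 2).
    by rewrite (s_sqr rg); field; rewrite !gt_eqF.
  apply: (@le_trans _ _ (int_pos (fun v => k * (eta ^+ 2 * s1) * weight s v))).
    apply: int_pos_norm_le; [|move=> v v0|exact: integrable_posZ].
      by apply: measurable_funM.
    rewrite normrM (gtr0_norm v0).
    have := h2 v v0; rewrite -(ler_pM2l v0) => /le_trans; apply.
    rewrite rateE le_eqVlt; apply/orP; left; apply/eqP; field.
    by rewrite gt_eqF.
  rewrite int_posZ// ler_wpM2l// mulr_ge0//.
- apply: (@le_trans _ _ (int_pos (fun v => k * (eta ^+ 2 * s1) * (v * weight s v)))).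
    apply: int_pos_norm_le; [|move=> v v0|exact: integrable_posZ].
      apply: measurable_funM => //; exact: exprn_measurable.
    rewrite normrM (ger0_norm (sqr_ge0 _)).
    have v20 : 0 < v ^+ 2 by rewrite exprn_gt0.
    have := h2 v v0; rewrite -(ler_pM2l v20) => /le_trans; apply.
    rewrite rateE le_eqVlt; apply/orP; left; apply/eqP; field.
    by rewrite gt_eqF.
  rewrite int_posZ// ew1 -mulrA ler_wpM2l//.
  have -> : eta ^+ 2 * s1 * (4 / s) = 4 * eta ^+ 2 * (s1 / s) by ring.
  have q1 : s1 / s <= 1 by rewrite ler_pdivrMr// mul1r s1_le_s.
  by rewrite ler_piMr// mulr_ge0// sqr_ge0.
Qed.

(** The wall distribution in terms of the thermal speed t = sqrt T. *)
Definition wall t v : R := wall_maxwellian (t ^+ 2) v.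

Lemma wallE t v : wall t v = t ^- 2 * gauss t v.
Proof. by []. Qed.

Lemma wall_ge0 t v : 0 <= wall t v.
Proof. by rewrite wallE mulr_ge0 ?invr_ge0 ?sqr_ge0// ltW// gauss_gt0. Qed.

Lemma wall_moments t : 0 < t ->
  [/\ integrable_pos (wall t), integrable_pos (fun v => v * wall t v) &
      integrable_pos (fun v => v ^+ 2 * wall t v)] /\
  [/\ int_pos (wall t) = c / t, int_pos (fun v => v * wall t v) = 1 &
      int_pos (fun v => v ^+ 2 * wall t v) = c * t].
Proof.
move=> t0; have [ig eg] := integrable_gauss t0.
have ig1 := integrable_id_gauss t0; have ig2 := integrable_sqr_gauss t0.
have E1 v : 0 < v -> t ^- 2 * (v * gauss t v) = v * wall t v.
  by move=> _; rewrite wallE mulrCA.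
have E2 v : 0 < v -> t ^- 2 * (v ^+ 2 * gauss t v) = v ^+ 2 * wall t v.
  by move=> _; rewrite wallE mulrCA.
split; split.
- exact: integrable_posZ.
- by apply: (eq_integrable_pos E1); exact: integrable_posZ.
- by apply: (eq_integrable_pos E2); exact: integrable_posZ.
- rewrite [LHS](_ : _ = int_pos (fun v => t ^- 2 * gauss t v))// int_posZ// eg.
  by field; rewrite gt_eqF.
- rewrite -(eq_int_pos E1) int_posZ// int_id_gauss//.
  by field; rewrite gt_eqF.
- rewrite -(eq_int_pos E2) int_posZ// int_sqr_gauss//.
  by field; rewrite gt_eqF.
Qed.

Lemma measurable_wall t : measurable_fun setT (wall t).
Proof. by apply: measurable_funM => //; exact: measurable_gauss. Qed.

(** The particles emitted with unit flux by a wall of thermal speed t that reach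
    the distance x without a collision. *)
Definition attenuated t x v : R := wall t v * expR (- (rate kappa v * x)).

Lemma measurable_attenuated t : measurable_fun setT (fun p : R * R => attenuated t p.1 p.2).
Proof.
apply: measurable_funM; first exact: (measurableT_comp (measurable_wall t)).
apply: measurableT_comp => //; apply: measurableT_comp => //.
by apply: measurable_funM => //; exact: measurable_rate.
Qed.

Lemma measurable_pos_attenuated t x : measurable_pos (attenuated t x).
Proof.
by apply: measurable_funTS; exact: (measurableT_comp (measurable_attenuated t) (measurable_pair1 x)).
Qed.

Lemma attenuated_bounds t x v : 0 <= x <= 1 -> 0 < v ->
  [/\ 0 <= attenuated t x v, attenuated t x v <= wall t v &
      wall t v - attenuated t x v <= wall t v * rate kappa v].
Proof.
move=> /andP[x0 x1] v0; have r0 := rate_gt0 v0; have w0 := wall_ge0 t v.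
rewrite /attenuated; split.
- by rewrite mulr_ge0// expR_ge0.
- by rewrite ler_piMr// -[leRHS]expR0 ler_expR oppr_le0 mulr_ge0// ltW.
- rewrite -[X in X - _]mulr1 -mulrBr ler_wpM2l//.
  rewrite (le_trans (one_sub_expRN_le _))//.
  by rewrite ler_piMr// ltW.
Qed.

(** Same orders as in [thin_moments]: attenuation costs a relative eta in the
    density and eta ^ 2 in the flux and in the pressure. *)
Lemma attenuated_moments t x : s1 <= t -> 0 <= x <= 1 ->
  [/\ integrable_pos (attenuated t x), integrable_pos (fun v => v * attenuated t x v) &
      integrable_pos (fun v => v ^+ 2 * attenuated t x v)] /\
  [/\ c / t - 3 * eta / t <= int_pos (attenuated t x) <= c / t,
      1 - 2 * eta ^+ 2 <= int_pos (fun v => v * attenuated t x v) <= 1 &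
      c * t - eta ^+ 2 * s1 <= int_pos (fun v => v ^+ 2 * attenuated t x v) <= c * t].
Proof.
move=> s1t x01; have t0 := lt_le_trans (s1_gt0 rg) s1t.
have [[iw0 iw1 iw2] [ew0 ew1 ew2]] := wall_moments t0.
have e0 := eta_gt0 rg; have s10 := s1_gt0 rg; have c2 := @half_sqrt_2pi_le2 R.
have A := attenuated_bounds t x01.
have ma := measurable_pos_attenuated t x.
have i0 : integrable_pos (attenuated t x).
  apply: (integrable_pos_dom ma) iw0 => v /A[a0 a1 _].
  by rewrite ger0_norm.
have i1 : integrable_pos (fun v => v * attenuated t x v).
  apply: integrable_pos_dom iw1; first by apply: measurable_funM.
  by move=> v /[dup] v0 /A[a0 a1 _]; rewrite normrM (gtr0_norm v0) ger0_norm// ler_wpM2l// ltW.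
have i2 : integrable_pos (fun v => v ^+ 2 * attenuated t x v).
  apply: integrable_pos_dom iw2.
    by apply: measurable_funM => //; exact: exprn_measurable.
  by move=> v /[dup] v0 /A[a0 a1 _]; rewrite normrM !ger0_norm ?sqr_ge0// ler_wpM2l// sqr_ge0.
split=> //; split; apply/andP; split.
- rewrite -ew0 lerBlDr -lerBlDl -int_posB//.
  rewrite (le_trans (ler_norm _))//.
  have l0 : 0 <= eta ^+ 2 * s1 by rewrite mulr_ge0 ?sqr_ge0 ?ltW.
  have d0 : 0 < t * eta by rewrite mulr_gt0.
  have := @int_pos_split_bound _ (fun v => wall t v - attenuated t x v) (wall t) (t ^- 2) (eta ^+ 2 * s1) (t * eta) l0 d0.
  have mb : measurable_pos (fun v => wall t v - attenuated t x v).
    by apply: measurable_funB => //; apply: measurable_funTS; exact: measurable_wall.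
  move=> /(_ mb iw0) H; apply: (le_trans (H _ _ _)).
  + by move=> v v0; rewrite wall_ge0/= wallE ler_piMr ?gauss_le1// invr_ge0 sqr_ge0.
  + move=> v /A[a0 a1 _]; rewrite ger0_norm ?subr_ge0//; lra.
  + by move=> v /A[a0 a1 a2]; rewrite ger0_norm ?subr_ge0// -rateE.
  + rewrite ew0.
    have -> : t ^- 2 * (t * eta) = eta / t by field; rewrite gt_eqF.
    have -> : eta ^+ 2 * s1 / (t * eta) * (c / t) = eta / t * (c * (s1 / t)).
      by field; rewrite !gt_eqF.
    have -> : 3 * eta / t = eta / t + eta / t * 2 by ring.
    rewrite lerD2l ler_wpM2l ?divr_ge0 ?(ltW e0) ?(ltW t0)//.
    have q1 : s1 / t <= 1 by rewrite ler_pdivrMr// mul1r.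
    have q0 : 0 <= s1 / t by rewrite divr_ge0// ltW.
    have := @half_sqrt_2pi_gt0 R; nra.
- by rewrite -ew0; apply: int_pos_le => // v /A[].
- rewrite -ew1 lerBlDr -lerBlDl -int_posB//.
  apply: (@le_trans _ _ (int_pos (fun v => eta ^+ 2 * s1 * wall t v))).
    apply: int_pos_le; [exact: integrable_posB|exact: integrable_posZ|].
    move=> v /[dup] v0 /A[a0 a1 a2]; rewrite -mulrBr.
    have := a2; rewrite -(ler_pM2l v0) => /le_trans; apply.
    rewrite rateE le_eqVlt; apply/orP; left; apply/eqP; field.
    by rewrite gt_eqF.
  rewrite int_posZ// ew0.
  have -> : eta ^+ 2 * s1 * (c / t) = eta ^+ 2 * (c * (s1 / t)) by ring.
  rewrite mulrC ler_wpM2r ?sqr_ge0//.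
  have q1 : s1 / t <= 1 by rewrite ler_pdivrMr// mul1r.
  have q0 : 0 <= s1 / t by rewrite divr_ge0// ltW.
  have := @half_sqrt_2pi_gt0 R; nra.
- rewrite -ew1; apply: int_pos_le => // v /[dup] v0 /A[_ a1 _].
  by rewrite ler_wpM2l// ltW.
- rewrite -ew2 lerBlDr -lerBlDl -int_posB//.
  apply: (@le_trans _ _ (int_pos (fun v => eta ^+ 2 * s1 * (v * wall t v)))).
    apply: int_pos_le; [exact: integrable_posB|exact: integrable_posZ|].
    move=> v /[dup] v0 /A[a0 a1 a2]; rewrite -mulrBr.
    have v20 : 0 < v ^+ 2 by rewrite exprn_gt0.
    have := a2; rewrite -(ler_pM2l v20) => /le_trans; apply.
    rewrite rateE le_eqVlt; apply/orP; left; apply/eqP; field.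
    by rewrite gt_eqF.
  by rewrite int_posZ// ew1 mulr1.
- rewrite -ew2; apply: int_pos_le => // v /[dup] v0 /A[_ a1 _].
  by rewrite ler_wpM2l// sqr_ge0.
Qed.

End facts.
End regime.

(** * Real arithmetic of the inflows and of the density *)
Section algebra.
Context {R : realFieldType}.

(** Here k * (s1 + s2) is the pressure created by two unit inflows in free
    flight, so that J and J * T + F, the future [inflow1] and [inflow2], are
    both close to its inverse. F and P are the flux and the pressure due to
    collisions and T is the transmitted flux. *)
Lemma inflow_bounds_alg (e k s1 s2 F P T D : R) : 1 <= k <= 2 -> 0 <= e <= 100^-1 ->
  0 < s1 -> s1 <= s2 -> 0 <= F <= 4 * e / s2 -> 0 <= P <= 4 * e ->
  0 < D -> k * (s1 + s2) * (1 - 2 * e) <= D -> D <= k * (s1 + s2) -> 1 - 2 * e <= T <= 1 ->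
  let J := (1 - P - k * s2 * F) / D in
  1 - 12 * e <= J * (k * (s1 + s2)) <= 1 + 4 * e /\
  1 - 14 * e <= (J * T + F) * (k * (s1 + s2)) <= 1 + 20 * e.
Proof.
move=> /andP[k1 k2] /andP[e0 es] s10 s12 /andP[F0 F1] /andP[P0 P1] D0 D1 D2 /andP[T0 T1] J.
have s20 : 0 < s2 by exact: lt_le_trans s12.
set A := k * (s1 + s2) in D1 D2 *.
have A0 : 0 < A by rewrite mulr_gt0 ?addr_gt0// (lt_le_trans ltr01).
have k0 : 0 <= k by exact: le_trans ler01 k1.
have ks20 : 0 <= k * s2 by rewrite mulr_ge0// ltW.
have kF : 0 <= k * s2 * F <= 8 * e.
  rewrite (mulr_ge0 ks20 F0)/=.
  apply: (@le_trans _ _ (2 * s2 * (4 * e / s2))).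
    by apply: ler_pM => //; rewrite ler_wpM2r ?(ltW s20).
  by rewrite le_eqVlt; apply/orP; left; apply/eqP; field; rewrite gt_eqF.
have AF : 0 <= A * F <= 16 * e.
  rewrite mulr_ge0 ?(ltW A0)//=.
  apply: (@le_trans _ _ (2 * (s2 + s2) * (4 * e / s2))).
    apply: ler_pM => //; first exact: ltW.
    by apply: ler_pM => //; rewrite ?lerD2r// addr_ge0// ltW.
  by rewrite le_eqVlt; apply/orP; left; apply/eqP; field; rewrite gt_eqF.
set n := 1 - P - k * s2 * F in J *.
have n1 : 1 - 12 * e <= n by clear -P1 kF; move: kF => /andP[_ kF]; rewrite /n; lra.
have n2 : n <= 1 by clear -P0 kF; move: kF => /andP[kF _]; rewrite /n; lra.
have m12 : 0 <= 1 - 12 * e by clear -es; lra.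
have m2 : 0 <= 1 - 2 * e by clear -es; lra.
have p4 : 0 <= 1 + 4 * e by clear -e0; lra.
have p42 : 1 <= (1 + 4 * e) * (1 - 2 * e) by clear -e0 es; nra.
clearbody n.
have /andP[j1 j1'] : 1 - 12 * e <= J * A <= 1 + 4 * e.
  rewrite /J mulrAC ler_pdivlMr// ler_pdivrMr//; apply/andP; split.
    by apply: ler_pM => //; exact: ltW.
  apply: (@le_trans _ _ A); first by rewrite ler_piMl ?(ltW A0).
  apply: (@le_trans _ _ ((1 + 4 * e) * (A * (1 - 2 * e)))); last first.
    by rewrite ler_wpM2l.
  rewrite [leRHS](_ : _ = A * ((1 + 4 * e) * (1 - 2 * e))); last by ring.
  by rewrite ler_peMr ?(ltW A0).
split; first by rewrite j1.
have -> : (J * T + F) * A = (J * A) * T + A * F by ring.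
have L : (1 - 12 * e) * (1 - 2 * e) <= J * A * T by apply: ler_pM.
have U : J * A * T <= J * A by rewrite ler_piMr//; exact: le_trans m12 j1.
move: AF => /andP[AF0 AF1]; apply/andP; split.
  clear -L AF0 e0; nra.
clear -U AF1 j1'; lra.
Qed.

Lemma inflow_diff_alg (e d k s1 s2 F P F' P' T D : R) : 1 <= k <= 2 ->
  0 <= e <= 100^-1 -> 0 <= d ->
  0 < s1 -> s1 <= s2 -> `|F - F'| <= 6 * d * (4 * e / s2) -> `|P - P'| <= 6 * d * (4 * e) ->
  0 < D -> k * (s1 + s2) * (1 - 2 * e) <= D -> 1 - 2 * e <= T <= 1 ->
  let J := (1 - P - k * s2 * F) / D in let J' := (1 - P' - k * s2 * F') / D in
  `|J - J'| * (k * (s1 + s2)) <= 144 * d * e /\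
  `|(J * T + F) - (J' * T + F')| * (k * (s1 + s2)) <= 240 * d * e.
Proof.
move=> /andP[k1 k2] /andP[e0 es] d0 s10 s12 dF dP D0 D1 /andP[T0 T1] J J'.
have s20 : 0 < s2 by exact: lt_le_trans s12.
set A := k * (s1 + s2) in D1 *.
have A0 : 0 < A by rewrite mulr_gt0 ?addr_gt0// (lt_le_trans ltr01).
have k0 : 0 <= k by exact: le_trans ler01 k1.
have de0 : 0 <= d * e by rewrite mulr_ge0.
have F1 : s2 * `|F - F'| <= 24 * (d * e).
  have := dF; rewrite -(ler_pM2l s20) => /le_trans; apply.
  by rewrite le_eqVlt; apply/orP; left; apply/eqP; field; rewrite gt_eqF.
have P1 : `|P - P'| <= 24 * (d * e).
  by apply: (le_trans dP); rewrite le_eqVlt; apply/orP; left; apply/eqP; ring.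
have J1 : `|J - J'| * A <= 144 * (d * e).
  have -> : J - J' = - ((P - P') + k * s2 * (F - F')) / D by rewrite /J /J'; ring.
  rewrite normrM normrN (gtr0_norm (_ : 0 < D^-1)) ?invr_gt0// mulrAC ler_pdivrMr//.
  have N : `|P - P' + k * s2 * (F - F')| <= 72 * (d * e).
    rewrite (le_trans (ler_normD _ _))//.
    rewrite [`|k * s2 * _|]normrM (ger0_norm (_ : 0 <= k * s2)); last by rewrite mulr_ge0// ltW.
    have : k * s2 * `|F - F'| <= 2 * (24 * (d * e)).
      rewrite -mulrA; apply: ler_pM => //.
      by rewrite mulr_ge0// ltW.
    clear -P1; lra.
  apply: (@le_trans _ _ (72 * (d * e) * A)); first by rewrite ler_wpM2r ?(ltW A0).
  have -> : 144 * (d * e) * D = 72 * (d * e) * (2 * D) by ring.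
  apply: ler_wpM2l; first by rewrite mulr_ge0.
  by clear -D1 A0 es; nra.
split; first by rewrite -mulrA.
have -> : (J * T + F) - (J' * T + F') = (J - J') * T + (F - F') by ring.
have N1 : `|(J - J') * T| * A <= 144 * (d * e).
  apply: le_trans J1; rewrite ler_wpM2r ?(ltW A0)// normrM ler_piMr// ger0_norm//; clear -T0 es; lra.
have N2 : `|F - F'| * A <= 96 * (d * e).
  have AA : A <= 4 * s2.
    have : k * (s1 + s2) <= 2 * (s1 + s2) by rewrite ler_wpM2r// addr_ge0// ltW.
    by rewrite -/A; clear -s12; lra.
  apply: (@le_trans _ _ (`|F - F'| * (4 * s2))); first by rewrite ler_wpM2l.
  by clear -F1; lra.
apply: (@le_trans _ _ ((`|(J - J') * T| + `|F - F'|) * A)).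
  by rewrite ler_wpM2r ?(ltW A0)// ler_normD.
by rewrite mulrDl; clear -N1 N2; lra.
Qed.

(** In free flight J = K = 1 / (k * (s1 + s2)), al = k / s1 and be = k / s2, and
    then s1 * s2 * (J * al + K * be) = 1. *)
Lemma density_bound_alg (eta k s1 s2 s al be n m J K : R) : 1 <= k <= 2 ->
  0 < eta -> eta <= 200^-1 -> 0 < s1 -> 0 < s2 -> 0 < s -> s ^+ 2 = s1 * s2 ->
  0 <= n <= 5 * eta / s ^+ 2 -> 0 <= m <= 5 * eta / s ^+ 2 ->
  k / s1 - 3 * eta / s1 <= al <= k / s1 -> k / s2 - 3 * eta / s2 <= be <= k / s2 ->
  1 - 12 * eta ^+ 2 <= J * (k * (s1 + s2)) <= 1 + 4 * eta ^+ 2 ->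
  1 - 14 * eta ^+ 2 <= K * (k * (s1 + s2)) <= 1 + 20 * eta ^+ 2 ->
  `|s ^+ 2 * (J * al + K * be + n + m) - 1| <= 30 * eta.
Proof.
move=> /andP[k1 k2] e0 es s10 s20 sg0 ss /andP[n0 n1] /andP[m0 m1] /andP[a0 a1] /andP[b0 b1] /andP[j0 j1] /andP[k0 k0'].
set A := k * (s1 + s2) in j0 j1 k0 k0'.
have e20 : 0 <= eta ^+ 2 by rewrite sqr_ge0.
have e2 : eta ^+ 2 <= eta / 200 by clear -e0 es; nra.
have A0 : 0 < A by rewrite mulr_gt0 ?addr_gt0// (lt_le_trans ltr01).
have kk : 0 <= k by exact: le_trans ler01 k1.
have m14 : 0 <= 1 - 14 * eta ^+ 2 by clear -e2 es; lra.
have m12 : 0 <= 1 - 12 * eta ^+ 2 by clear -e2 es; lra.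
have m3 : 0 <= 1 - 3 * eta by clear -es; lra.
have s20' : 0 < s ^+ 2 by rewrite exprn_gt0.
have Sn : 0 <= s ^+ 2 * n <= 5 * eta.
  rewrite mulr_ge0 ?(ltW s20')//=; move: n1; rewrite -(ler_pM2l s20') => /le_trans; apply.
  by rewrite le_eqVlt; apply/orP; left; apply/eqP; field; rewrite gt_eqF.
have Sm : 0 <= s ^+ 2 * m <= 5 * eta.
  rewrite mulr_ge0 ?(ltW s20')//=; move: m1; rewrite -(ler_pM2l s20') => /le_trans; apply.
  by rewrite le_eqVlt; apply/orP; left; apply/eqP; field; rewrite gt_eqF.
have al1 : k - 3 * eta <= s1 * al <= k.
  rewrite -(ler_pM2l s10) in a0; rewrite -(ler_pM2l s10) in a1.
  apply/andP; split.
    by apply: le_trans a0; rewrite le_eqVlt; apply/orP; left; apply/eqP; field; rewrite gt_eqF.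
  by apply: (le_trans a1); rewrite le_eqVlt; apply/orP; left; apply/eqP; field; rewrite gt_eqF.
have be1 : k - 3 * eta <= s2 * be <= k.
  rewrite -(ler_pM2l s20) in b0; rewrite -(ler_pM2l s20) in b1.
  apply/andP; split.
    by apply: le_trans b0; rewrite le_eqVlt; apply/orP; left; apply/eqP; field; rewrite gt_eqF.
  by apply: (le_trans b1); rewrite le_eqVlt; apply/orP; left; apply/eqP; field; rewrite gt_eqF.
(* Distributing s ^ 2 = s1 * s2 makes every factor dimensionless: s1 * al and
   s2 * be are close to k. *)
pose X := s2 * (J * (s1 * al)) + s1 * (K * (s2 * be)).
have XE : s ^+ 2 * (J * al + K * be + n + m) - 1 = (X - 1) + s ^+ 2 * n + s ^+ 2 * m.
  by rewrite /X !mulrDr {1 2}ss; ring.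
have J0 : 0 <= J by rewrite -(pmulr_lge0 _ A0); exact: le_trans m12 j0.
have K0 : 0 <= K by rewrite -(pmulr_lge0 _ A0); exact: le_trans m14 k0.
have j0' : 1 - 14 * eta ^+ 2 <= J * A by apply: le_trans j0; clear -e20; lra.
have j1' : J * A <= 1 + 20 * eta ^+ 2 by apply: (le_trans j1); clear -e20; lra.
have XU : X <= 1 + 20 * eta ^+ 2.
  apply: (@le_trans _ _ (s2 * (J * k) + s1 * (K * k))).
    move: al1 be1 => /andP[_ al1] /andP[_ be1].
    by rewrite lerD// ler_wpM2l ?(ltW s10) ?(ltW s20)// ler_wpM2l.
  rewrite -(ler_pM2r A0) [leLHS](_ : _ = (s2 * k) * (J * A) + (s1 * k) * (K * A)); last by ring.
  rewrite [leRHS](_ : _ = (s2 * k) * (1 + 20 * eta ^+ 2) + (s1 * k) * (1 + 20 * eta ^+ 2)); last by rewrite /A; ring.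
  by rewrite lerD// ler_wpM2l// mulr_ge0// ltW.
have XL : (1 - 14 * eta ^+ 2) * (1 - 3 * eta) <= X.
  apply: (@le_trans _ _ (s2 * (J * (k * (1 - 3 * eta))) + s1 * (K * (k * (1 - 3 * eta))))).
    rewrite -(ler_pM2r A0) [leLHS](_ : _ = k * (1 - 3 * eta) * (s2 * (1 - 14 * eta ^+ 2) + s1 * (1 - 14 * eta ^+ 2))); last by rewrite /A; ring.
    rewrite [leRHS](_ : _ = k * (1 - 3 * eta) * (s2 * (J * A) + s1 * (K * A))); last by ring.
    rewrite ler_wpM2l//; first exact: mulr_ge0.
    by rewrite lerD// ler_wpM2l// ltW.
  have ce : k * (1 - 3 * eta) <= k - 3 * eta by clear -k1 e0; nra.
  move: al1 be1 => /andP[al1 _] /andP[be1 _].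
  by rewrite lerD// ler_wpM2l ?(ltW s10) ?(ltW s20)// ler_wpM2l// (le_trans ce).
rewrite XE ler_norml; move: Sn Sm => /andP[Sn0 Sn1] /andP[Sm0 Sm1].
by apply/andP; split; [clear -XL Sn0 Sm0 e0 e2 es|clear -XU Sn1 Sm1 e0 e2 es]; nra.
Qed.

Lemma density_diff_alg (eta d k s1 s2 s al be n m n' m' J K J' K' : R) : 1 <= k <= 2 ->
  0 < eta -> eta <= 200^-1 -> 0 <= d -> 0 < s1 -> 0 < s2 -> 0 < s -> s ^+ 2 = s1 * s2 ->
  `|n - n'| <= 6 * d * (5 * eta / s ^+ 2) -> `|m - m'| <= 6 * d * (5 * eta / s ^+ 2) ->
  0 <= al <= k / s1 -> 0 <= be <= k / s2 ->
  `|J - J'| * (k * (s1 + s2)) <= 144 * d * eta ^+ 2 ->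
  `|K - K'| * (k * (s1 + s2)) <= 240 * d * eta ^+ 2 ->
  s ^+ 2 * `|(J * al + K * be + n + m) - (J' * al + K' * be + n' + m')| <= d / 2.
Proof.
move=> /andP[k1 k2] e0 es d0 s10 s20 sg0 ss dn dm /andP[al0 a1] /andP[be0 b1] dJ dK.
set A := k * (s1 + s2) in dJ dK.
have e20 : 0 <= eta ^+ 2 by rewrite sqr_ge0.
have e2 : eta ^+ 2 <= eta / 200 by clear -e0 es; nra.
have A0 : 0 < A by rewrite mulr_gt0 ?addr_gt0// (lt_le_trans ltr01).
have kk : 0 <= k by exact: le_trans ler01 k1.
have m14 : 0 <= 1 - 14 * eta ^+ 2 by clear -e2 es; lra.
have m12 : 0 <= 1 - 12 * eta ^+ 2 by clear -e2 es; lra.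
have m3 : 0 <= 1 - 3 * eta by clear -es; lra.
have s20' : 0 < s ^+ 2 by rewrite exprn_gt0.
set dj := J - J' in dJ; set dk := K - K' in dK.
set ddn := n - n' in dn; set ddm := m - m' in dm.
rewrite [X in `|X|](_ : _ = dj * al + dk * be + ddn + ddm); last first.
  by rewrite /dj /dk /ddn /ddm; ring.
have Sn : s ^+ 2 * `|ddn| <= 30 * (d * eta).
  move: dn; rewrite -(ler_pM2l s20') => /le_trans; apply.
  by rewrite le_eqVlt; apply/orP; left; apply/eqP; field; rewrite gt_eqF.
have Sm : s ^+ 2 * `|ddm| <= 30 * (d * eta).
  move: dm; rewrite -(ler_pM2l s20') => /le_trans; apply.
  by rewrite le_eqVlt; apply/orP; left; apply/eqP; field; rewrite gt_eqF.
have al1 : s1 * al <= k.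
  rewrite -(ler_pM2l s10) in a1.
  by apply: (le_trans a1); rewrite le_eqVlt; apply/orP; left; apply/eqP; field; rewrite gt_eqF.
have be1 : s2 * be <= k.
  rewrite -(ler_pM2l s20) in b1.
  by apply: (le_trans b1); rewrite le_eqVlt; apply/orP; left; apply/eqP; field; rewrite gt_eqF.
have JK : s2 * (`|dj| * (s1 * al)) + s1 * (`|dk| * (s2 * be)) <= 240 * d * eta ^+ 2.
  apply: (@le_trans _ _ (s2 * (`|dj| * k) + s1 * (`|dk| * k))).
    by rewrite lerD// ler_wpM2l ?(ltW s10) ?(ltW s20)// ler_wpM2l.
  rewrite -(ler_pM2r A0) [leLHS](_ : _ = (s2 * k) * (`|dj| * A) + (s1 * k) * (`|dk| * A)); last by ring.
  rewrite [leRHS](_ : _ = (s2 * k) * (240 * d * eta ^+ 2) + (s1 * k) * (240 * d * eta ^+ 2)); last by rewrite /A; ring.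
  have de0 : 144 * d * eta ^+ 2 <= 240 * d * eta ^+ 2.
    by rewrite ler_wpM2r// ler_wpM2r//; clear; lra.
  rewrite lerD// ler_wpM2l// ?(le_trans dJ)// mulr_ge0// ltW//.
apply: (@le_trans _ _ (s ^+ 2 * (`|dj| * al + `|dk| * be + `|ddn| + `|ddm|))).
  rewrite ler_wpM2l ?(ltW s20')//.
  rewrite (le_trans (ler_normD _ _))// lerD2r (le_trans (ler_normD _ _))// lerD2r.
  by rewrite (le_trans (ler_normD _ _))// !normrM (ger0_norm al0) (ger0_norm be0).
rewrite (_ : _ * _ = (s2 * (`|dj| * (s1 * al)) + s1 * (`|dk| * (s2 * be))) + s ^+ 2 * `|ddn| + s ^+ 2 * `|ddm|); last first.
  by rewrite !mulrDr {1 2}ss; ring.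
have T1 : d * eta ^+ 2 <= d * (eta / 200) by rewrite ler_wpM2l.
have T2 : d * eta <= d / 200 by rewrite ler_wpM2l.
clear -d0 JK Sn Sm T1 T2; lra.
Qed.

End algebra.

(** * The density map and its contraction estimates *)
Section functional.
Context {R : realType}.
Local Notation c := (@half_sqrt_2pi R).

(** Densities are taken on the whole line, with values of the order of the
    free-flight density s ^ -2, the range in which [source_bound] and
    [source_lip] hold. *)
Record admissible (s : R) (rho : R -> R) : Prop := Admissible {
  adm_cont : continuous rho ;
  adm_bounds : forall y, 2^-1 <= s ^+ 2 * rho y <= 3 / 2 }.

(** The reflection of the interval exchanges the walls, so that particles
    moving to the left obey the formulas for particles moving to the right. *)
Definition mirror (rho : R -> R) y := rho (1 - y).

Lemma admissible_mirror s rho : admissible s rho -> admissible s (mirror rho).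
Proof.
move=> [cr br]; split => [y|y]; last exact: br.
apply: (@continuous_comp _ _ _ (fun y : R => 1 - y) rho); last exact: cr.
by apply: cvgB; [exact: cvg_cst|exact: cvg_id].
Qed.

Lemma admissible_gt0 s rho : 0 < s -> admissible s rho -> forall y, 0 < rho y.
Proof. by move=> s0 [_ br] y; have [] := sqrt_rescaled s0 (br y). Qed.

Lemma admissible_measurable s rho : admissible s rho -> measurable_fun setT rho.
Proof. by move=> [cr _]; exact: continuous_measurable_fun. Qed.

Section facts.
Variables (kappa s1 s2 s eta : R).
Hypothesis rg : regime kappa s1 s2 s eta.

Local Notation rate := (rate kappa).
Local Notation gain := (gain kappa).

Lemma gain_bounds rho x v : admissible s rho -> 0 <= x <= 1 -> 0 < v ->
  [/\ 0 <= gain rho x v, gain rho x v <= 1 * weight s v &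
      gain rho x v <= 1 * weight s v * rate v].
Proof.
move=> ad /andP[x0 x1] v0; have r0 := ltW (rate_gt0 rg v0).
have cs : continuous (fun y => source (rho y) v) := continuous_source (adm_cont ad).
have sb y : 0 <= source (rho y) v <= weight s v.
  by apply: source_bound (adm_bounds ad y); exact: s_gt0 rg.
have w0 := weight_gt0 v (s_gt0 rg).
have g0 : 0 <= gain rho x v by apply: duhamel_ge0 => // y _; have /andP[] := sb y.
have gb : gain rho x v <= weight s v * (1 - expR (- (rate v * x))).
  rewrite (le_trans (ler_norm _))//; apply: duhamel_bound => // y _.
  by have /andP[s0 sw] := sb y; rewrite ger0_norm.
rewrite mul1r; split => //; apply: (le_trans gb).
- by rewrite ler_piMr ?(ltW w0)// one_sub_expRN_le1.
- rewrite ler_wpM2l ?(ltW w0)// (le_trans (one_sub_expRN_le _))//.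
  by rewrite ler_piMr.
Qed.

Lemma gain_diff rho rho' d x v : admissible s rho -> admissible s rho' ->
  (forall y, s ^+ 2 * `|rho y - rho' y| <= d) -> 0 <= x <= 1 -> 0 < v ->
  `|gain rho x v - gain rho' x v| <= 6 * d * weight s v /\
  `|gain rho x v - gain rho' x v| <= 6 * d * weight s v * rate v.
Proof.
move=> ad ad' dd /andP[x0 x1] v0; have r0 := ltW (rate_gt0 rg v0).
have cs : continuous (fun y => source (rho y) v) := continuous_source (adm_cont ad).
have cs' : continuous (fun y => source (rho' y) v) := continuous_source (adm_cont ad').
have w0 := weight_gt0 v (s_gt0 rg).
have d0 : 0 <= d by apply: le_trans (dd 0); rewrite mulr_ge0 ?sqr_ge0.
have K0 : 0 <= 6 * d * weight s v by rewrite mulr_ge0 ?(ltW w0)// mulr_ge0.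
have gb : `|gain rho x v - gain rho' x v| <= (6 * d * weight s v) * (1 - expR (- (rate v * x))).
  rewrite /gain -duhamelB//; apply: duhamel_bound => //.
    by move=> y; apply: cvgB; [exact: cs|exact: cs'].
  move=> y _; apply: (le_trans (source_lip v (s_gt0 rg) (adm_bounds ad y) (adm_bounds ad' y))).
  by rewrite ler_wpM2r ?(ltW w0)// ler_wpM2l.
split; apply: (le_trans gb).
- by rewrite ler_piMr// one_sub_expRN_le1.
- rewrite ler_wpM2l// (le_trans (one_sub_expRN_le _))//.
  by rewrite ler_piMr.
Qed.

Lemma measurable_gain_adm rho x : admissible s rho -> measurable_pos (gain rho x).
Proof.
move=> ad; apply: measurable_pos_gain; first exact: kappa_gt0 rg.
  exact: admissible_measurable ad.
by move=> y; exact/ltW/(admissible_gt0 (s_gt0 rg) ad).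
Qed.

Lemma integrable_gain rho x : admissible s rho -> 0 <= x <= 1 ->
  [/\ integrable_pos (gain rho x), integrable_pos (fun v => v * gain rho x v) &
      integrable_pos (fun v => v ^+ 2 * gain rho x v)].
Proof.
move=> ad x01; have mg := measurable_gain_adm x ad.
have [iw _] := int_weight (s_gt0 rg).
have [iw1 _] := int_id_weight (s_gt0 rg).
have iw2 := int_sqr_weight (s_gt0 rg).
split.
- apply: integrable_pos_dom iw => // v v0; have [g0 + _] := gain_bounds ad x01 v0.
  by rewrite mul1r ger0_norm.
- apply: integrable_pos_dom iw1 => [|v v0]; first exact: measurable_funM.
  have [g0 + _] := gain_bounds ad x01 v0.
  by rewrite mul1r normrM (gtr0_norm v0) ger0_norm// ler_pM2l.
- apply: integrable_pos_dom iw2 => [|v v0].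
    by apply: measurable_funM => //; exact: exprn_measurable.
  have [g0 + _] := gain_bounds ad x01 v0.
  by rewrite mul1r normrM !ger0_norm ?sqr_ge0// => ?; rewrite ler_wpM2l// sqr_ge0.
Qed.

Definition gain_density rho x := int_pos (gain rho x).
Definition gain_flux rho := int_pos (fun v => v * gain rho 1 v).
Definition gain_pressure rho := int_pos (fun v => v ^+ 2 * gain rho 1 v).

Lemma one01 : 0 <= (1 : R) <= 1. Proof. by rewrite ler01 lexx. Qed.

Lemma gain_moments_bounds rho x : admissible s rho -> 0 <= x <= 1 ->
  [/\ 0 <= gain_density rho x <= 5 * eta / s ^+ 2,
      0 <= gain_flux rho <= 4 * eta ^+ 2 / s2 &
      0 <= gain_pressure rho <= 4 * eta ^+ 2].
Proof.
move=> ad.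
have T y : 0 <= y <= 1 ->
  [/\ `|int_pos (gain rho y)| <= 1 * (5 * eta / s ^+ 2),
      `|int_pos (fun v => v * gain rho y v)| <= 1 * (4 * eta ^+ 2 / s2) &
      `|int_pos (fun v => v ^+ 2 * gain rho y v)| <= 1 * (4 * eta ^+ 2)].
  move=> y01; apply: (thin_moments rg ler01 (measurable_gain_adm y ad)) => v v0;
  by have [g0 g1 g2] := gain_bounds ad y01 v0; rewrite ger0_norm.
have G0 y v : 0 <= y <= 1 -> 0 < v -> 0 <= gain rho y v.
  by move=> y01 v0; have [] := gain_bounds ad y01 v0.
move=> x01; have [Tx _ _] := T x x01; have [_ T1 T2] := T 1 one01.
move: Tx T1 T2; rewrite !mul1r !ger0_norm; last first.
- by apply: int_pos_ge0 => v v0; exact: G0.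
- by apply: int_pos_ge0 => v v0; rewrite mulr_ge0 ?(ltW v0)// G0// one01.
- by apply: int_pos_ge0 => v v0; rewrite mulr_ge0 ?sqr_ge0// G0// one01.
move=> -> -> ->; rewrite !andbT; split; apply: int_pos_ge0 => v v0.
- exact: G0.
- by rewrite mulr_ge0 ?(ltW v0)// G0// one01.
- by rewrite mulr_ge0 ?sqr_ge0// G0// one01.
Qed.

Lemma gain_moments_diff rho rho' d x : admissible s rho -> admissible s rho' ->
  (forall y, s ^+ 2 * `|rho y - rho' y| <= d) -> 0 <= x <= 1 ->
  [/\ `|gain_density rho x - gain_density rho' x| <= 6 * d * (5 * eta / s ^+ 2),
      `|gain_flux rho - gain_flux rho'| <= 6 * d * (4 * eta ^+ 2 / s2) &
      `|gain_pressure rho - gain_pressure rho'| <= 6 * d * (4 * eta ^+ 2)].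
Proof.
move=> ad ad' dd.
have d0 : 0 <= 6 * d by rewrite mulr_ge0//; apply: le_trans (dd 0); rewrite mulr_ge0 ?sqr_ge0.
have T y : 0 <= y <= 1 ->
  [/\ `|int_pos (fun v => gain rho y v - gain rho' y v)| <= 6 * d * (5 * eta / s ^+ 2),
      `|int_pos (fun v => v * (gain rho y v - gain rho' y v))| <= 6 * d * (4 * eta ^+ 2 / s2) &
      `|int_pos (fun v => v ^+ 2 * (gain rho y v - gain rho' y v))| <= 6 * d * (4 * eta ^+ 2)].
  move=> y01; apply: (thin_moments rg d0).
  - by apply: measurable_funB; exact: measurable_gain_adm.
  - by move=> v v0; have [] := gain_diff ad ad' dd y01 v0.
  - by move=> v v0; have [] := gain_diff ad ad' dd y01 v0.
move=> x01; have [Tx _ _] := T x x01; have [_ T1 T2] := T 1 one01.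
have [i0 _ _] := integrable_gain ad x01.
have [i0' _ _] := integrable_gain ad' x01.
have [_ i1 i2] := integrable_gain ad one01.
have [_ i1' i2'] := integrable_gain ad' one01.
split.
- by rewrite /gain_density -int_posB.
- rewrite /gain_flux -int_posB//.
  by under eq_int_pos do rewrite -mulrBr.
- rewrite /gain_pressure -int_posB//.
  by under eq_int_pos do rewrite -mulrBr.
Qed.

Definition transmitted_flux := int_pos (fun v => v * attenuated kappa s1 1 v).
Definition transmitted_pressure := int_pos (fun v => v ^+ 2 * attenuated kappa s1 1 v).

(** The unknown inflows J1, J2 solve a linear system that expresses two
    requirements at x = 1, where the right wall emits J2 with pressure
    c * s2 * J2. The flux vanishes: J2 equals the rightward flux
    J1 * transmitted_flux + gain_flux. The pressure is 1:
    J1 * transmitted_pressure + gain_pressure + c * s2 * J2 = 1. *)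
Definition inflow1 rho : R := (1 - gain_pressure rho - c * s2 * gain_flux rho) /
  (transmitted_pressure + transmitted_flux * (c * s2)).
Definition inflow2 rho : R := inflow1 rho * transmitted_flux + gain_flux rho.

(** The density at x of the solution driven by rho: what each wall transmits,
    and what the gas emits in each direction. *)
Definition density_map rho x : R :=
  inflow1 rho * int_pos (attenuated kappa s1 x) + inflow2 rho * int_pos (attenuated kappa s2 (1 - x)) +
  gain_density rho x + gain_density (mirror rho) (1 - x).

Lemma eta_sqr_le : eta ^+ 2 <= eta / 200.
Proof. by have := eta_gt0 rg; have := eta_small rg; nra. Qed.

Lemma transmitted_bounds : let A := c * (s1 + s2) in let D := transmitted_pressure + transmitted_flux * (c * s2) in
  [/\ 0 < A, 0 < D, A * (1 - 2 * eta ^+ 2) <= D, D <= A &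
      1 - 2 * eta ^+ 2 <= transmitted_flux <= 1].
Proof.
move=> A D.
have c1 := @half_sqrt_2pi_ge1 R; have e2 := eta_sqr_le; have e0 := eta_gt0 rg.
have es := eta_small rg; have s10 := s1_gt0 rg; have s20 := s2_gt0 rg.
have [_ [_ /andP[f0 f1] /andP[p0 p1]]] := attenuated_moments rg (lexx s1) one01.
rewrite -/transmitted_flux -/transmitted_pressure in f0 f1 p0 p1.
have e20 : 0 <= eta ^+ 2 by rewrite sqr_ge0.
have A0 : 0 < A by rewrite mulr_gt0 ?addr_gt0//; lra.
have cs2 : 0 < c * s2 by rewrite mulr_gt0//; lra.
have B : A * (1 - 2 * eta ^+ 2) <= D.
  have F : (1 - 2 * eta ^+ 2) * (c * s2) <= transmitted_flux * (c * s2) by rewrite ler_wpM2r ?(ltW cs2).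
  have P : eta ^+ 2 * s1 <= 2 * eta ^+ 2 * (c * s1).
    have : eta ^+ 2 * s1 <= eta ^+ 2 * (c * s1) by rewrite ler_wpM2l// ler_peMl// ltW.
    have : 0 <= eta ^+ 2 * (c * s1) by rewrite mulr_ge0// mulr_ge0 ?(ltW s10)//; lra.
    lra.
  rewrite /A /D; lra.
have D0 : 0 < D by apply: lt_le_trans B; rewrite mulr_gt0//; lra.
split => //; last by rewrite f0.
have : transmitted_flux * (c * s2) <= 1 * (c * s2) by rewrite ler_wpM2r ?(ltW cs2).
rewrite /A /D; lra.
Qed.

Lemma half_sqrt_2pi_bounds : 1 <= c <= 2.
Proof. by rewrite half_sqrt_2pi_ge1 half_sqrt_2pi_le2. Qed.

Lemma eta_sqr_bounds : 0 <= eta ^+ 2 <= 100^-1.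
Proof.
by rewrite sqr_ge0/=; have := eta_gt0 rg; have := eta_small rg; nra.
Qed.

Lemma inflow_bounds rho : admissible s rho ->
  1 - 12 * eta ^+ 2 <= inflow1 rho * (c * (s1 + s2)) <= 1 + 4 * eta ^+ 2 /\
  1 - 14 * eta ^+ 2 <= inflow2 rho * (c * (s1 + s2)) <= 1 + 20 * eta ^+ 2.
Proof.
move=> ad; have [_ F P] := gain_moments_bounds ad one01.
have [A0 D0 D1 D2 T] := transmitted_bounds.
exact: (inflow_bounds_alg half_sqrt_2pi_bounds eta_sqr_bounds (s1_gt0 rg) (s1_le_s2 rg) F P D0 D1 D2 T).
Qed.

Lemma inflow_diff rho rho' d : admissible s rho -> admissible s rho' ->
  (forall y, s ^+ 2 * `|rho y - rho' y| <= d) ->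
  `|inflow1 rho - inflow1 rho'| * (c * (s1 + s2)) <= 144 * d * eta ^+ 2 /\
  `|inflow2 rho - inflow2 rho'| * (c * (s1 + s2)) <= 240 * d * eta ^+ 2.
Proof.
move=> ad ad' dd; have [_ dF dP] := gain_moments_diff ad ad' dd one01.
have [A0 D0 D1 D2 T] := transmitted_bounds.
have d0 : 0 <= d by apply: le_trans (dd 0); rewrite mulr_ge0 ?sqr_ge0.
exact: (inflow_diff_alg half_sqrt_2pi_bounds eta_sqr_bounds d0 (s1_gt0 rg) (s1_le_s2 rg) dF dP D0 D1 T).
Qed.

Lemma itv01_onem (x : R) : 0 <= x <= 1 -> 0 <= 1 - x <= 1.
Proof. by move=> /andP[x0 x1]; rewrite subr_ge0 x1 gerBl. Qed.

Lemma density_map_bound rho x : admissible s rho -> 0 <= x <= 1 ->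
  `|s ^+ 2 * density_map rho x - 1| <= 30 * eta.
Proof.
move=> ad x01; have x01' := itv01_onem x01.
have [n _ _] := gain_moments_bounds ad x01.
have [m _ _] := gain_moments_bounds (admissible_mirror ad) x01'.
have [J K] := inflow_bounds ad.
have [_ [al _ _]] := attenuated_moments rg (lexx s1) x01.
have [_ [be _ _]] := attenuated_moments rg (s1_le_s2 rg) x01'.
exact: (density_bound_alg half_sqrt_2pi_bounds (eta_gt0 rg) (eta_small rg) (s1_gt0 rg)
  (s2_gt0 rg) (s_gt0 rg) (s_sqr rg) n m al be J K).
Qed.

Lemma density_map_diff rho rho' d x : admissible s rho -> admissible s rho' ->
  (forall y, s ^+ 2 * `|rho y - rho' y| <= d) -> 0 <= x <= 1 ->
  s ^+ 2 * `|density_map rho x - density_map rho' x| <= d / 2.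
Proof.
move=> ad ad' dd x01; have x01' := itv01_onem x01.
have d0 : 0 <= d by apply: le_trans (dd 0); rewrite mulr_ge0 ?sqr_ge0.
have dd' y : s ^+ 2 * `|mirror rho y - mirror rho' y| <= d by exact: dd.
have [dn _ _] := gain_moments_diff ad ad' dd x01.
have [dm _ _] := gain_moments_diff (admissible_mirror ad) (admissible_mirror ad') dd' x01'.
have [dJ dK] := inflow_diff ad ad' dd.
have [_ [/andP[_ a1] _ _]] := attenuated_moments rg (lexx s1) x01.
have [_ [/andP[_ b1] _ _]] := attenuated_moments rg (s1_le_s2 rg) x01'.
have al : 0 <= int_pos (attenuated kappa s1 x) <= c / s1.
  by rewrite a1 andbT; apply: int_pos_ge0 => v v0; have [] := attenuated_bounds rg s1 x01 v0.
have be : 0 <= int_pos (attenuated kappa s2 (1 - x)) <= c / s2.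
  by rewrite b1 andbT; apply: int_pos_ge0 => v v0; have [] := attenuated_bounds rg s2 x01' v0.
exact: (density_diff_alg half_sqrt_2pi_bounds (eta_gt0 rg) (eta_small rg) d0 (s1_gt0 rg)
  (s2_gt0 rg) (s_gt0 rg) (s_sqr rg) dn dm al be dJ dK).
Qed.

End facts.
End functional.

(** * Hoelder regularity and the fixed point *)
Section fixed_point.
Context {R : realType}.
Local Notation c := (@half_sqrt_2pi R).

Section facts.
Variables (kappa s1 s2 s eta : R).
Hypothesis rg : regime kappa s1 s2 s eta.

Local Notation rate := (rate kappa).
Local Notation gain := (gain kappa).
Local Notation attenuated := (attenuated kappa).

(** The density of rightward particles when a wall of thermal speed t at x = 0
    emits the flux J. *)
Definition forward rho J t x v : R :=
  beam (rate v) (J * wall t v) (fun y => source (rho y) v) x.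

Lemma forwardE rho J t x v : forward rho J t x v = J * attenuated t x v + gain rho x v.
Proof. by rewrite /forward /beam /attenuated mulrA. Qed.

Lemma forward_bounds rho J t x v : admissible s rho -> 0 <= J -> 0 <= x <= 1 -> 0 < v ->
  0 <= forward rho J t x v <= J * wall t v + weight s v.
Proof.
move=> ad J0 x01 v0; rewrite forwardE.
have [a0 a1 _] := attenuated_bounds rg t x01 v0; have [g0 g1 _] := gain_bounds rg ad x01 v0.
apply/andP; split; first by apply: addr_ge0 => //; exact: mulr_ge0.
by rewrite mul1r in g1; apply: lerD => //; rewrite ler_wpM2l.
Qed.

(** The two bounds between which [int_pos_split_bound] interpolates: the
    Lipschitz constant in x contains the collision rate, hence blows up as v
    tends to 0. *)
Lemma forward_modulus rho J t x y v : admissible s rho -> 0 <= J ->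
  0 <= x <= 1 -> 0 <= y <= 1 -> 0 < v ->
  `|forward rho J t x v - forward rho J t y v| <= J * wall t v + 2 * weight s v /\
  `|forward rho J t x v - forward rho J t y v| <=
    (J * wall t v + 2 * weight s v) * (eta ^+ 2 * s1 * `|x - y| / v).
Proof.
move=> ad J0 x01 y01 v0; have w0 := weight_gt0 v (s_gt0 rg).
have /andP[fx0 fx1] := forward_bounds t ad J0 x01 v0.
have /andP[fy0 fy1] := forward_bounds t ad J0 y01 v0.
split.
  by rewrite ler_norml; apply/andP; split; lra.
have cs : continuous (fun y => source (rho y) v) := continuous_source (adm_cont ad).
have sM z : `|source (rho z) v| <= weight s v.
  have /andP[? ?] := source_bound v (s_gt0 rg) (adm_bounds ad z).
  by rewrite ger0_norm.
move: x01 y01 => /andP[x0 _] /andP[y0 _].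
have := beam_lipschitz (J * wall t v) (ltW (rate_gt0 rg v0)) x0 y0 cs sM.
rewrite (ger0_norm (mulr_ge0 J0 (wall_ge0 t v))) => /le_trans; apply.
rewrite (rateE rg) le_eqVlt; apply/orP; left; apply/eqP; ring.
Qed.

Lemma integrable_forward rho J t x : admissible s rho -> s1 <= t -> 0 <= x <= 1 ->
  [/\ integrable_pos (forward rho J t x), integrable_pos (fun v => v * forward rho J t x v) &
      integrable_pos (fun v => v ^+ 2 * forward rho J t x v)] /\
  [/\ int_pos (forward rho J t x) = J * int_pos (attenuated t x) + int_pos (gain rho x),
   int_pos (fun v => v * forward rho J t x v) =
     J * int_pos (fun v => v * attenuated t x v) + int_pos (fun v => v * gain rho x v) &
   int_pos (fun v => v ^+ 2 * forward rho J t x v) =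
     J * int_pos (fun v => v ^+ 2 * attenuated t x v) + int_pos (fun v => v ^+ 2 * gain rho x v)].
Proof.
move=> ad s1t x01.
have [[a0 a1 a2] _] := attenuated_moments rg s1t x01.
have [g0 g1 g2] := integrable_gain rg ad x01.
have E0 v : 0 < v -> J * attenuated t x v + gain rho x v = forward rho J t x v by rewrite forwardE.
have E1 v : 0 < v -> J * (v * attenuated t x v) + v * gain rho x v = v * forward rho J t x v.
  by move=> _; rewrite forwardE; ring.
have E2 v : 0 < v -> J * (v ^+ 2 * attenuated t x v) + v ^+ 2 * gain rho x v = v ^+ 2 * forward rho J t x v.
  by move=> _; rewrite forwardE; ring.
split; split.
- by apply: (eq_integrable_pos E0); apply: integrable_posD => //; exact: integrable_posZ.
- by apply: (eq_integrable_pos E1); apply: integrable_posD => //; exact: integrable_posZ.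
- by apply: (eq_integrable_pos E2); apply: integrable_posD => //; exact: integrable_posZ.
- by rewrite -(eq_int_pos E0) int_posD ?int_posZ//; exact: integrable_posZ.
- by rewrite -(eq_int_pos E1) int_posD ?int_posZ//; exact: integrable_posZ.
- by rewrite -(eq_int_pos E2) int_posD ?int_posZ//; exact: integrable_posZ.
Qed.

(** The bound of [int_pos_split_bound] for the majorant
    J * wall t + 2 * weight s, split at the speed sqrt |x - y|. *)
Definition holder_const J t : R :=
  J * t ^- 2 + 2 * s ^- 3 + eta ^+ 2 * s1 * (J * (c / t) + 2 * (4 / s ^+ 2)).

Lemma forward_holder rho J Jm t x y : admissible s rho -> s1 <= t -> 0 <= J -> J <= Jm ->
  0 <= x <= 1 -> 0 <= y <= 1 ->
  `|int_pos (forward rho J t x) - int_pos (forward rho J t y)| <=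
  holder_const Jm t * Num.sqrt `|x - y|.
Proof.
move=> ad s1t J0 Jm0 x01 y01.
have t0 := lt_le_trans (s1_gt0 rg) s1t.
have [->|xy] := eqVneq x y; first by rewrite !subrr normr0 sqrtr0 mulr0.
have d0 : 0 < `|x - y| by rewrite normr_gt0 subr_eq0.
have sd0 : 0 < Num.sqrt `|x - y| by rewrite sqrtr_gt0.
have [[ix _ _] _] := integrable_forward J ad s1t x01.
have [[iy _ _] _] := integrable_forward J ad s1t y01.
have [iw ew] := int_weight (s_gt0 rg).
have [[iwl _ _] [ewl _ _]] := wall_moments t0.
have w0 v : 0 <= weight s v by exact/ltW/(weight_gt0 _ (s_gt0 rg)).
rewrite -int_posB//.
have iW : integrable_pos (fun v => J * wall t v + 2 * weight s v).
  by apply: integrable_posD; exact: integrable_posZ.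
have l0 : 0 <= eta ^+ 2 * s1 * `|x - y|.
  by rewrite mulr_ge0// mulr_ge0 ?sqr_ge0// ltW// (s1_gt0 rg).
have mh : measurable_pos (fun v => forward rho J t x v - forward rho J t y v).
  by apply: measurable_funB; exact: integrable_pos_measurable.
have := @int_pos_split_bound _ _ _ (J * t ^- 2 + 2 * s ^- 3) _ _ l0 sd0 mh iW.
move=> H; apply: (le_trans (H _ _ _)).
- move=> v v0; apply/andP; split.
    by apply: addr_ge0; apply: mulr_ge0 => //; exact: wall_ge0.
  apply: lerD; apply: ler_wpM2l => //; last exact: weight_le (s_gt0 rg).
  by rewrite wallE; apply: ler_piMr; [rewrite invr_ge0 sqr_ge0|exact: gauss_le1].
- by move=> v v0; have [] := forward_modulus t ad J0 x01 y01 v0.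
- by move=> v v0; have [] := forward_modulus t ad J0 x01 y01 v0.
- rewrite int_posD; [|exact: integrable_posZ|exact: integrable_posZ].
  rewrite (int_posZ J iwl) (int_posZ 2 iw) ewl.
  have -> : eta ^+ 2 * s1 * `|x - y| / Num.sqrt `|x - y| = eta ^+ 2 * s1 * Num.sqrt `|x - y|.
    by rewrite -{1}(sqr_sqrtr (ltW d0)); field; rewrite gt_eqF.
  have e0 : 0 <= eta ^+ 2 * s1 by rewrite mulr_ge0 ?sqr_ge0// ltW// (s1_gt0 rg).
  have ct : 0 <= c / t by rewrite divr_ge0// ltW// half_sqrt_2pi_gt0.
  rewrite [leLHS](_ : _ = (J * t ^- 2 + 2 * s ^- 3 +
    eta ^+ 2 * s1 * (J * (c / t) + 2 * int_pos (weight s))) * Num.sqrt `|x - y|); last by ring.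
  apply: ler_wpM2r; first exact: ltW.
  apply: lerD.
    by rewrite lerD2r; apply: ler_wpM2r => //; rewrite invr_ge0 sqr_ge0.
  apply: ler_wpM2l => //; apply: lerD; first exact: ler_wpM2r.
  exact: ler_wpM2l.
Qed.

Definition inflow_max : R := 2 / (c * (s1 + s2)).

Lemma inflow_range rho : admissible s rho ->
  0 < inflow1 kappa s1 s2 rho <= inflow_max /\ 0 < inflow2 kappa s1 s2 rho <= inflow_max.
Proof.
move=> ad; have [/andP[j0 j1] /andP[k0 k1]] := inflow_bounds rg ad.
have [A0 _ _ _ _] := transmitted_bounds rg.
have /andP[_ e2] := eta_sqr_bounds rg.
have q1 : 0 < 1 - 12 * eta ^+ 2 by move: e2; lra.
have q2 : 0 < 1 - 14 * eta ^+ 2 by move: e2; lra.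
have q3 : 1 + 4 * eta ^+ 2 <= 2 by move: e2; lra.
have q4 : 1 + 20 * eta ^+ 2 <= 2 by move: e2; lra.
have P u lo hi : 0 < lo -> hi <= 2 -> lo <= u * (c * (s1 + s2)) -> u * (c * (s1 + s2)) <= hi ->
    0 < u <= inflow_max.
  move=> l0 h2 lu uh; rewrite -(pmulr_lgt0 _ A0) (lt_le_trans l0 lu)/=.
  by rewrite ler_pdivlMr// (le_trans uh).
by split; [exact: P q1 q3 j0 j1|exact: P q2 q4 k0 k1].
Qed.

Lemma density_mapE rho x : admissible s rho -> 0 <= x <= 1 ->
  density_map kappa s1 s2 rho x =
  int_pos (forward rho (inflow1 kappa s1 s2 rho) s1 x) +
  int_pos (forward (mirror rho) (inflow2 kappa s1 s2 rho) s2 (1 - x)).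
Proof.
move=> ad x01; have x01' := itv01_onem x01.
have [_ [-> _ _]] := integrable_forward (inflow1 kappa s1 s2 rho) ad (lexx s1) x01.
have [_ [-> _ _]] := integrable_forward (inflow2 kappa s1 s2 rho) (admissible_mirror ad) (s1_le_s2 rg) x01'.
by rewrite /density_map /gain_density [RHS]addrACA [RHS]addrA.
Qed.

Definition holder_density := holder_const inflow_max s1 + holder_const inflow_max s2.

Lemma density_map_holder rho x y : admissible s rho -> 0 <= x <= 1 -> 0 <= y <= 1 ->
  `|density_map kappa s1 s2 rho x - density_map kappa s1 s2 rho y| <=
  holder_density * Num.sqrt `|x - y|.
Proof.
move=> ad x01 y01; rewrite !density_mapE//.
have [/andP[j0 j1] /andP[k0 k1]] := inflow_range ad.
have H1 := forward_holder ad (lexx s1) (ltW j0) j1 x01 y01.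
have H2 := forward_holder (admissible_mirror ad) (s1_le_s2 rg) (ltW k0) k1 (itv01_onem x01) (itv01_onem y01).
have E : `|1 - x - (1 - y)| = `|x - y| by rewrite distrC; congr `|_|; ring.
rewrite E in H2.
rewrite /holder_density mulrDl (le_trans _ (lerD H1 H2))//.
by rewrite (le_trans _ (ler_normD _ _))// opprD addrACA.
Qed.

(** Composition with this projection onto [0, 1] extends a function on the
    interval to the line without increasing its modulus of continuity. *)
Definition clamp (x : R) : R := if x <= 0 then 0 else if 1 <= x then 1 else x.

Lemma clamp01 x : 0 <= clamp x <= 1.
Proof.
rewrite /clamp; case: (leP x 0) => x0; first by rewrite lexx ler01.
by case: (leP 1 x) => x1; rewrite ?ler01 ?lexx// !ltW.
Qed.

Lemma clamp_id x : 0 <= x <= 1 -> clamp x = x.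
Proof.
move=> /andP[x0 x1]; rewrite /clamp; case: leP => [xl|_].
  by apply/eqP; rewrite eq_le x0 xl.
by case: leP => // xl; apply/eqP; rewrite eq_le x1 xl.
Qed.

Lemma clamp_dist x y : `|clamp x - clamp y| <= `|x - y|.
Proof.
wlog xy : x y / y <= x.
  move=> H; have [|/ltW] := leP y x; first exact: H.
  by rewrite distrC (distrC x); exact: H.
have [c1 c2] : clamp y <= clamp x /\ clamp x - clamp y <= x - y.
  rewrite /clamp; case: (leP x 0) => a; case: (leP 1 x) => b;
  by case: (leP y 0) => e; case: (leP 1 y) => f; split; lra.
by rewrite !ger0_norm ?subr_ge0.
Qed.

(** The domain of the iteration. Pointwise limits do not preserve continuity,
    but they preserve a Hoelder bound with a fixed constant, so this set is
    closed where the set of admissible densities is not. *)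
Definition holder_set : set (R -> R) := [set u |
  (forall z, 2^-1 <= s ^+ 2 * u z <= 3 / 2) /\
  (forall x y, `|u x - u y| <= holder_density * Num.sqrt `|x - y|)].

Lemma sqrt_holder_continuous (u : R -> R) (K : R) :
  (forall x y, `|u x - u y| <= K * Num.sqrt `|x - y|) -> continuous u.
Proof.
move=> H x; have K0 : 0 <= K.
  have := H 1 0; rewrite subr0 normr1 sqrtr1 mulr1; apply: le_trans; exact: normr_ge0.
apply/cvgrPdist_le => e e0.
have K10 : 0 < K + 1 by apply: ltr_wpDl.
near=> y.
have D : `|x - y| <= (e / (K + 1)) ^+ 2.
  by near: y; apply: cvgr_dist_le => //; rewrite exprn_gt0// divr_gt0.
apply: (le_trans (H x y)).
apply: (@le_trans _ _ (K * (e / (K + 1)))).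
  have sE : Num.sqrt ((e / (K + 1)) ^+ 2) = e / (K + 1).
    by rewrite sqrtr_sqr ger0_norm// divr_ge0 ?ltW.
  by rewrite ler_wpM2l// -sE ler_wsqrtr.
by rewrite mulrA ler_pdivrMr// mulrC ler_wpM2l ?(ltW e0)// lerDl.
Unshelve. all: by end_near. Qed.

Lemma density_fixed_point : exists2 rho, holder_set rho &
  admissible s rho /\ forall x, rho x = density_map kappa s1 s2 rho (clamp x).
Proof.
have sg0 := s_gt0 rg; have s20 : 0 < s ^+ 2 by rewrite exprn_gt0.
have adm u : holder_set u -> admissible s u.
  by move=> [u1 u2]; split => //; exact: (sqrt_holder_continuous u2).
have hd0 : 0 <= holder_density.
  have ad1 : admissible s (fun=> s ^- 2).
    split; first by move=> ?; exact: cvg_cst.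
    by move=> _; rewrite mulfV ?gt_eqF//; lra.
  have := density_map_holder ad1 (x := 1) (y := 0).
  rewrite subr0 normr1 sqrtr1 mulr1 !lexx ler01 => /(_ isT isT).
  exact: le_trans.
pose F u (x : R) := density_map kappa s1 s2 u (clamp x).
have [||||||rho Hrho Frho] := @picard_fixed_point R R holder_set F (fun=> s ^- 2) 2^-1 (s ^- 2).
- by apply/andP; split; lra.
- split => [_|x y]; first by rewrite mulfV ?gt_eqF//; lra.
  by rewrite subrr normr0 mulr_ge0// sqrtr_ge0.
- move=> u /adm au; split => [z|x y].
    have := density_map_bound rg au (clamp01 z); have := eta_small rg; have := eta_gt0 rg.
    rewrite ler_norml /F => e0 es /andP[d1 d2]; apply/andP; split; lra.
  rewrite (le_trans (density_map_holder au (clamp01 x) (clamp01 y)))//.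
  by rewrite ler_wpM2l// ler_wsqrtr// clamp_dist.
- move=> u w d /adm au /adm aw duw z.
  have dd y : s ^+ 2 * `|u y - w y| <= s ^+ 2 * d by rewrite ler_pM2l.
  have := density_map_diff rg au aw dd (clamp01 z).
  by rewrite [leRHS](_ : _ = s ^+ 2 * (2^-1 * d)) ?ler_pM2l//; ring.
- move=> u [u1 _] z; have := u1 z => /andP[a b].
  rewrite -(ler_pM2l s20) mulfV ?gt_eqF// -(ger0_norm (ltW s20)) -normrM.
  rewrite mulrBr (ger0_norm (ltW s20)) mulfV ?gt_eqF// ler_norml; apply/andP; split; lra.
- move=> u_ u Uu cu; split => [z|x y].
    have cz : (s ^+ 2 * u_ n z) @[n --> \oo] --> s ^+ 2 * u z by apply: cvgMr; exact: cu.
    apply/andP; split.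
      rewrite -(cvg_lim _ cz)//; apply: limr_ge; first by apply/cvg_ex; exists (s ^+ 2 * u z).
      by apply: nearW => n; have [/(_ z)/andP[]] := Uu n.
    rewrite -(cvg_lim _ cz)//; apply: limr_le; first by apply/cvg_ex; exists (s ^+ 2 * u z).
    by apply: nearW => n; have [/(_ z)/andP[]] := Uu n.
  have cz : `|u_ n x - u_ n y| @[n --> \oo] --> `|u x - u y|.
    by apply: cvg_norm; apply: cvgB; exact: cu.
  rewrite -(cvg_lim _ cz)//; apply: limr_le; first by apply/cvg_ex; exists `|u x - u y|.
  by apply: nearW => n; have [_] := Uu n; apply.
by exists rho => //; split => [|x]; [exact: adm|rewrite -[LHS]Frho].
Qed.

End facts.
End fixed_point.

(** * Conservation laws of the fixed point *)
Section conservation.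
Context {R : realType}.
Local Notation mu := (@lebesgue_measure R).
Local Notation c := (@half_sqrt_2pi R).

Lemma lipschitz_within_continuous (u : R -> R) (L : R) :
  (forall x y, 0 <= x <= 1 -> 0 <= y <= 1 -> `|u x - u y| <= L * `|x - y|) ->
  {within `[0, 1], continuous u}.
Proof.
move=> uL; have L0 : 0 <= L.
  have := uL 1 0; rewrite subr0 normr1 mulr1 !lexx ler01 => /(_ isT isT).
  exact: le_trans.
have cu : continuous (u \o clamp).
  move=> x; apply/cvgrPdist_le => e e0.
  have L1 : 0 < L + 1 by apply: ltr_wpDl.
  near=> y.
  have D : `|x - y| <= e / (L + 1) by near: y; apply: cvgr_dist_le => //; rewrite divr_gt0.
  apply: (le_trans (uL _ _ (clamp01 x) (clamp01 y))).
  apply: (@le_trans _ _ (L * (e / (L + 1)))).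
    by rewrite ler_wpM2l// (le_trans (clamp_dist _ _)).
  by rewrite mulrA ler_pdivrMr// mulrC ler_wpM2l ?(ltW e0)// lerDl.
have : {within `[0, 1], continuous (u \o clamp)} by exact: continuous_subspaceT.
apply: subspace_eq_continuous => x; rewrite inE/= in_itv/= => x01.
by rewrite /from_subspace/= clamp_id.
Unshelve. all: by end_near. Qed.

(** By Fubini, the integral of u over v changes between 0 and x by the integral
    over y of the velocity integral of q, which is zero. *)
Lemma conserved (u : R -> R -> R) (q : R * R -> R) (B : R -> R) :
  measurable_fun setT q -> integrable_pos B ->
  (forall y v : R, 0 <= y <= 1 -> 0 < v -> `|q (y, v)| <= B v) ->
  (forall x v : R, 0 < x < 1 -> 0 < v -> is_derive x 1 (u ^~ v) (q (x, v))) ->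
  (forall v : R, 0 < v -> {within `[0, 1], continuous (u ^~ v)}) ->
  (forall v : R, 0 < v -> {within `[0, 1], continuous (fun y => q (y, v))}) ->
  (forall x, 0 <= x <= 1 -> integrable_pos (u x)) ->
  (forall y, 0 <= y <= 1 -> int_pos (fun v => q (y, v)) = 0) ->
  forall x, 0 <= x <= 1 -> int_pos (u x) = int_pos (u 0).
Proof.
move=> mq iB qB du cu cq iu q0 x /andP[x0 x1].
have sub : `[0, x] `<=` `[0, 1] by apply: subset_itvl; rewrite bnd_simp.
apply/eqP; rewrite -subr_eq0 -int_posB; last 2 first.
- by apply: iu; rewrite x0.
- by apply: iu; rewrite lexx ler01.
rewrite -(@eq_int_pos _ (fun v => \int[mu]_(y in `[0, x]) q (y, v))); last first.
  move=> v v0; apply: (@Rintegral_is_derive _ (u ^~ v)) => //.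
  - by move=> y /andP[y0 yx]; apply: du => //; rewrite y0 (lt_le_trans yx).
  - by have := cu _ v0; exact: continuous_subspaceW.
  - by have := cq _ v0; exact: continuous_subspaceW.
rewrite (int_pos_swap x0 mq iB); last first.
  by move=> y v /andP[y0 yx] v0; apply: qB => //; rewrite y0 (le_trans yx).
rewrite (@eq_Rintegral _ _ _ _ _ (fun=> 0)).
  by rewrite Rintegral_cst// mul0r.
move=> y; rewrite inE/= in_itv/= => /andP[y0 yx].
by rewrite q0// y0 (le_trans yx).
Qed.

Section facts.
Variables (kappa s1 s2 s eta : R).
Hypothesis rg : regime kappa s1 s2 s eta.
Variable rho : R -> R.
Hypothesis ad : admissible s rho.
Hypothesis fp : forall x, 0 <= x <= 1 -> rho x = density_map kappa s1 s2 rho x.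

Local Notation rate := (rate kappa).
Local Notation J1 := (inflow1 kappa s1 s2 rho).
Local Notation J2 := (inflow2 kappa s1 s2 rho).

Definition rightward x v : R := forward kappa rho J1 s1 x v.
Definition leftward x v : R := forward kappa (mirror rho) J2 s2 (1 - x) v.

(** The solution of the kinetic equation before division by the mass. *)
Definition profile x v : R :=
  if 0 < v then rightward x v else if v < 0 then leftward x (- v) else 0.

Lemma profile_pos x v : 0 < v -> profile x v = rightward x v.
Proof. by rewrite /profile => ->. Qed.

Lemma profile_neg x v : 0 < v -> profile x (- v) = leftward x v.
Proof. by move=> v0; rewrite /profile oppr_gt0 oppr_lt0 v0 opprK ltNge (ltW v0). Qed.

Lemma measurable_forward r J t : admissible s r ->
  measurable_fun setT (fun p : R * R => if 0 < p.2 then forward kappa r J t p.1 p.2 else 0).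
Proof.
move=> ar; have mg := measurable_gain (kappa_gt0 rg) (admissible_measurable ar)
   (fun y => ltW (admissible_gt0 (s_gt0 rg) ar y)).
have ma := @measurable_attenuated _ kappa t.
have m0 : measurable_fun setT (fun p : R * R => if 0 < p.2 then (1 : R) else 0).
  by apply: measurable_fun_ifT => //; exact: measurable_fun_ltr.
have : measurable_fun setT (fun p : R * R => J * ((if 0 < p.2 then (1 : R) else 0) * attenuated kappa t p.1 p.2) +
    (if 0 < p.2 then gain kappa r p.1 p.2 else 0)).
  by apply: measurable_funD => //; apply: measurable_funM => //; exact: measurable_funM.
apply: eq_measurable_fun => -[x v] _ /=; case: ifPn => _.
  by rewrite mul1r forwardE.
by rewrite mul0r mulr0 add0r.
Qed.

Lemma measurable_profile : measurable_fun setT (fun p : R * R => profile p.1 p.2).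
Proof.
have mr := measurable_forward J1 s1 ad.
have ml := measurable_forward J2 s2 (admissible_mirror ad).
have mN : measurable_fun setT (fun p : R * R => (1 - p.1, - p.2)).
  apply/measurable_fun_pair => /=; first exact: measurable_funB.
  by apply: measurableT_comp.
have mlN := measurableT_comp ml mN.
have := measurable_funD mr mlN; apply: eq_measurable_fun => -[x v] _.
rewrite /= /profile oppr_gt0; case: (ltgtP v 0) => v0; rewrite ?add0r ?addr0//.
Qed.

Lemma inflow1_ge0 : 0 <= J1.
Proof. by have [/andP[/ltW]] := inflow_range rg ad. Qed.
Lemma inflow2_ge0 : 0 <= J2.
Proof. by have [_ /andP[/ltW]] := inflow_range rg ad. Qed.

Lemma rightward_bounds x v : 0 <= x <= 1 -> 0 < v ->
  0 <= rightward x v <= J1 * wall s1 v + weight s v.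
Proof. exact: (forward_bounds rg s1 ad inflow1_ge0). Qed.

Lemma leftward_bounds x v : 0 <= x <= 1 -> 0 < v ->
  0 <= leftward x v <= J2 * wall s2 v + weight s v.
Proof.
move=> /itv01_onem; exact: (forward_bounds rg s2 (admissible_mirror ad) inflow2_ge0).
Qed.

Lemma rightward_lipschitz v : 0 < v -> exists L, forall x y, 0 <= x <= 1 -> 0 <= y <= 1 ->
  `|rightward x v - rightward y v| <= L * `|x - y|.
Proof.
move=> v0; exists ((J1 * wall s1 v + 2 * weight s v) * (eta ^+ 2 * s1) / v) => x y x01 y01.
have [_ /le_trans] := forward_modulus rg s1 ad inflow1_ge0 x01 y01 v0; apply.
by rewrite le_eqVlt; apply/orP; left; apply/eqP; ring.
Qed.

Lemma leftward_lipschitz v : 0 < v -> exists L, forall x y, 0 <= x <= 1 -> 0 <= y <= 1 ->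
  `|leftward x v - leftward y v| <= L * `|x - y|.
Proof.
move=> v0; exists ((J2 * wall s2 v + 2 * weight s v) * (eta ^+ 2 * s1) / v) => x y x01 y01.
have [_ /le_trans] := forward_modulus rg s2 (admissible_mirror ad) inflow2_ge0
  (itv01_onem x01) (itv01_onem y01) v0; apply.
have -> : `|1 - x - (1 - y)| = `|x - y| by rewrite distrC; congr `|_|; ring.
by rewrite le_eqVlt; apply/orP; left; apply/eqP; ring.
Qed.

Lemma is_derive_rightward (x v : R) : 0 < x < 1 ->
  is_derive x 1 (rightward ^~ v) (rate v * (source (rho x) v - rightward x v)).
Proof.
move=> /andP[x0 _]; rewrite /rightward /forward.
have cs : continuous (fun y => source (rho y) v) := continuous_source (adm_cont ad).
exact: (is_derive_beam (rate v) (J1 * wall s1 v) cs x0).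
Qed.

Lemma is_derive_leftward (x v : R) : 0 < x < 1 ->
  is_derive x 1 (leftward ^~ v) (- (rate v * (source (rho x) v - leftward x v))).
Proof.
move=> /andP[_ x1]; rewrite /leftward /forward.
have cs : continuous (fun y => source (mirror rho y) v) := continuous_source (adm_cont (admissible_mirror ad)).
have x1' : 0 < 1 - x by rewrite subr_gt0.
have D1 := is_derive_beam (rate v) (J2 * wall s2 v) cs x1'.
have D2 : is_derive x 1 (fun y : R => 1 - y) (-1).
  by apply: is_derive_eq; rewrite add0r mul1r.
have := @is_derive1_comp _ _ (fun y : R => 1 - y) x _ _ D1 D2.
by rewrite mulrN1 /mirror subKr.
Qed.

Lemma integrable_profile x : 0 <= x <= 1 ->
  [/\ integrable_pos (rightward x), integrable_pos (fun v => v * rightward x v) &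
      integrable_pos (fun v => v ^+ 2 * rightward x v)] /\
  [/\ integrable_pos (leftward x), integrable_pos (fun v => v * leftward x v) &
      integrable_pos (fun v => v ^+ 2 * leftward x v)].
Proof.
move=> x01.
have [H1 _] := integrable_forward rg J1 ad (lexx s1) x01.
have [H2 _] := integrable_forward rg J2 (admissible_mirror ad) (s1_le_s2 rg) (itv01_onem x01).
exact: (conj H1 H2).
Qed.

Lemma profile_density x : 0 <= x <= 1 ->
  int_pos (rightward x) + int_pos (leftward x) = rho x.
Proof. by move=> x01; rewrite fp// (density_mapE rg). Qed.

Lemma continuous_profile v : v != 0 -> {within `[0, 1], continuous (profile ^~ v)}.
Proof.
rewrite neq_lt => /orP[v0|v0].
- rewrite -oppr_gt0 in v0; have [L HL] := leftward_lipschitz v0.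
  apply: (@lipschitz_within_continuous _ L) => x y x01 y01.
  by rewrite -(opprK v) !profile_neg// HL.
- have [L HL] := rightward_lipschitz v0.
  by apply: (@lipschitz_within_continuous _ L) => x y x01 y01; rewrite !profile_pos// HL.
Qed.

Lemma continuous_source_within v : {within `[0, 1], continuous (fun y => source (rho y) v)}.
Proof. by apply: continuous_subspaceT; apply: continuous_source; exact: adm_cont ad. Qed.

Lemma measurable_profileN : measurable_fun setT (fun p : R * R => profile p.1 (- p.2)).
Proof.
have mN : measurable_fun setT (fun p : R * R => (p.1, - p.2)).
  by apply/measurable_fun_pair => //=; apply: measurableT_comp.
exact: (measurableT_comp measurable_profile mN).
Qed.

Lemma measurable_source_pair : measurable_fun setT (fun p : R * R => source (rho p.1) p.2).
Proof.
apply: measurable_source => //; apply: (measurableT_comp (admissible_measurable ad)) => //.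
Qed.

(** A majorant of the profile over all x, for the interchange of integrals in
    [conserved]. *)
Definition profile_max v : R := J1 * wall s1 v + J2 * wall s2 v + 2 * weight s v.

Lemma integrable_profile_max :
  integrable_pos profile_max /\ integrable_pos (fun v => v * profile_max v).
Proof.
have [[a0 a1 _] _] := wall_moments (s1_gt0 rg).
have [[b0 b1 _] _] := wall_moments (s2_gt0 rg).
have [c0 _] := int_weight (s_gt0 rg); have [c1 _] := int_id_weight (s_gt0 rg).
split.
  by apply: integrable_posD; [apply: integrable_posD|]; exact: integrable_posZ.
apply: (@eq_integrable_pos _ (fun v => J1 * (v * wall s1 v) + J2 * (v * wall s2 v) + 2 * (v * weight s v))).
  by move=> v _; rewrite /profile_max !mulrDr ![v * (_ * _)]mulrCA.
by apply: integrable_posD; [apply: integrable_posD|]; exact: integrable_posZ.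
Qed.

Lemma profile_le_max x v : 0 <= x <= 1 -> 0 < v ->
  [/\ 0 <= rightward x v, 0 <= leftward x v & rightward x v + leftward x v <= profile_max v].
Proof.
move=> x01 v0; have /andP[r0 r1] := rightward_bounds x01 v0.
have /andP[l0 l1] := leftward_bounds x01 v0; split => //.
apply: (le_trans (lerD r1 l1)); rewrite /profile_max addrACA -mulr2n mulr_natl.
exact: lexx.
Qed.

Lemma leftward1_flux : int_pos (fun v => v * leftward 1 v) = J2.
Proof.
have [[_ w1 _] [_ e1 _]] := wall_moments (s2_gt0 rg).
rewrite (@eq_int_pos _ _ (fun v => J2 * (v * wall s2 v))).
  by rewrite (int_posZ _ w1) e1 mulr1.
by move=> v _; rewrite /leftward /forward subrr beam0 mulrCA.
Qed.

(** The flux is constant because the collision term conserves mass: the gas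
    emits [source], of density rho, and absorbs the profile, whose density is
    rho by the fixed point property. It vanishes at x = 1 by the choice of
    [inflow2]. *)
Lemma profile_flux x : 0 <= x <= 1 -> int_pos (fun v => v * (rightward x v - leftward x v)) = 0.
Proof.
have iu y : 0 <= y <= 1 -> integrable_pos (fun v => v * (rightward y v - leftward y v)).
  move=> y01; have [[_ i1 _] [_ i2 _]] := integrable_profile y01.
  apply: (eq_integrable_pos _ (integrable_posB i1 i2)) => v _.
  exact/esym/mulrBr.
pose q (p : R * R) := eta ^+ 2 * s1 * (2 * source (rho p.1) p.2 - (profile p.1 p.2 + profile p.1 (- p.2))).
have qE y v : 0 < v -> q (y, v) = eta ^+ 2 * s1 * (2 * source (rho y) v - (rightward y v + leftward y v)).
  by move=> v0; rewrite /q /= profile_pos// profile_neg.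
pose B v := eta ^+ 2 * s1 * (2 * weight s v + profile_max v).
have k0 : 0 <= eta ^+ 2 * s1 by rewrite mulr_ge0 ?sqr_ge0// ltW// (s1_gt0 rg).
have [im im1] := integrable_profile_max.
have [iw _] := int_weight (s_gt0 rg).
have C : forall x, 0 <= x <= 1 -> int_pos (fun v => v * (rightward x v - leftward x v)) =
   int_pos (fun v => v * (rightward 0 v - leftward 0 v)).
  apply: (@conserved (fun x v => v * (rightward x v - leftward x v)) q B).
  - apply: measurable_funM => //; apply: measurable_funB.
      by apply: measurable_funM => //; exact: measurable_source_pair.
    by apply: measurable_funD; [exact: measurable_profile|exact: measurable_profileN].
  - by apply: integrable_posZ; apply: integrable_posD => //; exact: integrable_posZ.
  - move=> y v y01 v0; rewrite qE// normrM (ger0_norm k0) ler_wpM2l//.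
    have /andP[g0 g1] := source_bound v (s_gt0 rg) (adm_bounds ad y).
    have [r0 l0 rl] := profile_le_max y01 v0.
    apply: (le_trans (ler_normB _ _)).
    rewrite (ger0_norm (mulr_ge0 (ler0n _ 2) g0)) (ger0_norm (addr_ge0 r0 l0)).
    by apply: lerD => //; rewrite ler_wpM2l.
  - move=> z v z01 v0; rewrite (qE z v v0).
    have Dr := is_derive_rightward v z01; have Dl := is_derive_leftward v z01.
    have -> : (fun y => v * (rightward y v - leftward y v)) = (fun y => v *: ((rightward ^~ v) - (leftward ^~ v)) y).
      by apply/funext.
    apply: is_derive_eq.
    rewrite (rateE rg) /GRing.scale/=.
    move: (source _ _) (rightward z v) (leftward z v) => S r l.
    by field; rewrite gt_eqF.
  - move=> v v0; have [L1 H1] := rightward_lipschitz v0; have [L2 H2] := leftward_lipschitz v0.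
    apply: (@lipschitz_within_continuous _ (v * (L1 + L2))) => z y z01 y01.
    rewrite -mulrBr normrM (gtr0_norm v0) -mulrA ler_pM2l// mulrDl.
    have sr (a b e f : R) : a - b - (e - f) = (a - e) - (b - f) by ring.
    rewrite sr; apply: (le_trans (ler_normB _ _)); apply: lerD; [exact: H1|exact: H2].
  - move=> v v0.
    have c1 := @continuous_source_within v; have c2 := @continuous_profile v (lt0r_neq0 v0).
    have c3 : {within `[0, 1], continuous (profile ^~ (- v))}.
      by apply: continuous_profile; rewrite oppr_eq0 gt_eqF.
    move=> y; apply: cvgMr; apply: cvgB.
      by apply: cvgMr; exact: c1.
    by apply: cvgD; [exact: c2|exact: c3].
  - exact: iu.
  - move=> y y01; have [[i0 _ _] [l0 _ _]] := integrable_profile y01.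
    have [isrc esrc] := int_source (admissible_gt0 (s_gt0 rg) ad y).
    have iS := integrable_posZ 2 isrc; have iD := integrable_posD i0 l0.
    rewrite (eq_int_pos (fun v => @qE y v)) (int_posZ _ (integrable_posB iS iD)).
    rewrite (int_posB iS iD) (int_posZ 2 isrc) (int_posD i0 l0) esrc profile_density//.
    by rewrite mulrC [2 * _]mulrC divfK// subrr mul0r.
move=> x01; rewrite C// -(C 1 one01).
have [[_ i1 _] [_ i2 _]] := integrable_profile one01.
have -> : int_pos (fun v => v * (rightward 1 v - leftward 1 v)) =
    int_pos (fun v => v * rightward 1 v) - int_pos (fun v => v * leftward 1 v).
  by rewrite -(int_posB i1 i2); apply: eq_int_pos => v _; exact: mulrBr.
have [_ [_ er _]] := integrable_forward rg J1 ad (lexx s1) one01.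
by rewrite leftward1_flux [X in X - _]er subrr.
Qed.

(** The derivative of the pressure is minus the flux over kappa, since [source]
    is even in v; so the pressure keeps the value 1 that [inflow1] gives it at
    x = 1. *)
Lemma profile_pressure x : 0 <= x <= 1 ->
  int_pos (fun v => v ^+ 2 * (rightward x v + leftward x v)) = 1.
Proof.
have iu y : 0 <= y <= 1 -> integrable_pos (fun v => v ^+ 2 * (rightward y v + leftward y v)).
  move=> y01; have [[_ _ i1] [_ _ i2]] := integrable_profile y01.
  apply: (eq_integrable_pos _ (integrable_posD i1 i2)) => v _.
  exact/esym/mulrDr.
pose q (p : R * R) := - (eta ^+ 2 * s1) * (p.2 * (profile p.1 p.2 - profile p.1 (- p.2))).
have qE y v : 0 < v -> q (y, v) = - (eta ^+ 2 * s1) * (v * (rightward y v - leftward y v)).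
  by move=> v0; rewrite /q /= profile_pos// profile_neg.
pose B v := eta ^+ 2 * s1 * (v * profile_max v).
have k0 : 0 <= eta ^+ 2 * s1 by rewrite mulr_ge0 ?sqr_ge0// ltW// (s1_gt0 rg).
have [_ im1] := integrable_profile_max.
have C : forall x, 0 <= x <= 1 -> int_pos (fun v => v ^+ 2 * (rightward x v + leftward x v)) =
   int_pos (fun v => v ^+ 2 * (rightward 0 v + leftward 0 v)).
  apply: (@conserved (fun x v => v ^+ 2 * (rightward x v + leftward x v)) q B).
  - apply: measurable_funM => //; apply: measurable_funM => //.
    by apply: measurable_funB; [exact: measurable_profile|exact: measurable_profileN].
  - exact: integrable_posZ.
  - move=> y v y01 v0; rewrite (qE y v v0) normrM normrN (ger0_norm k0) ler_wpM2l//.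
    have [r0 l0 rl] := profile_le_max y01 v0.
    rewrite normrM (gtr0_norm v0) ler_pM2l//.
    apply: (le_trans (ler_normB _ _)).
    by rewrite (ger0_norm r0) (ger0_norm l0); exact: rl.
  - move=> z v z01 v0; rewrite (qE z v v0).
    have Dr := is_derive_rightward v z01; have Dl := is_derive_leftward v z01.
    have -> : (fun y => v ^+ 2 * (rightward y v + leftward y v)) = (fun y => v ^+ 2 *: ((rightward ^~ v) + (leftward ^~ v)) y).
      by apply/funext.
    apply: is_derive_eq.
    rewrite (rateE rg) /GRing.scale/=.
    move: (source _ _) (rightward z v) (leftward z v) => S r l.
    by field; rewrite gt_eqF.
  - move=> v v0; have [L1 H1] := rightward_lipschitz v0; have [L2 H2] := leftward_lipschitz v0.
    apply: (@lipschitz_within_continuous _ (v ^+ 2 * (L1 + L2))) => z y z01 y01.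
    rewrite -mulrBr normrM (gtr0_norm (exprn_gt0 2 v0)) -mulrA.
    apply: ler_wpM2l; first exact: sqr_ge0.
    have sr (a b e f : R) : a + b - (e + f) = (a - e) + (b - f) by ring.
    rewrite mulrDl sr; apply: (le_trans (ler_normD _ _)); apply: lerD; [exact: H1|exact: H2].
  - move=> v v0.
    have c2 := @continuous_profile v (lt0r_neq0 v0).
    have c3 : {within `[0, 1], continuous (profile ^~ (- v))}.
      by apply: continuous_profile; rewrite oppr_eq0 gt_eqF.
    move=> y; apply: cvgMr; apply: cvgMr; apply: cvgB; [exact: c2|exact: c3].
  - exact: iu.
  - move=> y y01; have [[_ i1 _] [_ i2 _]] := integrable_profile y01.
    have i12 : integrable_pos (fun v => v * (rightward y v - leftward y v)).
      apply: (eq_integrable_pos _ (integrable_posB i1 i2)) => v _.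
      exact/esym/mulrBr.
    by rewrite (eq_int_pos (fun v => @qE y v)) (int_posZ _ i12) profile_flux// mulr0.
move=> x01; rewrite C// -(C 1 one01).
have [[_ _ i1] [_ _ i2]] := integrable_profile one01.
have -> : int_pos (fun v => v ^+ 2 * (rightward 1 v + leftward 1 v)) =
    int_pos (fun v => v ^+ 2 * rightward 1 v) + int_pos (fun v => v ^+ 2 * leftward 1 v).
  by rewrite -(int_posD i1 i2); apply: eq_int_pos => v _; exact: mulrDr.
have [_ [_ _ er]] := integrable_forward rg J1 ad (lexx s1) one01.
have -> : int_pos (fun v => v ^+ 2 * leftward 1 v) = J2 * (c * s2).
  have [[_ _ w2] [_ _ e2]] := wall_moments (s2_gt0 rg).
  rewrite (@eq_int_pos _ _ (fun v => J2 * (v ^+ 2 * wall s2 v))); last first.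
    by move=> v _; rewrite /leftward /forward subrr beam0 mulrCA.
  by rewrite (int_posZ _ w2) e2.
rewrite [X in X + _]er -/(transmitted_pressure kappa s1) -/(gain_pressure kappa rho).
have [_ D0 _ _ _] := transmitted_bounds rg.
have JD : J1 * (transmitted_pressure kappa s1 + transmitted_flux kappa s1 * (c * s2)) =
   1 - gain_pressure kappa rho - c * s2 * gain_flux kappa rho.
  by rewrite /inflow1 divfK// gt_eqF.
rewrite /inflow2; move: JD.
move: J1 (transmitted_pressure _ _) (transmitted_flux _ _) (gain_pressure _ _) (gain_flux _ _) (c * s2) => j tp tf gp gf k JD.
rewrite [LHS](_ : _ = j * (tp + tf * k) + gp + k * gf); last by ring.
by rewrite JD; ring.
Qed.

End facts.
End conservation.

(** * The steady state *)
Section steady.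
Context {R : realType}.
Local Notation mu := (@lebesgue_measure R).
Local Notation c := (@half_sqrt_2pi R).

Lemma lipschitz_absolutely_continuous (g : R -> R) (L a b : R) :
  (forall x y, a <= x <= b -> a <= y <= b -> `|g x - g y| <= L * `|x - y|) ->
  absolutely_continuous a b g.
Proof.
move=> gL eps e0.
have L1 : 0 < `|L| + 1 by apply: ltr_wpDl.
exists (eps / (`|L| + 1)); first by rewrite divr_gt0.
move=> n l r lr _ sd.
apply: (@le_lt_trans _ _ (\sum_(i < n) (`|L| + 1) * (r i - l i))).
  apply: ler_sum => i _; have [al [lri rb]] := lr i.
  apply: (le_trans (gL _ _ _ _)); rewrite ?al ?rb ?(le_trans al lri) ?(le_trans lri rb)//.
  rewrite ger0_norm ?subr_ge0// ler_wpM2r ?subr_ge0//.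
  by rewrite (le_trans (ler_norm _))// lerDl.
by rewrite -mulr_sumr mulrC -ltr_pdivlMr.
Qed.

Lemma integrable_itvoo (g : R -> R) : continuous g ->
  mu.-integrable `]0%R, 1%R[ (EFin \o g).
Proof.
move=> cg; have ig : mu.-integrable `[0, 1] (EFin \o g).
  by apply: continuous_integrable_itv; exact: continuous_subspaceT.
by apply: integrableS ig => //; exact: subset_itvW.
Qed.

Lemma source_maxwellian (r v : R) : 0 < r -> r * maxwellian r^-1 v = source r v.
Proof.
move=> r0; rewrite /maxwellian /source mulrA; congr (_ * expR _).
  have p0 : 0 <= 2 * pi :> R by rewrite mulr_ge0// pi_ge0.
  rewrite powRN powR12_sqrt; last by rewrite mulr_ge0// invr_ge0 ltW.
  rewrite sqrtrM// sqrtrV; last exact: ltW.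
  have c2 : 2 * c = Num.sqrt (2 * pi) by rewrite /half_sqrt_2pi mulrC divfK.
  by rewrite c2 invfM invrK mulrA mulrAC.
by field; rewrite gt_eqF.
Qed.

Section facts.
Variables (kappa s1 s2 s eta : R).
Hypothesis rg : regime kappa s1 s2 s eta.
Variable rho : R -> R.
Hypothesis ad : admissible s rho.
Hypothesis fp : forall x, 0 <= x <= 1 -> rho x = density_map kappa s1 s2 rho x.

Local Notation J1 := (inflow1 kappa s1 s2 rho).
Local Notation J2 := (inflow2 kappa s1 s2 rho).
Local Notation profile := (profile kappa s1 s2 rho).
Local Notation rightward := (rightward kappa s1 s2 rho).
Local Notation leftward := (leftward kappa s1 s2 rho).

Definition mass : R := \int[mu]_(x in `]0%R, 1%R[) rho x.

Lemma integrable_rho : mu.-integrable `]0%R, 1%R[ (EFin \o rho).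
Proof.
apply: integrable_itvoo; exact: adm_cont ad.
Qed.

Lemma rho_bounds x : 0 <= x <= 1 -> 1 - 30 * eta <= s ^+ 2 * rho x <= 1 + 30 * eta.
Proof.
move=> x01; have := density_map_bound rg ad x01; rewrite -fp// ler_norml.
by move=> /andP[a b]; apply/andP; split; lra.
Qed.

Lemma mass_bounds : 1 - 30 * eta <= s ^+ 2 * mass <= 1 + 30 * eta.
Proof.
have s20 : 0 < s ^+ 2 by rewrite exprn_gt0// (s_gt0 rg).
have ic (k : R) : mu.-integrable `]0%R, 1%R[ (EFin \o (fun=> k)).
  by apply: integrable_itvoo => ?; exact: cvg_cst.
have Ec (k : R) : \int[mu]_(x in `]0%R, 1%R[) k = k.
  by rewrite Rintegral_cst//= lebesgue_measure_itv/= lte_fin ltr01/= subr0 mulr1.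
have B x : `]0, 1[%classic x -> 1 - 30 * eta <= s ^+ 2 * rho x <= 1 + 30 * eta.
  by rewrite /= in_itv/= => /andP[x0 x1]; apply: rho_bounds; rewrite !ltW.
apply/andP; split; rewrite [s ^+ 2 * mass]mulrC.
- rewrite -ler_pdivrMr// -[leLHS]Ec; apply: le_Rintegral; [by []|exact: ic|exact: integrable_rho|].
  by move=> x /B/andP[b _]; rewrite ler_pdivrMr// [rho x * _]mulrC.
- rewrite -ler_pdivlMr// -[leRHS]Ec; apply: le_Rintegral; [by []|exact: integrable_rho|exact: ic|].
  by move=> x /B/andP[_ b]; rewrite ler_pdivlMr// [rho x * _]mulrC.
Qed.

Lemma mass_gt0 : 0 < mass.
Proof.
have s20 : 0 < s ^+ 2 by rewrite exprn_gt0// (s_gt0 rg).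
rewrite -(pmulr_rgt0 _ s20); have /andP[m0 _] := mass_bounds.
apply: lt_le_trans m0; have := eta_small rg; lra.
Qed.

Definition state x v : R := mass^-1 * profile x v.

Lemma state_pos x v : 0 < v -> state x v = mass^-1 * rightward x v.
Proof. by move=> v0; rewrite /state profile_pos. Qed.

Lemma state_neg x v : 0 < v -> state x (- v) = mass^-1 * leftward x v.
Proof. by move=> v0; rewrite /state profile_neg. Qed.

Lemma measurable_state : measurable_fun setT (fun p : R * R => state p.1 p.2).
Proof. by apply: measurable_funM => //; exact: (measurable_profile rg ad). Qed.

Lemma measurable_state1 x : measurable_fun setT (state x).
Proof. exact: (measurableT_comp measurable_state (measurable_pair1 x)). Qed.

Lemma state_density x : 0 <= x <= 1 ->
  mu.-integrable setT (fun v => (state x v)%:E) /\ density state x = mass^-1 * rho x.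
Proof.
move=> x01; have [[r0 _ _] [l0 _ _]] := integrable_profile rg ad x01.
have ip : integrable_pos (state x).
  by apply: (eq_integrable_pos _ (integrable_posZ mass^-1 r0)) => v v0; rewrite state_pos.
have iN : integrable_pos (fun v => state x (- v)).
  by apply: (eq_integrable_pos _ (integrable_posZ mass^-1 l0)) => v v0; rewrite state_neg.
have [iT eT] := integral_line_split (measurable_state1 x) ip iN.
split; first exact: iT.
rewrite /density [LHS]eT (@eq_int_pos _ _ (fun v => mass^-1 * (rightward x v + leftward x v))); last first.
  by move=> v v0; rewrite state_pos// state_neg// -mulrDr.
by rewrite (int_posZ _ (integrable_posD r0 l0)) (int_posD r0 l0) (profile_density rg ad fp x01).
Qed.

Lemma state_momentum x : 0 <= x <= 1 -> momentum state x = 0.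
Proof.
move=> x01; have [[_ r1 _] [_ l1 _]] := integrable_profile rg ad x01.
have ip : integrable_pos (fun v => v * state x v).
  by apply: (eq_integrable_pos _ (integrable_posZ mass^-1 r1)) => v v0; rewrite state_pos// mulrCA.
have iN : integrable_pos (fun v => - v * state x (- v)).
  apply: (eq_integrable_pos _ (integrable_posZ (- mass^-1) l1)) => v v0.
  by rewrite state_neg// !mulNr mulrCA.
have mh : measurable_fun setT (fun v : R => v * state x v).
  by apply: measurable_funM => //; exact: measurable_state1.
have [_ eT] := integral_line_split mh ip iN.
have i12 : integrable_pos (fun v => v * (rightward x v - leftward x v)).
  apply: (eq_integrable_pos _ (integrable_posB r1 l1)) => v _.
  exact/esym/mulrBr.
rewrite /momentum [LHS]eT (@eq_int_pos _ _ (fun v => mass^-1 * (v * (rightward x v - leftward x v)))).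
  by rewrite (int_posZ _ i12) (profile_flux rg ad fp x01) mulr0.
move=> v v0; rewrite state_pos// state_neg//.
by move: (rightward x v) (leftward x v) => r l; ring.
Qed.

Lemma state_pressure x : 0 <= x <= 1 ->
  mu.-integrable setT (fun v : R => (v ^+ 2 * state x v)%:E) /\ pressure state x = mass^-1.
Proof.
move=> x01; have [[_ _ r2] [_ _ l2]] := integrable_profile rg ad x01.
have ip : integrable_pos (fun v => v ^+ 2 * state x v).
  by apply: (eq_integrable_pos _ (integrable_posZ mass^-1 r2)) => v v0; rewrite state_pos// mulrCA.
have iN : integrable_pos (fun v => (- v) ^+ 2 * state x (- v)).
  apply: (eq_integrable_pos _ (integrable_posZ mass^-1 l2)) => v v0.
  by rewrite state_neg// sqrrN mulrCA.
have mh : measurable_fun setT (fun v : R => v ^+ 2 * state x v).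
  by apply: measurable_funM; [exact: exprn_measurable|exact: measurable_state1].
have [iT eT] := integral_line_split mh ip iN.
have i12 : integrable_pos (fun v => v ^+ 2 * (rightward x v + leftward x v)).
  apply: (eq_integrable_pos _ (integrable_posD r2 l2)) => v _.
  exact/esym/mulrDr.
split; first exact: iT.
rewrite /pressure [LHS]eT (@eq_int_pos _ _ (fun v => mass^-1 * (v ^+ 2 * (rightward x v + leftward x v)))).
  by rewrite (int_posZ _ i12) (profile_pressure rg ad fp x01) mulr1.
move=> v v0; rewrite state_pos// state_neg// sqrrN.
by move: (rightward x v) (leftward x v) => r l; ring.
Qed.

Lemma state_temperature x : 0 <= x <= 1 -> temperature state x = (rho x)^-1.
Proof.
move=> x01; rewrite /temperature (state_density x01).2 (state_pressure x01).2.
have := admissible_gt0 (s_gt0 rg) ad x; have := mass_gt0 => m0 r0.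
by field; rewrite !gt_eqF.
Qed.

Lemma is_derive_state (x v : R) : 0 < x < 1 -> v != 0 ->
  is_derive x 1 (state ^~ v)
    (v^-1 * (kappa^-1 * (mass^-1 * source (rho x) v - state x v))).
Proof.
have m0 := mass_gt0.
move=> x01; rewrite neq_lt => /orP[v0|v0].
- have [w w0 ->] : exists2 w, 0 < w & v = - w by exists (- v); rewrite ?oppr_gt0 ?opprK.
  have D := is_derive_leftward kappa s1 s2 ad w x01.
  have -> : state ^~ (- w) = fun y => mass^-1 *: (leftward ^~ w) y.
    by apply/funext => y; rewrite state_neg.
  apply: is_derive_eq.
  rewrite state_neg// sourceN (rateE rg) (kappaV rg) /GRing.scale/=.
  move: (source _ _) (leftward _ _) => S l.
  by field; rewrite !gt_eqF.
- have D := is_derive_rightward kappa s1 s2 ad v x01.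
  have -> : state ^~ v = fun y => mass^-1 *: (rightward ^~ v) y.
    by apply/funext => y; rewrite state_pos.
  apply: is_derive_eq.
  rewrite state_pos// (rateE rg) (kappaV rg) /GRing.scale/=.
  move: (source _ _) (rightward _ _) => S r.
  by field; rewrite !gt_eqF.
Qed.

Lemma state_lipschitz v : v != 0 -> exists L, forall x y, 0 <= x <= 1 -> 0 <= y <= 1 ->
  `|state x v - state y v| <= L * `|x - y|.
Proof.
have m0 : 0 < mass^-1 by rewrite invr_gt0 mass_gt0.
rewrite neq_lt => /orP[v0|v0].
- have [w w0 ->] : exists2 w, 0 < w & v = - w by exists (- v); rewrite ?oppr_gt0 ?opprK.
  have [L HL] := leftward_lipschitz rg ad w0; exists (mass^-1 * L) => x y x01 y01.
  by rewrite !state_neg// -mulrBr normrM (gtr0_norm m0) -mulrA ler_pM2l// HL.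
- have [L HL] := rightward_lipschitz rg ad v0; exists (mass^-1 * L) => x y x01 y01.
  by rewrite !state_pos// -mulrBr normrM (gtr0_norm m0) -mulrA ler_pM2l// HL.
Qed.

Lemma zero01 : 0 <= (0 : R) <= 1. Proof. by rewrite lexx ler01. Qed.

(** As the total flux at x = 0 vanishes, the wall receives exactly what it emits,
    which is the diffusive boundary condition. *)
Lemma state_influx0 : mu.-integrable `]-oo, 0%R[ (fun v : R => (`|v| * state 0 v)%:E) /\
  \int[mu]_(v in `]-oo, 0%R[) (`|v| * state 0 v) = mass^-1 * J1.
Proof.
have [[_ r1 _] [_ l1 _]] := integrable_profile rg ad zero01.
have mh : measurable_fun setT (fun v : R => `|v| * state 0 v).
  by apply: measurable_funM => //; exact: measurable_state1.
have E v : 0 < v -> mass^-1 * (v * leftward 0 v) = `|- v| * state 0 (- v).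
  by move=> v0; rewrite state_neg// normrN gtr0_norm// mulrCA.
have iN : integrable_pos (fun v => `|- v| * state 0 (- v)).
  exact: (eq_integrable_pos E (integrable_posZ _ l1)).
have [i e] := integral_reflect mh iN; split; first exact: i.
rewrite [LHS]e -(eq_int_pos E) (int_posZ _ l1); congr (_ * _).
have := profile_flux rg ad fp zero01.
have -> : int_pos (fun v => v * (rightward 0 v - leftward 0 v)) =
    int_pos (fun v => v * rightward 0 v) - int_pos (fun v => v * leftward 0 v).
  by rewrite -(int_posB r1 l1); apply: eq_int_pos => v _; exact: mulrBr.
move=> /eqP; rewrite subr_eq0 => /eqP <-.
have [[_ w1 _] [_ e1 _]] := wall_moments (s1_gt0 rg).
rewrite (@eq_int_pos _ _ (fun v => J1 * (v * wall s1 v))).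
  by rewrite (int_posZ _ w1) e1 mulr1.
by move=> v _; rewrite /rightward /forward beam0 mulrCA.
Qed.

Lemma state_influx1 : mu.-integrable `]0%R, +oo[ (fun v : R => (`|v| * state 1 v)%:E) /\
  \int[mu]_(v in `]0%R, +oo[) (`|v| * state 1 v) = mass^-1 * J2.
Proof.
have [[_ r1 _] [_ l1 _]] := integrable_profile rg ad one01.
have E v : 0 < v -> mass^-1 * (v * rightward 1 v) = `|v| * state 1 v.
  by move=> v0; rewrite state_pos// gtr0_norm// mulrCA.
split; first exact: (eq_integrable_pos E (integrable_posZ _ r1)).
rewrite -[LHS](eq_int_pos E) (int_posZ _ r1); congr (_ * _).
by have [_ [_ er _]] := integrable_forward rg J1 ad (lexx s1) one01.
Qed.

Lemma state_steady : steady_state kappa (s1 ^+ 2) (s2 ^+ 2) state.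
Proof.
have oo (x : R) : 0 < x < 1 -> 0 <= x <= 1 by move=> /andP[x0 x1]; rewrite !ltW.
have m0 := mass_gt0; have r0 := admissible_gt0 (s_gt0 rg) ad.
split.
- exact: (measurable_funTS measurable_state).
- move=> x v x01; apply: mulr_ge0; first by rewrite invr_ge0 ltW.
  rewrite /profile; case: ifPn => [v0|_].
    by have /andP[] := rightward_bounds rg ad x01 v0.
  case: ifPn => // v0; rewrite -oppr_gt0 in v0.
  by have /andP[] := leftward_bounds rg ad x01 v0.
- by move=> x /oo x01; have [] := state_density x01.
- by move=> x /oo x01; have [] := state_pressure x01.
- by move=> x /oo x01; rewrite (state_density x01).2 mulr_gt0// invr_gt0.
- transitivity (\int[mu]_(x in `]0%R, 1%R[) (mass^-1 * rho x)).
    apply: eq_Rintegral => x; rewrite inE/= in_itv/= => /oo x01.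
    by rewrite (state_density x01).2.
  by rewrite RintegralZl//; [rewrite mulVf// gt_eqF|exact: integrable_rho].
- move=> v v0; have [L HL] := state_lipschitz v0.
  exact: lipschitz_absolutely_continuous HL.
- move=> v v0; apply: aeW => x x01; have D := is_derive_state x01 v0.
  split; first exact: ex_derive.
  have x01' := oo x x01.
  rewrite derive1E derive_val mulVKf// (state_density x01').2 (state_temperature x01').
  by rewrite -mulrA (source_maxwellian v (r0 x)).
- by have [] := state_influx0.
- by have [] := state_influx1.
- move=> v v0; rewrite state_influx0.2 state_pos//.
  by rewrite /rightward /forward beam0 mulrA mulrC.
- move=> v v0; rewrite state_influx1.2.
  have [w w0 ->] : exists2 w, 0 < w & v = - w by exists (- v); rewrite ?oppr_gt0 ?opprK.
  rewrite state_neg// /leftward /forward subrr beam0 /wall /wall_maxwellian sqrrN.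
  by rewrite mulrA mulrC.
Qed.

End facts.
End steady.

(** The density and the temperature of the state are rho / mass and 1 / rho.
    Both s ^ 2 * rho and s ^ 2 * mass are within 30 * eta of 1, and 75 is chosen
    so that (1 + 30 * eta) / (1 - 30 * eta) <= 1 + 75 * eta when eta is at most
    1 / 200. The latter bound is the fourth root of the condition
    kappa ^ 2 * T1 > 200 ^ 4. The factor 2 covers (1 - 30 * eta)^-1. The
    separation of the wall temperatures gives s1 <= s2. *)
Theorem theorem1 (R : realType) :
  exists g0 g1 g2 : R, [/\ 0 < g0, 0 < g1 & 0 < g2] /\
  exists C : R -> R -> R,
    (forall T1 T2 : R, 0 < T1 -> 0 < T2 -> 0 < C T1 T2) /\
  forall kappa T1 T2 : R, 0 < kappa -> 0 < T1 -> 0 < T2 ->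
    kappa ^+ 2 * T1 > g2 ->
    Num.sqrt T2 - Num.sqrt T1 >= g1 * kappa `^ 2^-1 * T2 `^ 4^-1 ->
  exists f : R -> R -> R,
  [/\ steady_state kappa T1 T2 f,
      forall x : R, 0 < x < 1 -> momentum f x = 0,
      forall x : R, 0 < x < 1 ->
        (1 - g0 * kappa `^ (- 2^-1) * T1 `^ (- 4^-1) <= density f x /\
         density f x <= 1 + g1 * kappa `^ (- 2^-1) * T1 `^ (- 4^-1)) /\
        (Num.sqrt (T1 * T2) <= C T1 T2 * pressure f x /\
         pressure f x <= C T1 T2 * Num.sqrt (T1 * T2)) &
      holder_continuous 2^-1 `]0%R, 1%R[ (temperature f) /\
      forall x : R, 0 < x < 1 ->
        Num.sqrt (T1 * T2) * (1 - g1 * kappa `^ (- 2^-1) * T1 `^ (- 4^-1))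
          <= C T1 T2 * temperature f x /\
        temperature f x <=
          C T1 T2 * (Num.sqrt (T1 * T2) *
            (1 + g0 * kappa `^ (- 2^-1) * T1 `^ (- 4^-1)))].
Proof.
exists 75, 75, (200 ^+ 4); split; first by split => //; rewrite exprn_gt0.
exists (fun _ _ => 2); split => // kappa T1 T2 k0 T10 T20 C1 C2.
pose s1 := Num.sqrt T1; pose s2 := Num.sqrt T2; pose s := Num.sqrt (s1 * s2).
pose eta := kappa `^ (- 2^-1) * T1 `^ (- 4^-1).
have s10 : 0 < s1 by rewrite sqrtr_gt0.
have s20 : 0 < s2 by rewrite sqrtr_gt0.
have e0 : 0 < eta by rewrite mulr_gt0// powR_gt0.
have e2 : eta ^+ 2 = kappa^-1 * s1^-1.
  rewrite /eta exprMn -!powR_mulrn ?powR_ge0// -!powRrM.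
  have -> : - 2^-1 * 2 = -1 :> R by rewrite mulNr mulVf.
  have -> : - 4^-1 * 2 = - 2^-1 :> R by rewrite -[4]/(2 * 2)%:R natrM; field.
  by rewrite powRN powRr1 ?(ltW k0)// powRN powR12_sqrt ?(ltW T10).
have rg : regime kappa s1 s2 s eta.
  split => //.
  - rewrite -(@ler_pXn2r _ 4) ?nnegrE ?(ltW e0)//.
    have -> : eta ^+ 4 = (kappa ^+ 2 * T1)^-1.
      rewrite (exprM eta 2 2) e2 -invfM exprVn exprMn sqr_sqrtr ?(ltW T10)//.
    rewrite exprVn lef_pV2 ?posrE ?exprn_gt0 ?mulr_gt0 ?exprn_gt0//.
    exact: ltW.
  - rewrite -subr_ge0; apply: le_trans C2.
    by rewrite mulr_ge0 ?powR_ge0// mulr_ge0 ?powR_ge0.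
  - by rewrite sqrtr_gt0 mulr_gt0.
  - by rewrite sqr_sqrtr// mulr_ge0 ?ltW.
  - by rewrite e2 divfK ?gt_eqF.
have [rho [_ rhoH] [ad fp]] := density_fixed_point rg.
have {}fp x : 0 <= x <= 1 -> rho x = density_map kappa s1 s2 rho x.
  by move=> x01; rewrite fp clamp_id.
have oo (x : R) : 0 < x < 1 -> 0 <= x <= 1 by move=> /andP[x0 x1]; rewrite !ltW.
have s2E : Num.sqrt (T1 * T2) = s ^+ 2.
  by rewrite (s_sqr rg) sqrtrM// ltW.
have ss0 : 0 < s ^+ 2 by rewrite exprn_gt0// (s_gt0 rg).
have m0 := mass_gt0 rg ad fp; have /andP[mb1 mb2] := mass_bounds rg ad fp.
have es := eta_small rg.
have rb x (x01 : 0 <= x <= 1) := rho_bounds rg ad fp x01.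
have r0 := admissible_gt0 (s_gt0 rg) ad.
rewrite s2E; exists (state kappa s1 s2 rho); split.
- have := state_steady rg ad fp.
  by rewrite !sqr_sqrtr ?(ltW T10) ?(ltW T20).
- by move=> x /oo x01; exact: (state_momentum rg ad fp x01).
- move=> x /oo x01; rewrite -!mulrA -/eta.
  rewrite (state_density rg ad fp x01).2 (state_pressure rg ad fp x01).2.
  have /andP[ra rb'] := rb x x01.
  move: (rho x) (mass rho) m0 mb1 mb2 ra rb' => r m m0 mb1 mb2 ra rb'.
  split; split.
  + rewrite [m^-1 * r]mulrC ler_pdivlMr// -(ler_pM2l ss0).
    by apply: le_trans ra; clear -e0 es mb2; nra.
  + rewrite [m^-1 * r]mulrC ler_pdivrMr// -(ler_pM2l ss0).
    by apply: (le_trans rb'); clear -e0 es mb1; nra.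
  + by rewrite ler_pdivlMr//; apply: (le_trans mb2); clear -es; lra.
  + rewrite -div1r ler_pdivrMr//.
    by rewrite -mulrA; clear -mb1 es; lra.
- split.
    exists (4 * s ^+ 4 * holder_density s1 s2 s eta) => x y.
    rewrite /= !in_itv/= => /oo x01 /oo y01.
    rewrite (state_temperature rg ad fp x01) (state_temperature rg ad fp y01).
    rewrite powR12_sqrt//.
    have P z : 0 <= z <= 1 -> (rho z)^-1 <= 2 * s ^+ 2.
      move=> z01; have /andP[ra _] := rb z z01.
      by rewrite -div1r ler_pdivrMr// -mulrA; clear -ra es; lra.
    have -> : (rho x)^-1 - (rho y)^-1 = - (rho x - rho y) * ((rho x)^-1 * (rho y)^-1).
      by field; rewrite !gt_eqF.
    rewrite normrM normrN mulrC (gtr0_norm (_ : 0 < (rho x)^-1 * (rho y)^-1)); last first.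
      by rewrite mulr_gt0// invr_gt0.
    rewrite (_ : 4 * s ^+ 4 * _ * _ = (2 * s ^+ 2 * (2 * s ^+ 2)) * (holder_density s1 s2 s eta * Num.sqrt `|x - y|)); last by ring.
    apply: ler_pM => //.
    + by rewrite mulr_ge0// invr_ge0 ltW.
    + by apply: ler_pM; rewrite ?invr_ge0 ?P// ltW.
  move=> x /oo x01; rewrite -!mulrA -/eta (state_temperature rg ad fp x01).
  have /andP[ra rb'] := rb x x01; have rx := r0 x.
  move: (rho x) rx ra rb' => r rx ra rb'.
  split.
  + rewrite ler_pdivlMr//.
    rewrite (_ : _ * _ * r = (s ^+ 2 * r) * (1 - 75 * eta)); last by ring.
    by move: (s ^+ 2 * r) ra rb' => u ra rb'; clear -e0 es ra rb'; nra.
  + rewrite -div1r ler_pdivrMr//.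
    rewrite (_ : _ * r = 2 * ((s ^+ 2 * r) * (1 + 75 * eta))); last by ring.
    by move: (s ^+ 2 * r) ra rb' => u ra rb'; clear -e0 es ra rb'; nra.
Qed.
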